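(* Let $(A,[\cdot,\cdot],a)$ be a Lie algebroid over a smooth manifold $M$. Let $\mathrm{H}^\bullet(\mathfrak{J}A;A)$ be the cohomology of the cochain complex $(\Gamma(\mathrm{Hom}(\wedge^\bullet\mathfrak{J}A,A)_{\mathfrak{D}A}),\mathrm{d}_{\mathfrak{J}})$ and let $\mathrm{H}^\bullet_{\mathrm{def}}(A)$ be the deformation cohomology of $A$. Then $$\mathrm{H}^\bullet(\mathfrak{J}A;A)\cong \mathrm{H}^\bullet_{\mathrm{def}}(A).$$
   Context: Everything is smooth; $\mathrm{d}$ is the de Rham differential. A Lie algebroid $(A,[\cdot,\cdot],a)$ over $M$ is a vector bundle $A\to M$ with a Lie bracket on $\Gamma(A)$ and a bundle map (anchor) $a:A\to TM$ with $[X,fY]=f[X,Y]+a(X)(f)Y$. Gauge Lie algebroid. $\mathfrak{D}A$ is the vector bundle over $M$ whose sections are the $\mathbb{R}$-linear maps $\mathfrak d:\Gamma(A)\to\Gamma(A)$ for which there is a vector field $\mathrm{j}(\mathfrak d)$ with $\mathfrak d(fu)=f\,\mathfrak d u+\mathrm{j}(\mathfrak d)(f)u$; it is a Lie algebroid with the commutator bracket $[\cdot,\cdot]_{\mathfrak D}$ and anchor $\mathrm{j}:\mathfrak{D}A\to TM$. Jet bundle. $\mathfrak{J}A$ is the first jet bundle of $A$, with projection $\mathrm{p}:\mathfrak{J}A\to A$, $[u]_m\mapsto u(m)$, whose kernel is identified with $\mathrm{Hom}(TM,A)=T^*M\otimes A$. For $u\in\Gamma(A)$, $\mathbf{d}u\in\Gamma(\mathfrak{J}A)$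 is its 1-jet prolongation; the identification of the kernel is such that $\mathbf{d}(fu)=\mathrm{d}f\otimes u+f\,\mathbf{d}u$. There is a nondegenerate $A$-valued pairing $\langle\mu,\mathfrak d\rangle_A=\langle\mathfrak d,\mu\rangle_A=\mathfrak d u$ for $\mu=[u]_m\in\mathfrak{J}A$, $\mathfrak d\in\mathfrak{D}A$; for $\eta\in\mathrm{Hom}(TM,A)$ it gives $\langle\eta,\mathfrak d\rangle_A=\eta(\mathrm{j}(\mathfrak d))$. Via this pairing $\mathfrak{D}A\subset\mathrm{Hom}(\mathfrak{J}A,A)$. Jet Lie algebroid. Let $\pi:\mathfrak{J}A\to\mathfrak{D}A$ be the bundle map with $\pi(\mathbf{d}u)(v)=[u,v]$ for $u,v\in\Gamma(A)$. For $\mathfrak d\in\Gamma(\mathfrak{D}A)$ and $\mu\in\Gamma(\mathfrak{J}A)$ define $L_{\mathfrak d}\mu\in\Gamma(\mathfrak{J}A)$ by $\langle L_{\mathfrak d}\mu,\mathfrak d'\rangle_A=\mathfrak d\langle\mu,\mathfrak d'\rangle_A-\langle\mu,[\mathfrak d,\mathfrak d']_{\mathfrak D}\rangle_A$. Then $\mathfrak{J}A$ with bracket $[\mu,\nu]_\pi=L_{\pi(\mu)}\nu-L_{\pi(\nu)}\mu-\mathbf{d}\langle\pi(\mu),\nu\rangle_A$ and anchor $\mathrm{j}\circ\pi$ is a Lie algebroid, and $\pi$ is a representation of it on $A$. Let $\mathrm{d}_{\mathfrak{J}}$ be the corresponding Chevalley–Eilenberg coboundary on $\Gamma(\mathrm{Hom}(\wedge^\bullet\mathfrak{J}A,A))$: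 $$(\mathrm{d}_{\mathfrak J}\mathfrak d)(\mu_1,\dots,\mu_{k+1})=\sum_i(-1)^{i+1}\pi(\mu_i)\mathfrak d(\dots,\widehat{\mu_i},\dots)+\sum_{i<j}(-1)^{i+j}\mathfrak d([\mu_i,\mu_j]_\pi,\dots,\widehat{\mu_i},\dots,\widehat{\mu_j},\dots).$$ Subcomplex. For $k\ge2$ and $\mathrm{rank}\,A\ge2$, $\mathrm{Hom}(\wedge^k\mathfrak{J}A,A)_{\mathfrak{D}A}$ is the bundle of all $\mathfrak d\in\mathrm{Hom}(\wedge^k\mathfrak{J}A,A)$ such that $\mathfrak d(\mu_1,\dots,\mu_{k-1},\cdot)\in\mathfrak{D}A\subset\mathrm{Hom}(\mathfrak{J}A,A)$ for all $\mu_i$. For $k=0$ it is $A$ and for $k=1$ it is $\mathfrak{D}A$. For $k\ge2$ and $\mathrm{rank}\,A=1$ it consists of those $\mathfrak d$ for which there is $\lambda\in\mathrm{Hom}(\wedge^{k-1}A,TM)$ with $\mathfrak d(\mu_1,\dots,\mu_{k-1},\eta)=\eta(\lambda(\mathrm{p}\mu_1,\dots,\mathrm{p}\mu_{k-1}))$ for all $\mu_i\in\mathfrak{J}A$, $\eta\in\mathrm{Hom}(TM,A)$ (in rank $\ge 2$ this condition holds automatically). The sections of these bundles form a subcomplex for $\mathrm{d}_{\mathfrak{J}}$. Deformation cohomology. $C^n_{\mathrm{def}}(A)$ consists of the skew-symmetric $\mathbb{R}$-multilinear maps $D:\Gamma(A)^n\to\Gamma(A)$ that are multiderivations: there is $\sigma_D\in\Gamma(\mathrm{Hom}(\wedge^{n-1}A,TM))$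 (the symbol) with $D(u_1,\dots,fu_n)=fD(u_1,\dots,u_n)+\sigma_D(u_1,\dots,u_{n-1})(f)u_n$; $C^0_{\mathrm{def}}(A)=\Gamma(A)$. The coboundary is $$\delta(D)(u_0,\dots,u_n)=\sum_i(-1)^i[u_i,D(u_0,\dots,\widehat{u_i},\dots,u_n)]+\sum_{i<j}(-1)^{i+j}D([u_i,u_j],u_0,\dots,\widehat{u_i},\dots,\widehat{u_j},\dots,u_n),$$ and $\mathrm{H}^\bullet_{\mathrm{def}}(A)$ is the cohomology of $(C^\bullet_{\mathrm{def}}(A),\delta)$. *)

(* Defs.v *)
From HB Require Import structures.
From mathcomp Require Import all_boot all_order all_fingroup all_algebra.
From mathcomp Require Import all_classical all_reals all_analysis.
From mathcomp Require Import ring.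
Set Implicit Arguments.
Unset Strict Implicit.
Unset Printing Implicit Defensive.
Import Order.TTheory GRing.Theory Num.Theory.
Import numFieldNormedType.Exports.
Local Open Scope classical_set_scope.
Local Open Scope ring_scope.

Section DependentFunctions.
Variables (R : pzRingType) (I : Type) (F : I -> lmodType R).

Definition dfun := forall i, F i.

HB.instance Definition _ := gen_eqMixin dfun.
HB.instance Definition _ := gen_choiceMixin dfun.

Let dadd (s t : dfun) : dfun := fun i => s i + t i.
Let dopp (s : dfun) : dfun := fun i => - s i.
Let dzero : dfun := fun=> 0.
Let dscale (a : R) (s : dfun) : dfun := fun i => a *: s i.

Fact daddA : associative dadd.
Proof. by move=> s t u; apply: functional_extensionality_dep => i; exact: addrA. Qed.
Fact daddC : commutative dadd.
Proof. by move=> s t; apply: functional_extensionality_dep => i; exact: addrC. Qed.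
Fact dadd0 : left_id dzero dadd.
Proof. by move=> s; apply: functional_extensionality_dep => i; exact: add0r. Qed.
Fact daddN : left_inverse dzero dopp dadd.
Proof. by move=> s; apply: functional_extensionality_dep => i; exact: addNr. Qed.
HB.instance Definition _ := GRing.isZmodule.Build dfun daddA daddC dadd0 daddN.

Fact dscaleA a b s : dscale a (dscale b s) = dscale (a * b) s.
Proof. by apply: functional_extensionality_dep => i; exact: scalerA. Qed.
Fact dscale1 : left_id 1 dscale.
Proof. by move=> s; apply: functional_extensionality_dep => i; exact: scale1r. Qed.
Fact dscaleDr : right_distributive dscale +%R.
Proof. by move=> a s t; apply: functional_extensionality_dep => i; exact: scalerDr. Qed.
Fact dscaleDl s : {morph dscale^~ s : a b / a + b}.
Proof. by move=> a b; apply: functional_extensionality_dep => i; exact: scalerDl. Qed.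
HB.instance Definition _ :=
  GRing.Zmodule_isLmodule.Build R dfun dscaleA dscale1 dscaleDr dscaleDl.

Lemma dfunPE (a : R) (s t : dfun) i : (a *: s + t) i = a *: s i + t i.
Proof. by []. Qed.

End DependentFunctions.

Section SubAndQuotient.
Variables (R : pzRingType) (V : lmodType R).

Record subspace := Subspace {
  in_subspace :> V -> Prop;
  subspace0 : in_subspace 0;
  subspaceP : forall a x y,
    in_subspace x -> in_subspace y -> in_subspace (a *: x + y) }.

Variable S : subspace.

Definition subspace_pred : {pred V} := fun x => `[< S x >].

Fact subspace_pred_closed : submod_closed subspace_pred.
Proof.
split=> [|a x y]; first exact/asboolP/subspace0.
by move=> /asboolP Sx /asboolP Sy; apply/asboolP/subspaceP.
Qed.
HB.instance Definition _ :=
  GRing.isSubmodClosed.Build R V subspace_pred subspace_pred_closed.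

Record sub_lmod := SubLmod { sub_val : V; _ : sub_val \in subspace_pred }.
HB.instance Definition _ := [isSub for sub_val].
HB.instance Definition _ := [Choice of sub_lmod by <:].
HB.instance Definition _ := [SubChoice_isSubLmodule of sub_lmod by <:].

Definition sub_mk (x : V) (Sx : S x) : sub_lmod := SubLmod (introT (asboolP _) Sx).

Lemma sub_valP (x : sub_lmod) : S (sub_val x).
Proof. by case: x => x Sx; apply/asboolP. Qed.

Definition quot_lmod := Quotient.quot subspace_pred.
HB.instance Definition _ := GRing.Zmodule.on quot_lmod.

Definition quot_pi (x : V) : quot_lmod := \pi_(Quotient.quot subspace_pred)%qT x.
Definition quot_repr (x : quot_lmod) : V := generic_quotient.repr x.

Lemma quot_piK (x : quot_lmod) : quot_pi (quot_repr x) = x.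
Proof. exact: reprK. Qed.

Lemma quot_piP (x y : V) : quot_pi x = quot_pi y <-> S (x - y).
Proof.
rewrite /quot_pi; split=> [/eqP|Sxy]; rewrite -?Quotient.idealrBE.
  by move/asboolP.
by apply/eqP; rewrite -Quotient.idealrBE; exact/asboolP.
Qed.

Lemma quot_piD (x y : V) : quot_pi (x + y) = quot_pi x + quot_pi y.
Proof. exact: Quotient.pi_add. Qed.

Let qscale (a : R) (x : quot_lmod) : quot_lmod := quot_pi (a *: quot_repr x).

Fact quot_piZ (a : R) (x : V) : quot_pi (a *: x) = qscale a (quot_pi x).
Proof.
apply/quot_piP; rewrite -scalerBr -[_ *: _]addr0; apply: subspaceP; last exact: subspace0.
by apply/quot_piP; rewrite quot_piK.
Qed.

Fact qscaleA a b x : qscale a (qscale b x) = qscale (a * b) x.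
Proof. by rewrite -[x]quot_piK -!quot_piZ scalerA. Qed.
Fact qscale1 : left_id 1 qscale.
Proof. by move=> x; rewrite -[x]quot_piK -quot_piZ scale1r. Qed.
Fact qscaleDr : right_distributive qscale +%R.
Proof.
move=> a x y; rewrite -[x]quot_piK -[y]quot_piK.
by rewrite -quot_piD -!quot_piZ -quot_piD scalerDr.
Qed.
Fact qscaleDl x : {morph qscale^~ x : a b / a + b}.
Proof. by move=> a b; rewrite -[x]quot_piK -!quot_piZ -quot_piD scalerDl. Qed.
HB.instance Definition _ :=
  GRing.Zmodule_isLmodule.Build R quot_lmod qscaleA qscale1 qscaleDr qscaleDl.

Fact quot_pi_linear : linear quot_pi.
Proof. by move=> a x y; rewrite quot_piD quot_piZ. Qed.
HB.instance Definition _ := GRing.isLinear.Build R V quot_lmod *:%R quot_pi quot_pi_linear.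

End SubAndQuotient.

Section Smooth.
Variables (R : realType) (n : nat).
Implicit Types (U : set 'rV[R]_n) (f g : 'rV[R]_n -> R).

Definition partial (i : 'I_n) f : 'rV[R]_n -> R := 'D_(delta_mx 0 i) f.

Fixpoint Ck (k : nat) U f : Prop :=
  (forall x, U x -> {for x, continuous f}) /\
  match k with
  | 0 => True
  | k'.+1 => forall i : 'I_n,
      (forall x, U x -> derivable f x (delta_mx 0 i)) /\ Ck k' U (partial i f)
  end.

Definition smooth U f : Prop := forall k, Ck k U f.

Lemma open_near_eq U f g x : open U -> (forall z, U z -> f z = g z) -> U x ->
  {near x, f =1 g}.
Proof. by move=> oU fg Ux; near=> z; apply: fg; near: z; exact: open_nbhs_nbhs. 
Unshelve. all: by end_near. Qed.

Lemma cont_ext U f g x : open U -> (forall z, U z -> f z = g z) -> U x ->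
  {for x, continuous f} -> {for x, continuous g}.
Proof.
move=> oU fg Ux; rewrite /prop_for /continuous_at -(fg _ Ux) => cf.
exact: cvg_trans (near_eq_cvg (open_near_eq oU fg Ux)) cf.
Qed.

Lemma Ck_ext k U f g : open U -> (forall z, U z -> f z = g z) ->
  Ck k U f -> Ck k U g.
Proof.
move=> oU; elim: k f g => [|k IH] f g fg /= [cf df].
- by split=> // x Ux; exact: cont_ext oU fg Ux (cf _ Ux).
- split=> [x Ux|i]; first exact: cont_ext oU fg Ux (cf _ Ux).
  have [dfi Cfi] := df i; split=> [x Ux|].
    exact: near_eq_derivable (open_near_eq oU fg Ux) (dfi _ Ux).
  apply: IH Cfi => z Uz; apply: near_eq_derive.
  exact: open_near_eq oU fg Uz.
Qed.

Lemma Ck_cont k U f : Ck k U f -> forall x, U x -> {for x, continuous f}.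
Proof. by case: k => [|k] []. Qed.

Lemma Ck_pred k U f : Ck k.+1 U f -> Ck k U f.
Proof.
elim: k f => [|k IH] f; first by case=> cf _; split.
by move=> [cf df]; split=> // i; have [dfi /IH] := df i; split.
Qed.

Lemma cont_lin (a : R) f g x : {for x, continuous f} -> {for x, continuous g} ->
  {for x, continuous (a *: f + g)}.
Proof.
move=> cf cg; have cz : {for x, continuous (a *: f)} by exact: (@continuousZl_tmp R R^o).
exact: continuousD cz cg.
Qed.

Lemma Ck_lin k U (a : R) f g : open U -> Ck k U f -> Ck k U g ->
  Ck k U (a *: f + g).
Proof.
move=> oU; elim: k f g => [|k IH] f g.
  by move=> [cf _] [cg _]; split=> // x Ux; apply: cont_lin; [exact: cf|exact: cg].
move=> [cf df] [cg dg]; split=> [x Ux|i].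
  by apply: cont_lin; [exact: cf|exact: cg].
have [dfi Cfi] := df i; have [dgi Cgi] := dg i; split=> [x Ux|].
  by apply: derivableD; [apply: derivableZ; exact: dfi|exact: dgi].
apply: Ck_ext (IH _ _ Cfi Cgi) => // x Ux.
rewrite /partial deriveD ?deriveZ //; [exact: dfi|apply: derivableZ; exact: dfi|exact: dgi].
Qed.

Lemma Ck_mul k U f g : open U -> Ck k U f -> Ck k U g -> Ck k U (f * g).
Proof.
move=> oU; elim: k f g => [|k IH] f g.
  by move=> [cf _] [cg _]; split=> // x Ux; exact: (continuousM (cf _ Ux) (cg _ Ux)).
move=> Cf Cg; have [cf df] := Cf; have [cg dg] := Cg; split=> [x Ux|i].
  exact: (continuousM (cf _ Ux) (cg _ Ux)).
have [dfi Cfi] := df i; have [dgi Cgi] := dg i; split=> [x Ux|].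
  by apply: derivableM; [exact: dfi|exact: dgi].
have h := Ck_lin 1 oU (IH _ _ (Ck_pred Cf) Cgi) (IH _ _ (Ck_pred Cg) Cfi).
apply: Ck_ext h => // x Ux.
rewrite scale1r; apply/esym; apply: deriveM; [exact: dfi|exact: dgi].
Qed.

Lemma Ck0 k U : Ck k U 0.
Proof.
have c0 (x : 'rV[R]_n) : {for x, continuous (0 : 'rV[R]_n -> R)}.
  exact: (@cst_continuous _ _ (0 : R)).
elim: k => [|k IH]; first by split.
split=> // i.
split=> [x _|]; first exact: derivable_cst.
suff -> : partial i 0 = 0 by [].
by apply/funext => x; rewrite /partial derive_cst.
Qed.

Lemma Ck_sub k U U' f : U `<=` U' -> Ck k U' f -> Ck k U f.
Proof.
move=> UU'; elim: k f => [|k IH] f [cf df].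
  by split=> // x /UU'; exact: cf.
split=> [x /UU'|i]; first exact: cf.
by have [dfi /IH] := df i; split=> // x /UU'; exact: dfi.
Qed.

End Smooth.

Section Charts.
Variables (R : realType) (T : topologicalType) (n : nat).

(* A homeomorphism from the open set [cdom] onto an open subset of R^n;
   [cinv] is only meaningful on the open set [cmap @` cdom]. *)
Record chart := Chart {
  cdom : set T;
  cmap : T -> 'rV[R]_n;
  cinv : 'rV[R]_n -> T;
  cdom_open : open cdom;
  cimg_open : open (cmap @` cdom);
  cmapK : forall x, cdom x -> cinv (cmap x) = x;
  cmap_continuous : {within cdom, continuous cmap};
  cinv_continuous : {within cmap @` cdom, continuous cinv} }.

Definition chart_image (c : chart) (W : set T) : set 'rV[R]_n :=
  cmap c @` (cdom c `&` W).

Definition smooth_in (c : chart) (W : set T) (f : T -> R) : Prop :=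
  smooth (chart_image c W) (f \o cinv c).

Lemma chart_image_open c W : open W -> open (chart_image c W).
Proof.
move=> oW.
have -> : chart_image c W = (cmap c @` cdom c) `&` (cinv c @^-1` W).
  apply/seteqP; split=> z.
    by move=> [x [cx Wx] <-]; split; [exists x|rewrite /= cmapK].
  by move=> [[x cx <-]] /=; rewrite cmapK // => Wx; exists x.
have := @cinv_continuous c.
rewrite continuous_open_subspace; last exact: cimg_open.
move=> cc; rewrite openE => z [cz Wz].
have ncz : nbhs z (cmap c @` cdom c).
  by apply: open_nbhs_nbhs; split; first exact: cimg_open.
apply: (@filterI _ (nbhs z) _ _ _ ncz).
by apply: (cc z); [exact/mem_set|apply: open_nbhs_nbhs].
Qed.

Lemma smooth_in_ext c W f g : open W -> (forall x, cdom c x -> W x -> f x = g x) ->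
  smooth_in c W f -> smooth_in c W g.
Proof.
move=> oW fg Sf k; apply: Ck_ext (Sf k); first exact: chart_image_open.
by move=> _ [x [cx Wx] <-] /=; rewrite cmapK // fg.
Qed.

Lemma smooth_in_lin c W (a : R) f g : open W ->
  smooth_in c W f -> smooth_in c W g -> smooth_in c W (fun x => a * f x + g x).
Proof.
by move=> oW Sf Sg k; apply: Ck_lin (Sf k) (Sg k); exact: chart_image_open.
Qed.

Lemma smooth_in_mul c W f g : open W ->
  smooth_in c W f -> smooth_in c W g -> smooth_in c W (fun x => f x * g x).
Proof.
by move=> oW Sf Sg k; apply: Ck_mul (Sf k) (Sg k); exact: chart_image_open.
Qed.

Lemma smooth_in0 c W : smooth_in c W (fun=> 0).
Proof. by move=> k; exact: Ck0. Qed.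

End Charts.

Section Manifolds.
Variables (R : realType) (n : nat).

Record manifold := Manifold {
  mspace :> topologicalType;
  mspace_hausdorff : hausdorff_space mspace;
  mspace_second_countable : @second_countable mspace;
  atlas : set (chart R mspace n);
  atlas_cover : forall x, exists2 c, atlas c & cdom c x;
  atlas_compatible : forall c c', atlas c -> atlas c' ->
    forall i, smooth_in c (cdom c') (fun x => cmap c' x 0 i) }.

Variable M : manifold.

Definition smooth_on (W : set M) (f : M -> R) : Prop :=
  forall c, atlas c -> smooth_in c W f.

Definition Cinf_space : subspace (M -> R^o).
Proof.
exists (smooth_on setT) => [c _|a f g Sf Sg c Ac]; first exact: smooth_in0.
by apply: smooth_in_lin; [exact: openT|exact: Sf|exact: Sg].
Defined.

Definition Cinf := sub_lmod Cinf_space.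
HB.instance Definition _ := GRing.Lmodule.on Cinf.
Definition Cinf_fun (f : Cinf) : M -> R := sub_val f.
Coercion Cinf_fun : Cinf >-> Funclass.

Lemma Cinf_smooth (f : Cinf) : smooth_on setT f.
Proof. exact: (sub_valP f). Qed.

Fact Cinf_mul_smooth (f g : Cinf) : Cinf_space (fun m => f m * g m).
Proof.
move=> c Ac; apply: smooth_in_mul; first exact: openT.
  exact: Cinf_smooth.
exact: Cinf_smooth.
Qed.
Definition Cinf_mul (f g : Cinf) : Cinf := sub_mk (Cinf_mul_smooth f g).

(* Tangent vectors are point derivations of the algebra of smooth functions. *)
Definition tangent_space (m : M) : subspace (Cinf -> R^o).
Proof.
exists (fun v => linear v /\
  forall f g, v (Cinf_mul f g) = f m * v g + g m * v f).
- by split=> [a f g|f g]; rewrite ?mulr0 ?scaler0 ?addr0.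
- move=> a v w [vl vM] [wl wM]; split=> [b f g|f g].
    rewrite !fctE vl wl !scalerDr !scalerA mulrC -!addrA; congr (_ + _).
    by rewrite addrCA.
  by rewrite !fctE vM wM !scalerDr /GRing.scale /=; ring.
Defined.

Definition tangent (m : M) := sub_lmod (tangent_space m).
HB.instance Definition _ m := GRing.Lmodule.on (tangent m).
Definition tangent_fun m (v : tangent m) : Cinf -> R := sub_val v.
Coercion tangent_fun : tangent >-> Funclass.

Definition vector_field_space : subspace (dfun tangent).
Proof.
exists (fun X => forall f : Cinf, smooth_on setT (fun m => (X m : tangent m) f)).
- by move=> f c _; exact: smooth_in0.
- move=> a X Y SX SY f c Ac; apply: smooth_in_lin; first exact: openT.
    exact: SX.
  exact: SY.
Defined.

Definition vector_field := sub_lmod vector_field_space.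
HB.instance Definition _ := GRing.Lmodule.on vector_field.
Definition vector_field_at (X : vector_field) (m : M) : tangent m := sub_val X m.
Coercion vector_field_at : vector_field >-> Funclass.

End Manifolds.

Section VectorBundles.
Variables (R : realType) (n : nat) (M : manifold R n) (r : nat).

(* [tmap m] is only meaningful for [m] in [tdom]. *)
Record trivialization (F : M -> lmodType R) := Trivialization {
  tdom : set M;
  tmap : forall m, {linear F m -> 'rV[R]_r};
  tdom_open : open tdom;
  tmap_bij : forall m, tdom m -> bijective (tmap m) }.

(* The topology and smooth structure of the total space are those induced by
   the trivializations, whose transition functions are smooth. *)
Record vbundle := VBundle {
  fiber :> M -> lmodType R;
  trivs : set (trivialization fiber);
  trivs_cover : forall m, exists2 t, trivs t & tdom t m;
  trivs_compatible : forall t t', trivs t -> trivs t' ->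
    exists g : M -> 'M[R]_r,
      (forall i j, smooth_on (tdom t `&` tdom t') (fun m => g m i j)) /\
      (forall m, tdom t m -> tdom t' m ->
         forall x, tmap t' m x = tmap t m x *m g m) }.

Variable A : vbundle.

Definition tcoord (t : trivialization A) (j : 'I_r) (s : dfun A) (m : M) : R :=
  tmap t m (s m) 0 j.

Lemma tcoord_lin t j a (s s' : dfun A) m :
  tcoord t j (a *: s + s') m = a * tcoord t j s m + tcoord t j s' m.
Proof. by rewrite /tcoord dfunPE linearP !mxE. Qed.

Definition section_space : subspace (dfun A).
Proof.
exists (fun s => forall t, trivs t -> forall j, smooth_on (tdom t) (tcoord t j s)).
- move=> t _ j c _; apply: smooth_in_ext (smooth_in0 _ _); first exact: tdom_open.
  by move=> m _ _; rewrite /tcoord linear0 mxE.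
- move=> a s s' Ss Ss' t tt j c Ac.
  apply: smooth_in_ext (smooth_in_lin a _ (Ss t tt j c Ac) (Ss' t tt j c Ac));
    try exact: tdom_open.
  by move=> m _ _; rewrite tcoord_lin.
Defined.

Definition sections := sub_lmod section_space.
HB.instance Definition _ := GRing.Lmodule.on sections.
Definition section_dfun (u : sections) : dfun A := sub_val u.
Definition section_at (u : sections) (m : M) : A m := section_dfun u m.
Coercion section_at : sections >-> Funclass.

Lemma section_lin (a : R) (u v : sections) m :
  section_at (a *: u + v) m = a *: u m + v m.
Proof. by []. Qed.

Fact fscale_smooth (f : Cinf M) (u : sections) :
  section_space (fun m => f m *: u m).
Proof.
move=> t tt j c Ac.
have Sf : smooth_in c (tdom t) f.
  have Sf := Cinf_smooth f Ac.
  by move=> k; apply: Ck_sub (Sf k) => _ [x [cx _] <-]; exists x.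
have Su := sub_valP u t tt j c Ac.
have oW := tdom_open t.
apply: (smooth_in_ext oW _ (smooth_in_mul oW Sf Su)).
by move=> m _ _; rewrite /tcoord linearZ mxE.
Qed.
Definition fscale (f : Cinf M) (u : sections) : sections := sub_mk (fscale_smooth f u).

(* The section with values [s]; it is only used for smooth [s]. *)
Definition section_of (s : forall m, A m) : sections :=
  xget 0 [set u : sections | forall m, u m = s m].

Definition tderiv (c : chart R M n) (t : trivialization A) (j : 'I_r) (i : 'I_n)
    (u : sections) (m : M) : R :=
  partial i (tcoord t j (section_dfun u) \o cinv c) (cmap c m).

Lemma tderiv_lin c t j i a (u v : sections) m :
  atlas c -> trivs t -> cdom c m -> tdom t m ->
  tderiv c t j i (a *: u + v) m = a * tderiv c t j i u m + tderiv c t j i v m.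
Proof.
move=> Ac tt cm tm; rewrite /tderiv.
have -> : tcoord t j (section_dfun (a *: u + v)) \o cinv c =
   a *: (tcoord t j (section_dfun u) \o cinv c) + (tcoord t j (section_dfun v) \o cinv c).
  by apply/funext => z; rewrite /= tcoord_lin.
have D (w : sections) :
    derivable (tcoord t j (section_dfun w) \o cinv c) (cmap c m) (delta_mx 0 i).
  have [_ /(_ i) [+ _]] := sub_valP w t tt j c Ac 1.
  by apply; exists m.
rewrite /partial deriveD ?deriveZ //.
exact: derivableZ.
Qed.

(* Every 1-jet at [m] is the jet of a global section, so that the fibre at [m]
   of the jet bundle is the quotient of the global sections by this subspace. *)
Definition null_jet_space (m : M) : subspace sections.
Proof.
exists (fun u => forall c t, atlas c -> trivs t -> cdom c m -> tdom t m ->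
  forall j, tcoord t j (section_dfun u) m = 0 /\ forall i, tderiv c t j i u m = 0).
- move=> c t Ac tt cm tm j; split=> [|i]; first by rewrite /tcoord linear0 mxE.
  by have := tderiv_lin j i (- 1) 0 0 Ac tt cm tm; rewrite mulN1r addNr scaler0 addr0.
- move=> a u v Su Sv c t Ac tt cm tm j.
  have [u0 du0] := Su c t Ac tt cm tm j; have [v0 dv0] := Sv c t Ac tt cm tm j.
  split=> [|i]; first by rewrite tcoord_lin u0 v0 mulr0 addr0.
  by rewrite tderiv_lin // du0 dv0 mulr0 addr0.
Defined.

Definition jet (m : M) : lmodType R := quot_lmod (null_jet_space m).
Definition jet_of (m : M) (u : sections) : jet m := quot_pi (null_jet_space m) u.
Definition jet_rep (m : M) (x : jet m) : sections := quot_repr x.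
Definition jet_value (m : M) (x : jet m) : A m := jet_rep x m.

Lemma jet_of_lin m a u v : jet_of m (a *: u + v) = a *: jet_of m u + jet_of m v.
Proof. exact: linearP. Qed.

Lemma jet_rep_of m u : null_jet_space m (jet_rep (jet_of m u) - u).
Proof. by apply/quot_piP; exact: quot_piK. Qed.

Lemma jet_rep_lin m a (x y : jet m) :
  null_jet_space m (jet_rep (a *: x + y) - (a *: jet_rep x + jet_rep y)).
Proof.
by apply/quot_piP; rewrite quot_pi_linear /jet_rep !quot_piK.
Qed.

Lemma jet_rep0 m : null_jet_space m (jet_rep (0 : jet m) - 0).
Proof. by apply/quot_piP; rewrite /jet_rep quot_piK linear0. Qed.

Lemma null_jet_eq m u v c t j : null_jet_space m (u - v) ->
  atlas c -> trivs t -> cdom c m -> tdom t m ->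
  tcoord t j (section_dfun u) m = tcoord t j (section_dfun v) m /\
  forall i, tderiv c t j i u m = tderiv c t j i v m.
Proof.
move=> uv Ac tt cm tm; have [e de] := uv c t Ac tt cm tm j.
have <- : 1 *: (u - v) + v = u by rewrite scale1r subrK.
split=> [|i]; first by rewrite tcoord_lin e mulr0 add0r.
by rewrite tderiv_lin // de mulr0 add0r.
Qed.

(* The smooth structure of the jet bundle: the fibre coordinates of [x : jet m]
   over a chart and a trivialization are the values and first partial
   derivatives of the coordinates of a section representing [x]. *)
Definition smooth_jet_section (mu : dfun jet) : Prop :=
  forall c t, atlas c -> trivs t -> forall j,
  smooth_in c (tdom t) (fun m => tcoord t j (section_dfun (jet_rep (mu m))) m) /\
  forall i, smooth_in c (tdom t) (fun m => tderiv c t j i (jet_rep (mu m)) m).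

Fact smooth_jet_section0 : smooth_jet_section 0.
Proof.
move=> c t Ac tt j; have oW := tdom_open t.
split=> [|i]; apply: (smooth_in_ext oW _ (smooth_in0 _ _)) => m cm tm;
  have -> : (0 : dfun jet) m = 0 by [];
  have [e de] := @null_jet_eq m _ _ c t j (@jet_rep0 m) Ac tt cm tm.
- by rewrite e /tcoord linear0 mxE.
- rewrite de; have := tderiv_lin j i (- 1) 0 0 Ac tt cm tm.
  by rewrite mulN1r addNr scaler0 addr0.
Qed.

Fact smooth_jet_section_lin a mu nu :
  smooth_jet_section mu -> smooth_jet_section nu -> smooth_jet_section (a *: mu + nu).
Proof.
move=> Smu Snu c t Ac tt j; have oW := tdom_open t.
have [S1 D1] := Smu c t Ac tt j; have [S2 D2] := Snu c t Ac tt j.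
split=> [|i].
- apply: (smooth_in_ext oW _ (smooth_in_lin a oW S1 S2)) => m cm tm.
  rewrite dfunPE; have [-> _] := @null_jet_eq m _ _ c t j (@jet_rep_lin m a (mu m) (nu m)) Ac tt cm tm.
  by rewrite tcoord_lin.
- apply: (smooth_in_ext oW _ (smooth_in_lin a oW (D1 i) (D2 i))) => m cm tm.
  rewrite dfunPE; have [_ ->] := @null_jet_eq m _ _ c t j (@jet_rep_lin m a (mu m) (nu m)) Ac tt cm tm.
  by rewrite tderiv_lin.
Qed.

Definition jet_section_space : subspace (dfun jet) :=
  Subspace smooth_jet_section0 smooth_jet_section_lin.

Definition jet_sections := sub_lmod jet_section_space.
HB.instance Definition _ := GRing.Lmodule.on jet_sections.
Definition jet_section_at (mu : jet_sections) (m : M) : jet m := sub_val mu m.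
Coercion jet_section_at : jet_sections >-> Funclass.

Fact prolong_smooth (u : sections) : jet_section_space (fun m => jet_of m u).
Proof.
move=> c t Ac tt j; split=> [|i].
  apply: smooth_in_ext (sub_valP u t tt j c Ac); first exact: tdom_open.
  by move=> m cm tm; have [-> _] := @null_jet_eq m _ _ c t j (@jet_rep_of m u) Ac tt cm tm.
have Su := sub_valP u t tt j c Ac.
have : smooth_in c (tdom t) (tderiv c t j i u).
  move=> k; have [_ /(_ i) [_]] := Su k.+1.
  apply: Ck_ext; first by apply: chart_image_open; exact: tdom_open.
  by move=> _ [m [cm _] <-]; rewrite /= cmapK.
apply: smooth_in_ext; first exact: tdom_open.
by move=> m cm tm; have [_ ->] := @null_jet_eq m _ _ c t j (@jet_rep_of m u) Ac tt cm tm.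
Qed.
Definition prolong (u : sections) : jet_sections := sub_mk (prolong_smooth u).

Definition is_derivation (d : sections -> sections) : Prop :=
  linear d /\ exists X : vector_field M,
    forall f u m, d (fscale f u) m = f m *: d u m + X m f *: u m.

Fact is_derivation0 : is_derivation 0.
Proof.
split; first by move=> a u v; rewrite scaler0 addr0.
by exists 0 => f u m; rewrite scaler0 scale0r addr0.
Qed.

Fact is_derivation_lin (a : R) (d d' : sections -> sections) :
  is_derivation d -> is_derivation d' -> is_derivation (a *: d + d').
Proof.
move=> [dl [X dX]] [dl' [X' dX']]; split.
  move=> b u v; rewrite !fctE dl dl' !scalerDr !scalerA mulrC -!addrA; congr (_ + _).
  by rewrite addrCA.
exists (a *: X + X') => f u m.
transitivity (a *: section_at (d (fscale f u)) m + section_at (d' (fscale f u)) m) => //.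
rewrite dX dX'.
transitivity (f m *: (a *: section_at (d u) m + section_at (d' u) m) +
   (a * X m f + X' m f) *: u m) => //.
by rewrite !scalerDr scalerDl !scalerA [f m * a]mulrC addrACA.
Qed.

Definition gauge_space : subspace (sections -> sections) :=
  Subspace is_derivation0 is_derivation_lin.

Definition gauge := sub_lmod gauge_space.
HB.instance Definition _ := GRing.Lmodule.on gauge.
Definition gauge_fun (d : gauge) : sections -> sections := sub_val d.
Coercion gauge_fun : gauge >-> Funclass.

Lemma gauge_lin (a : R) (d d' : gauge) u :
  gauge_fun (a *: d + d') u = a *: d u + d' u.
Proof. by []. Qed.

End VectorBundles.

Section GaugeBracket.
Variables (R : realType) (n : nat) (M : manifold R n).

Definition vf_app (X : vector_field M) (f : Cinf M) : Cinf M :=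
  @sub_mk _ _ (Cinf_space M) _ (sub_valP X f).

Lemma Cinf_ext (f g : Cinf M) : (forall m, f m = g m) -> f = g.
Proof. by move=> fg; apply: val_inj; apply/funext. Qed.

Lemma tangent_lin (m : M) (v : tangent m) a f g : v (a *: f + g) = a * v f + v g.
Proof. by have [vl _] := sub_valP v; exact: vl. Qed.

Lemma tangent_mul (m : M) (v : tangent m) f g : v (Cinf_mul f g) = f m * v g + g m * v f.
Proof. by have [_ vM] := sub_valP v; exact: vM. Qed.

Fact vf_bracket_tangent (X Y : vector_field M) m :
  tangent_space m (fun f => X m (vf_app Y f) - Y m (vf_app X f)).
Proof.
have L (Z : vector_field M) a f g :
    vf_app Z (a *: f + g) = a *: vf_app Z f + vf_app Z g.
  by apply: Cinf_ext => x; exact: tangent_lin.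
have P (Z : vector_field M) f g :
    vf_app Z (Cinf_mul f g) = 1 *: Cinf_mul f (vf_app Z g) + Cinf_mul g (vf_app Z f).
  by apply: Cinf_ext => x; rewrite scale1r; exact: tangent_mul.
split=> [a f g|f g].
  by rewrite !L !tangent_lin /GRing.scale /=; ring.
rewrite !P !tangent_lin !tangent_mul.
rewrite /vf_app /Cinf_fun /= /vector_field_at; ring.
Qed.

Fact vf_bracket_smooth (X Y : vector_field M) :
  vector_field_space M (fun m => sub_mk (vf_bracket_tangent X Y m)).
Proof.
move=> f c Ac; apply: (smooth_in_ext openT _ (smooth_in_lin (- 1) openT
  (Cinf_smooth (vf_app Y (vf_app X f)) Ac) (Cinf_smooth (vf_app X (vf_app Y f)) Ac))).
by move=> m _ _; rewrite mulN1r addrC.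
Qed.

Definition vf_bracket X Y : vector_field M := sub_mk (vf_bracket_smooth X Y).

Variables (r : nat) (A : vbundle M r).

Lemma sections_ext (u v : sections A) : (forall m, u m = v m) -> u = v.
Proof. by move=> uv; apply: val_inj; exact: functional_extensionality_dep. Qed.

Fact gauge_bracket_subproof (d d' : gauge A) :
  gauge_space A (fun u => d (d' u) - d' (d u)).
Proof.
have [dl [X dX]] := sub_valP d; have [dl' [Y dY]] := sub_valP d'; split.
  move=> a u v; rewrite /gauge_fun dl' dl dl dl' scalerBr opprD.
  by rewrite addrACA.
have E (e : gauge A) (Z : vector_field M) :
    (forall f u m, e (fscale f u) m = f m *: e u m + Z m f *: u m) ->
    forall f u, e (fscale f u) = 1 *: fscale f (e u) + fscale (vf_app Z f) u.
  by move=> eZ f u; apply: sections_ext => m; rewrite eZ scale1r.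
exists (vf_bracket X Y) => f u m.
have eX := E d X dX; have eY := E d' Y dY.
rewrite eX eY.
have -> : d (1 *: fscale f (d' u) + fscale (vf_app Y f) u) =
   1 *: d (fscale f (d' u)) + d (fscale (vf_app Y f) u) by exact: dl.
have -> : d' (1 *: fscale f (d u) + fscale (vf_app X f) u) =
   1 *: d' (fscale f (d u)) + d' (fscale (vf_app X f) u) by exact: dl'.
rewrite !eX !eY !scale1r.
transitivity (f m *: d (d' u) m + X m f *: d' u m +
   (Y m f *: d u m + X m (vf_app Y f) *: u m)
   - (f m *: d' (d u) m + Y m f *: d u m +
     (X m f *: d' u m + Y m (vf_app X f) *: u m))); first by [].
transitivity (f m *: (d (d' u) m - d' (d u) m) +
   (X m (vf_app Y f) - Y m (vf_app X f)) *: u m); last by [].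
rewrite scalerBr scalerBl.
set a := f m *: d _ m; set b := X m f *: _; set c := Y m f *: _.
set e := X m _ *: _; set a' := f m *: d' _ m; set e' := Y m _ *: _.
rewrite (AC (2*2) ((1*4)*(2*3))) [a' + c + _](AC (2*2) ((1*4)*(3*2))).
by rewrite opprD addrACA subrr addr0 opprD addrACA.
Qed.
Definition gauge_bracket (d d' : gauge A) : gauge A :=
  sub_mk (gauge_bracket_subproof d d').

End GaugeBracket.

Section Forms.
Variables (R : pzRingType) (V W : lmodType R).

Definition multilinear k (c : ('I_k -> V) -> W) : Prop :=
  forall (i : 'I_k) (x : 'I_k -> V) a y z,
    c [eta x with i |-> a *: y + z] =
    a *: c [eta x with i |-> y] + c [eta x with i |-> z].

Definition skew_symmetric k (c : ('I_k -> V) -> W) : Prop :=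
  forall (s : 'S_k) x, c (x \o s) = (-1) ^+ s *: c x.

Definition is_form k (c : ('I_k -> V) -> W) : Prop :=
  multilinear c /\ skew_symmetric c.

End Forms.

Lemma is_form0 (R : pzRingType) (V W : lmodType R) k : is_form (0 : ('I_k -> V) -> W).
Proof.
by split=> [i x a y z|s x]; rewrite ?scaler0 ?addr0.
Qed.

Lemma is_form_lin (R : comPzRingType) (V W : lmodType R) k (a : R) (c c' : ('I_k -> V) -> W) :
  is_form c -> is_form c' -> is_form (a *: c + c').
Proof.
move=> [cl cs] [cl' cs']; split=> [i x b y z|s x].
  rewrite !fctE cl cl' !scalerDr !scalerA mulrC -!addrA; congr (_ + _).
  by rewrite addrCA.
by rewrite !fctE cs cs' scalerDr !scalerA mulrC.
Qed.

(* (x_1, ..., x_k, y) *)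
Definition snoc (T : Type) k (x : 'I_k -> T) (y : T) : 'I_k.+1 -> T :=
  fun i => if unlift ord_max i is Some j then x j else y.

(* For i < j: (y, x_0, ..., x_k) with the entries x_i and x_j omitted. *)
Definition contract (T : Type) k (i j : 'I_k.+1) (y : T) (x : 'I_k.+1 -> T) :
    'I_k -> T :=
  fun l => if l == 0%N :> nat then y else x (inord (bump j (bump i l.-1))).

(* The Chevalley--Eilenberg differential associated with a bracket on [V] and
   an action of [V] on [W]. *)
Definition chevalley_eilenberg (R : pzRingType) (V W : lmodType R)
    (br : V -> V -> V) (act : V -> W -> W) k
    (c : ('I_k -> V) -> W) (x : 'I_k.+1 -> V) : W :=
  \sum_(i < k.+1) (-1) ^+ i *: act (x i) (c (fun l => x (lift i l))) +
  \sum_(i < k.+1) \sum_(j < k.+1 | (i < j)%N)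
    (-1) ^+ (i + j) *: c (contract i j (br (x i) (x j)) x).

Lemma chevalley_eilenberg_linear (R : comPzRingType) (V W : lmodType R) br act k :
  (forall x, linear (act x)) -> linear (@chevalley_eilenberg R V W br act k).
Proof.
move=> actl a c c'; apply/funext => x; rewrite !fctE /chevalley_eilenberg.
rewrite scalerDr addrACA; congr (_ + _);
  rewrite scaler_sumr -big_split /=; apply: eq_bigr => i _.
  by rewrite actl scalerDr !scalerA mulrC.
rewrite scaler_sumr -big_split /=; apply: eq_bigr => j _.
by rewrite scalerDr !scalerA mulrC.
Qed.

(* Cohomology of a complex C whose cochains of degree k embed, via [iota k], in
   a larger space E k; the differential of a cochain is computed in E k.+1.
   When d maps C k into iota (C k.+1) and squares to 0, this is ker d / im d. *)
Section Cohomology.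
Variables (R : pzRingType) (C E : nat -> lmodType R).
Variables (iota : forall k, {linear C k -> E k}) (d : forall k, {linear C k -> E k.+1}).

Definition cocycles k : subspace (C k).
Proof.
exists (fun z => d k z = 0); first exact: linear0.
by move=> a x y dx dy; rewrite linearP dx dy scaler0 addr0.
Defined.

Definition is_coboundary k : C k -> Prop :=
  match k with
  | 0 => fun z => z = 0
  | k'.+1 => fun z => exists w : C k', iota k'.+1 z = d k' w
  end.

Definition coboundaries k : subspace (sub_lmod (cocycles k)).
Proof.
exists (fun z : sub_lmod (cocycles k) => is_coboundary (sub_val z)).
  by case: k => [//|k]; exists 0; rewrite !linear0.
case: k => [|k] a x y /=; first by move=> -> ->; rewrite scaler0 addr0.
by move=> [v xv] [w yw]; exists (a *: v + w); rewrite !linearP xv yw.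
Defined.

Definition cohomology k := quot_lmod (coboundaries k).

End Cohomology.

Section LieAlgebroids.
Variables (R : realType) (n : nat) (M : manifold R n) (r : nat) (A : vbundle M r).

Record lie_algebroid := LieAlgebroid {
  bracket : sections A -> sections A -> sections A;
  anchor : forall m, {linear A m -> tangent m};
  bracket_linear : forall X, linear (bracket X);
  bracket_skew : forall X Y, bracket X Y = - bracket Y X;
  bracket_jacobi : forall X Y Z,
    bracket X (bracket Y Z) + bracket Y (bracket Z X) + bracket Z (bracket X Y) = 0;
  anchor_smooth : forall X : sections A,
    vector_field_space M (fun m => anchor m (X m));
  bracket_leibniz : forall X f Y m,
    bracket X (fscale f Y) m = 
      f m *: bracket X Y m + (anchor m (X m) : tangent m) f *: Y m }.

(* The gauge algebroid is represented by its sections, the derivations of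
   [sections A]: the fibre at m consists of the maps u |-> d u m, which factor
   through [jet A m]. *)
Definition pairing (d : gauge A) (mu : jet_sections A) : sections A :=
  section_of (fun m => d (jet_rep (mu m)) m).

(* There is exactly one such [nu], the pairing being nondegenerate. *)
Definition lie_derivative (d : gauge A) (mu : jet_sections A) : jet_sections A :=
  xget 0 [set nu : jet_sections A | forall d' : gauge A,
    pairing d' nu = d (pairing d' mu) - pairing (gauge_bracket d d') mu].

Variable L : lie_algebroid.

(* The bundle map pi with pi([u]_m) v = [u, v] at m, applied to sections;
   there is exactly one such [d]. *)
Definition jet_to_gauge (mu : jet_sections A) : gauge A :=
  xget 0 [set d : gauge A | forall (m : M) (u : sections A),
    mu m = jet_of m u -> forall v, d v m = bracket L u v m].

Definition jet_bracket (mu nu : jet_sections A) : jet_sections A :=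
  lie_derivative (jet_to_gauge mu) nu - lie_derivative (jet_to_gauge nu) mu
  - prolong (pairing (jet_to_gauge mu) nu).

End LieAlgebroids.

Section KernelInclusion.
Variables (R : realType) (n : nat) (M : manifold R n) (r : nat) (A : vbundle M r).
Variable m : M.

Definition hom_TA_space : subspace (tangent m -> A m).
Proof.
exists (fun h => linear h) => [a x y|a h h' hl hl' b x y].
  by rewrite scaler0 addr0.
rewrite !fctE hl hl' !scalerDr !scalerA mulrC -!addrA; congr (_ + _).
by rewrite addrCA.
Defined.

Definition hom_TA := sub_lmod hom_TA_space.
HB.instance Definition _ := GRing.Lmodule.on hom_TA.
Definition hom_TA_fun (h : hom_TA) : tangent m -> A m := sub_val h.
Coercion hom_TA_fun : hom_TA >-> Funclass.

Fact df_tensor_linear (f : Cinf M) (u : sections A) :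
  hom_TA_space (fun v : tangent m => v f *: u m).
Proof. by move=> a v w; rewrite scalerA -scalerDl. Qed.

(* df (x) u at the point m *)
Definition df_tensor f u : hom_TA := sub_mk (df_tensor_linear f u).

(* The identification of Hom(T_m M, A_m) with the kernel of J_m A -> A_m,
   the unique linear map for which [fu]_m = df (x) u + f(m) [u]_m. *)
Definition hom_to_jet : hom_TA -> jet A m :=
  xget 0 [set h : hom_TA -> jet A m | linear h /\
    forall f u, h (df_tensor f u) = jet_of m (fscale f u) - f m *: jet_of m u].

End KernelInclusion.

Section Complexes.
Variables (R : realType) (n : nat) (M : manifold R n) (r : nat) (A : vbundle M r).

(* Degree 0 cochains are functions on the one-element type ['I_0 -> _]. *)
Definition fibre_cochain (k : nat) : lmodType R :=
  dfun (fun m : M => (('I_k -> jet A m) -> A m) : lmodType R).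

(* Smooth sections of Hom(wedge^k JA, A). *)
Definition is_bundle_form k (w : fibre_cochain k) : Prop :=
  (forall m, is_form (w m)) /\
  forall mu : 'I_k -> jet_sections A, section_space A (fun m => w m (fun i => mu i m)).

Definition in_gauge k (w : fibre_cochain k.+1) : Prop :=
  forall m (mu : 'I_k -> jet A m), exists d : gauge A,
    forall u : sections A, w m (snoc mu (jet_of m u)) = d u m.

Definition has_symbol k (w : fibre_cochain k.+1) : Prop :=
  forall m, exists2 lam : ('I_k -> A m) -> tangent m, is_form lam &
    forall (mu : 'I_k -> jet A m) (eta : hom_TA A m),
      w m (snoc mu (hom_to_jet eta)) = eta (lam (fun i => jet_value (mu i))).

Definition gauge_condition k : fibre_cochain k -> Prop :=
  match k with
  | 0 => fun=> True
  | k'.+1 => fun w => if (0 < k')%N && (r == 1%N) then has_symbol w else in_gauge w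
  end.

Definition jet_cochain_space k : subspace (fibre_cochain k).
Proof.
exists (fun w => is_bundle_form w /\ gauge_condition w).
- split; first split=> [m|mu]; [exact: is_form0|exact: subspace0|].
  case: k => [//|k] /=; case: ifP => _ m.
    by exists 0; [exact: is_form0|move=> mu eta; rewrite [RHS](_ : _ = 0) //;
      have etal := sub_valP eta; have := etal (-1) 0 0; rewrite scaler0 addr0 scaleN1r addNr].
  by move=> mu; exists 0.
- move=> a w w' [[wf ws] wc] [[wf' ws'] wc']; split.
    split=> [m|mu]; first exact: is_form_lin.
    exact: (subspaceP a (ws mu) (ws' mu)).
  case: k w w' wf ws wc wf' ws' wc' => [//|k] w w' _ _ wc _ _ wc' /=.
  move: wc wc' => /=; case: ifP => _ wc wc' m.
    have [l lf lw] := wc m; have [l' lf' lw'] := wc' m.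
    exists (a *: l + l'); first exact: is_form_lin.
    move=> mu eta; transitivity (a *: w m (snoc mu (hom_to_jet eta)) +
      w' m (snoc mu (hom_to_jet eta))) => //.
    by rewrite lw lw'; have etal := sub_valP eta; rewrite -etal.
  move=> mu; have [d dw] := wc m mu; have [d' dw'] := wc' m mu.
  exists (a *: d + d') => u.
  transitivity (a *: w m (snoc mu (jet_of m u)) + w' m (snoc mu (jet_of m u))) => //.
  by rewrite dw dw' -section_lin -gauge_lin.
Defined.

(* Sections of Hom(wedge^k JA, A)_{DA}. *)
Definition jet_cochains k : lmodType R := sub_lmod (jet_cochain_space k).

Definition jet_eval k (w : jet_cochains k) (mu : 'I_k -> jet_sections A) : sections A :=
  sub_mk ((sub_valP w).1.2 mu).

Fact jet_eval_linear k : linear (@jet_eval k).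
Proof. by move=> a w w'; apply/funext => mu; apply: sections_ext. Qed.
HB.instance Definition _ k := GRing.isLinear.Build R (jet_cochains k)
  (('I_k -> jet_sections A) -> sections A) *:%R (@jet_eval k) (@jet_eval_linear k).

Fact jet_eval_inj k : injective (@jet_eval k).
Proof.
move=> w w' ww'; apply: val_inj; apply: functional_extensionality_dep => m.
apply/funext => mu.
have : jet_eval w (fun i => prolong (jet_rep (mu i))) m =
       jet_eval w' (fun i => prolong (jet_rep (mu i))) m by rewrite ww'.
have E : (fun i => prolong (jet_rep (mu i)) m) = mu.
  by apply/funext => i; exact: quot_piK.
by move=> h; rewrite -E; exact: h.
Qed.

Variable L : lie_algebroid A.

Definition jet_d k (w : jet_cochains k) : ('I_k.+1 -> jet_sections A) -> sections A :=
  chevalley_eilenberg (jet_bracket L) (jet_to_gauge L) (jet_eval w).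

Fact jet_d_linear k : linear (@jet_d k).
Proof.
move=> a w w'; rewrite /jet_d jet_eval_linear chevalley_eilenberg_linear // => mu.
by have [] := sub_valP (jet_to_gauge L mu).
Qed.
HB.instance Definition _ k := GRing.isLinear.Build R (jet_cochains k)
  (('I_k.+1 -> jet_sections A) -> sections A) *:%R (@jet_d k) (@jet_d_linear k).

Definition jet_cohomology (k : nat) : lmodType R :=
  cohomology (fun k => @jet_eval k : {linear _ -> _}) (fun k => @jet_d k : {linear _ -> _}) k.

Definition smooth_symbol k (s : forall m, ('I_k -> A m) -> tangent m) : Prop :=
  (forall m, is_form (s m)) /\
  forall u : 'I_k -> sections A, vector_field_space M (fun m => s m (fun i => u i m)).

Definition is_multiderivation k : (('I_k -> sections A) -> sections A) -> Prop :=
  match k with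
  | 0 => fun=> True
  | k'.+1 => fun D => is_form D /\
      exists2 s : forall m, ('I_k' -> A m) -> tangent m, smooth_symbol s &
      forall (u : 'I_k' -> sections A) f v m,
        D (snoc u (fscale f v)) m =
        f m *: D (snoc u v) m + s m (fun i => u i m) f *: v m
  end.

Definition def_cochain_space k : subspace (('I_k -> sections A) -> sections A).
Proof.
exists (@is_multiderivation k).
- case: k => [//|k]; split; first exact: is_form0.
  exists (fun m => 0) => [|u f v m].
    by split=> [m|u]; [exact: is_form0|exact: subspace0].
  by rewrite scaler0 scale0r addr0.
- case: k => [//|k] a D D' [Df [s [sf ss] sD]] [Df' [s' [sf' ss'] sD']].
  split; first exact: is_form_lin.
  exists (fun m => a *: s m + s' m) => [|u f v m].
    split=> [m|u]; first exact: is_form_lin.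
    exact: (subspaceP a (ss u) (ss' u)).
  transitivity (a *: section_at (D (snoc u (fscale f v))) m +
     section_at (D' (snoc u (fscale f v))) m) => //.
  rewrite sD sD'.
  transitivity (f m *: (a *: section_at (D (snoc u v)) m + section_at (D' (snoc u v)) m) +
   (a * s m (fun i => u i m) f + s' m (fun i => u i m) f) *: v m) => //.
  by rewrite !scalerDr scalerDl !scalerA [f m * a]mulrC addrACA.
Defined.

Definition def_cochains k : lmodType R := sub_lmod (def_cochain_space k).

Definition def_eval k (D : def_cochains k) : ('I_k -> sections A) -> sections A :=
  sub_val D.

Fact def_eval_linear k : linear (@def_eval k).
Proof. by []. Qed.
HB.instance Definition _ k := GRing.isLinear.Build R (def_cochains k)
  (('I_k -> sections A) -> sections A) *:%R (@def_eval k) (@def_eval_linear k).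

Definition def_d k (D : def_cochains k) : ('I_k.+1 -> sections A) -> sections A :=
  chevalley_eilenberg (bracket L) (bracket L) (def_eval D).

Fact def_d_linear k : linear (@def_d k).
Proof.
by move=> a w w'; rewrite /def_d def_eval_linear chevalley_eilenberg_linear //;
  exact: bracket_linear.
Qed.
HB.instance Definition _ k := GRing.isLinear.Build R (def_cochains k)
  (('I_k.+1 -> sections A) -> sections A) *:%R (@def_d k) (@def_d_linear k).

Definition def_cohomology (k : nat) : lmodType R :=
  cohomology (fun k => @def_eval k : {linear _ -> _}) (fun k => @def_d k : {linear _ -> _}) k.

End Complexes.

(* Main.v *)
From HB Require Import structures.
Require Import Defs.
From mathcomp Require Import all_boot all_order all_fingroup all_algebra.
From mathcomp Require Import all_classical all_reals all_analysis.
From mathcomp Require Import ring lra zify.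
Set Implicit Arguments.
Unset Strict Implicit.
Unset Printing Implicit Defensive.
Import Order.TTheory GRing.Theory Num.Theory.
Import numFieldNormedType.Exports.
Local Open Scope classical_set_scope.
Local Open Scope ring_scope.

(** A cochain on the jet bundle is determined by its values on 1-jet
    prolongations, because every 1-jet at a point is the jet of a global
    section. Restriction to prolongations, D(u_1, ..., u_k) = w(du_1, ..., du_k),
    is an isomorphism of complexes from the jet complex to the deformation
    complex, and this gives the isomorphism in cohomology.

    Restriction yields multiderivations ([prolong_cochain_multiderivation]).
    The symbol of D is read off from w on the kernel Hom(TM, A) of the projection
    from jets to values. In rank 1 the definition of the subcomplex provides it;
    in rank at least 2, exchanging two arguments of the form alpha (x) x and
    beta (x) y gives beta(sigma(alpha (x) x)) y = - alpha(sigma(beta (x) y)) x,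
    which forces both sides to vanish when x and y are independent, so that
    sigma factors through the values of the jets ([symbol_at_value]).

    Conversely a multiderivation D is a derivation in each argument, so that
    D(u_1, ..., u_k) at a point m only depends on the 1-jets of the u_i at m, and
    w_m(mu_1, ..., mu_k) = D(u_1, ..., u_k)(m) for any u_i with mu_i = [u_i]_m is
    well defined ([multiderivation_jet]). The two constructions are inverse to
    each other.

    The differentials correspond on prolongations, since pi(du) = [u, .] and
    [du, dv] = d[u, v] ([jet_d_prolong]). To conclude that an identity between
    jet cochains can be tested on prolongations, the Chevalley-Eilenberg
    expression of d_J is shown to be C^oo(M)-linear in each argument
    ([chevalley_eilenberg_slot], [jet_d_tensorial]); near each point, every
    section of the jet bundle is a combination of prolongations with smooth
    coefficients ([local_jet_frame], [tensorial_vanish]).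

    All of this rests on the local description of jets. Fibres of the jet bundle
    are quotients of the space of global sections by the sections whose values
    and first derivatives vanish in all charts. The bridge to algebra is
    [null_jetP]: a section has zero jet at m if and only if every derivation of
    the sections of A kills it at m. One direction is Hadamard's lemma
    ([hadamard_factors]), which shows that a point derivation of the smooth
    functions is a combination of partial derivatives ([tangent_coordinates]);
    the other one uses derivations built from bump functions ([gauge_null]).
    The same criterion is the nondegeneracy of the pairing of jets with
    derivations, by which the Lie derivative, the map pi and the identification
    of the kernel are characterised. *)

(** * Functions of class C^k on open subsets of R^n *)

Section Calculus.
Variables (R : realType) (n : nat).
Notation V := 'rV[R]_n.
Implicit Types (f g : V -> R) (U : set V).

(** The gluing principle behind all smoothness statements below: each clause in
    the definition of [Ck] is a condition at a point that only sees the germ of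
    the function. *)
Lemma Ck_local k U f :
  (forall x, U x -> exists W : set V, exists2 g, open W & W x /\
     (forall z, W z -> g z = f z) /\ Ck k W g) -> Ck k U f.
Proof.
elim: k f => [|k IH] f H.
  split=> // x /H [W [g oW [Wx [gf [cg _]]]]].
  exact: cont_ext oW gf Wx (cg _ Wx).
split=> [x /H [W [g oW [Wx [gf [cg _]]]]]|i]; first exact: cont_ext oW gf Wx (cg _ Wx).
split=> [x /H [W [g oW [Wx [gf [cg /(_ i) [dg _]]]]]]|].
  exact: near_eq_derivable (open_near_eq oW gf Wx) (dg _ Wx).
apply: IH => x /H [W [g oW [Wx [gf [_ /(_ i) [_ Cg]]]]]].
exists W, (partial i g) => //; split=> //; split=> // z Wz.
by apply: near_eq_derive; exact: open_near_eq oW gf Wz.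
Qed.

Lemma Ck_cst k U (a : R) : Ck k U (fun=> a).
Proof.
elim: k a => [|k IH] a; first by split=> // x _; exact: cst_continuous.
split=> [x _|i]; first exact: cst_continuous.
split=> [x _|]; first exact: derivable_cst.
suff -> : partial i (fun=> a) = (fun=> 0) by exact: IH.
by apply/funext => x; exact: derive_cst.
Qed.

Lemma Ck_le k l U f : (k <= l)%N -> Ck l U f -> Ck k U f.
Proof.
move=> /subnK <-; elim: (l - k)%N => [//|p IH]; rewrite addSn => /Ck_pred; exact: IH.
Qed.

Lemma CkD k U f g : open U -> Ck k U f -> Ck k U g -> Ck k U (fun x => f x + g x).
Proof.
move=> oU Cf Cg; have := Ck_lin 1 oU Cf Cg.
by apply: Ck_ext => // x _; rewrite scale1r.
Qed.

Lemma CkZ k U (a : R) f : open U -> Ck k U f -> Ck k U (fun x => a * f x).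
Proof.
move=> oU Cf; have := Ck_lin a oU Cf (Ck0 k U).
by apply: Ck_ext => // x _; rewrite addr0.
Qed.

Lemma CkB k U f g : open U -> Ck k U f -> Ck k U g -> Ck k U (fun x => f x - g x).
Proof.
move=> oU Cf Cg; have := CkD oU Cf (CkZ (- 1) oU Cg).
by apply: Ck_ext => // x _; rewrite mulN1r.
Qed.

Lemma CkM k U f g : open U -> Ck k U f -> Ck k U g -> Ck k U (fun x => f x * g x).
Proof. exact: Ck_mul. Qed.

Lemma Ck_sum (I : Type) (s : seq I) k U (F : I -> V -> R) : open U ->
  (forall i, Ck k U (F i)) -> Ck k U (fun x => \sum_(i <- s) F i x).
Proof.
move=> oU CF; elim: s => [|i s IH].
  by apply: Ck_ext (Ck0 k U) => // x _; rewrite big_nil.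
by apply: Ck_ext (CkD oU (CF i) IH) => // x _; rewrite big_cons.
Qed.

Lemma is_derive_coord (x v : V) j : is_derive x v (fun y : V => y 0 j) (v 0 j).
Proof.
have df := @differentiable_coord R 1 n x 0 j.
apply: DeriveDef; first exact: diff_derivable.
have fl : linear (fun y : V => y 0 j : R^o) by move=> a y z; rewrite !mxE.
pose l : {linear V -> R^o} := HB.pack (fun y : V => y 0 j : R^o) (GRing.isLinear.Build _ _ _ _ _ fl).
have -> := @deriveE _ _ _ (l : V -> R^o) x v df.
have -> := @diff_lin _ _ _ l x => //.
exact: (@coord_continuous _ 1 n 0 j).
Qed.

Lemma Ck_coord k U j : Ck k U (fun x => x 0 j).
Proof.
case: k => [|k]; first by split=> // x _; exact: coord_continuous.
split=> [x _|i]; first exact: coord_continuous.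
split=> [x _|]; first by have [] := is_derive_coord x (delta_mx 0 i) j.
suff -> : partial i (fun x : V => x 0 j) = (fun=> (i == j)%:R :> R) by exact: Ck_cst.
by apply/funext => x; rewrite /partial (@derive_val _ _ _ _ _ _ _ (is_derive_coord _ _ _)) mxE eqxx /= eq_sym.
Qed.

Lemma is_derive_line f (x v : V) s : derivable f (x + s *: v) v ->
  is_derive s 1 (fun t : R => f (x + t *: v)) ('D_v f (x + s *: v)).
Proof.
have E : (fun h : R => h^-1 *: (((fun t => f (x + t *: v)) \o shift s) (h *: 1) - f (x + s *: v))) =
   (fun h => h^-1 *: ((f \o shift (x + s *: v)) (h *: v) - f (x + s *: v))).
  apply/funext => h; rewrite /= -[h *: 1]/(h * 1) mulr1 scalerDl.
  by rewrite addrCA.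
by move=> df; apply: DeriveDef; rewrite /derivable /derive E.
Qed.

(** The mean value theorem along a line, with a step [h] of either sign. *)
Lemma MVT_line f (x v : V) (h : R) :
  (forall s : R, `|s| <= `|h| -> derivable f (x + s *: v) v) ->
  exists2 s, `|s| <= `|h| & f (x + h *: v) - f x = h * 'D_v f (x + s *: v).
Proof.
move=> df; pose g (t : R) := f (x + t *: v).
have dg (s : R) : `|s| <= `|h| -> is_derive s 1 g ('D_v f (x + s *: v)).
  by move=> /df; exact: is_derive_line.
have g0 : g 0 = f x by rewrite /g scale0r addr0.
have cg (a b : R) : (forall s, s \in `[a, b] -> `|s| <= `|h|) -> {within `[a, b], continuous g}.
  move=> ab; apply: derivable_within_continuous => s /ab /dg [dgs _]; exact: dgs.
rewrite -g0 -/(g h).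
have [h0|h0] := leP 0 h.
  have H s : s \in `[0, h]%R -> `|s| <= `|h|.
    by rewrite in_itv /= => /andP[s0 sh]; rewrite !ger0_norm.
  have [||c ch E] := @MVT_segment _ g (fun s => 'D_v f (x + s *: v)) 0 h h0.
  - by move=> s sh; apply: dg; apply: H; move: sh; rewrite !in_itv /= => /andP[/ltW -> /ltW ->].
  - exact: cg.
  by exists c; [exact: H|rewrite E subr0 mulrC].
have H s : s \in `[h, 0]%R -> `|s| <= `|h|.
  by rewrite in_itv /= => /andP[hs s0]; rewrite !ler0_norm ?lerN2 // ltW.
have [||c ch E] := @MVT_segment _ g (fun s => 'D_v f (x + s *: v)) h 0 (ltW h0).
- by move=> s sh; apply: dg; apply: H; move: sh; rewrite !in_itv /= => /andP[/ltW -> /ltW ->].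
- exact: cg.
exists c; first exact: H.
by rewrite -opprB E sub0r mulrN opprK mulrC.
Qed.

Lemma coord_le_norm (x : V) i : `|x 0 i| <= `|x|.
Proof.
have [/mx_norm_eq0 ->|] := eqVneq (mx_norm x) 0; first by rewrite mxE normr0.
move=> _; rewrite [leRHS]mx_normrE.
exact: (le_bigmax _ (fun ij => `|x ij.1 ij.2|) (0, i)).
Qed.

Lemma norm_le_coord (x : V) e : 0 <= e -> (forall i, `|x 0 i| <= e) -> `|x| <= e.
Proof.
move=> e0 H; have [/mx_norm_eq0 ->|/mx_norm_neq0 [[i j] E]] := eqVneq (mx_norm x) 0.
  by rewrite normr0.
by rewrite [leLHS]E /= ord1.
Qed.

(** Going from [x] to [x + h] one coordinate at a time, each step is controlled
    by the mean value theorem and by the continuity of one partial derivative;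
    this turns partial derivatives into a differential, as the chain rule needs. *)
Lemma differentiable_C1 U f x : open U -> Ck 1 U f -> U x ->
  differentiable f x /\ forall v, 'D_v f x = \sum_i v 0 i * partial i f x.
Proof.
move=> oU [cf df] Ux.
have Ll : linear ((fun v : V => \sum_i v 0 i * partial i f x) : V -> R^o).
  move=> a v w; rewrite scaler_sumr -big_split /=; apply: eq_bigr => i _.
  by rewrite !mxE mulrDl scalerAl.
pose L : {linear V -> R^o} := HB.pack (fun v : V => \sum_i v 0 i * partial i f x)
   (GRing.isLinear.Build _ _ _ _ _ Ll).
have cL : continuous L.
  move=> y; apply: (@Ck_cont _ _ 0 setT) => //; apply: Ck_sum => [|i]; first exact: openT.
  by apply: CkM; [exact: openT|exact: Ck_coord|exact: Ck_cst].
pose W : normedModType R := R^o; pose fo : V -> W := f.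
have Lo : (fo \o shift x : V -> W) = cst (fo x) + (L : V -> W) +o_ (0 : V) (@id V).
  apply/eqaddoP => _/posnumP[e].
  pose e' := e%:num / (n.+1)%:R.
  have e'0 : 0 < e' by apply: divr_gt0.
  have nU : \forall y \near x, U y /\ forall i, `|partial i f y - partial i f x| <= e'.
    have h1 : nbhs x U by exact: open_nbhs_nbhs.
    have h2 : nbhs x (fun y => forall i, `|partial i f y - partial i f x| <= e').
      apply: (@filter_forall V 'I_n (fun i y => `|partial i f y - partial i f x| <= e') (nbhs x) _) => i.
      have [_ [ci _]] := df i; have := ci _ Ux.
      rewrite /prop_for /continuous_at => /cvgrPdist_le /(_ _ e'0).
      by apply: filterS => y; rewrite distrC.
    exact: (@filterI _ (nbhs x) _ _ _ h1 h2).
  have /nbhs_ballP [d /= d0 Bd] := nU.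
  near=> h.
  have hd : `|h| < d.
    near: h; have := @nbhsx_ballx R V 0 d d0; apply: filterS => h.
    by rewrite mx_norm_ball /ball_ /= sub0r normrN.
  pose T k : V := \row_i (if (i < k)%N then h 0 i else 0).
  have TS (k : 'I_n) : T k.+1 = T k + h 0 k *: delta_mx 0 k.
    apply/rowP => i; rewrite !mxE eqxx /= ltnS leq_eqVlt.
    have [->|ik] := eqVneq i k; first by rewrite eqxx ltnn /= mulr1 add0r.
    by rewrite (negbTE (_ : nat_of_ord i != k)) //= mulr0 addr0.
  have step (k : 'I_n) : `|f (x + T k.+1) - f (x + T k) - h 0 k * partial k f x| <= `|h| * e'.
    have Hs s : `|s| <= `|h 0 k| -> U (x + T k + s *: delta_mx 0 k) /\
       forall i, `|partial i f (x + T k + s *: delta_mx 0 k) - partial i f x| <= e'.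
      move=> sh; apply: Bd; rewrite mx_norm_ball /ball_ /= -addrA opprD addNKr normrN.
      apply: le_lt_trans hd; apply: norm_le_coord => // i; rewrite !mxE eqxx /=.
      case: ltnP => [ik|ki].
        rewrite (_ : (i == k) = false) ?mulr0 ?addr0 ?coord_le_norm //.
        by apply/negbTE; rewrite neq_ltn ik.
      rewrite add0r; case: (i == k); rewrite ?mulr1 ?mulr0 ?normr0 //.
      exact: le_trans sh (coord_le_norm _ _).
    have dHs s : `|s| <= `|h 0 k| -> derivable f (x + T k + s *: delta_mx 0 k) (delta_mx 0 k).
      by move=> /Hs [Us _]; have [dk _] := df k; exact: dk.
    have [s sh] := MVT_line dHs.
    rewrite TS addrA => ->; rewrite -mulrBr normrM; apply: ler_pM => //.
      exact: coord_le_norm.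
    by have [_] := Hs _ sh; exact.
  have T0 : T 0%N = 0 by apply/rowP => i; rewrite !mxE.
  have Tn : T n = h by apply/rowP => i; rewrite !mxE ltn_ord.
  have -> : (fo \o shift x - (cst (fo x) + (L : V -> W))) h =
     \sum_(k < n) (f (x + T k.+1) - f (x + T k) - h 0 k * partial k f x).
    rewrite sumrB; have := @telescope_sumr _ 0%N n (fun k => f (x + T k)) (leq0n n).
    rewrite big_mkord => ->; rewrite T0 Tn addr0.
    transitivity (f (h + x) - (f x + \sum_(k < n) h 0 k * partial k f x)); first by [].
    by rewrite [h + x]addrC opprD addrA.
  apply: le_trans (ler_norm_sum _ _ _) _.
  apply: (@le_trans _ _ (\sum_(k < n) `|h| * e')); first exact: ler_sum.
  rewrite sumr_const card_ord -mulr_natr -mulrA [e%:num * _]mulrC; apply: ler_wpM2l => //.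
  by rewrite /e' mulrAC ler_pdivrMr // ler_wpM2l // ler_nat.
have dE := diff_unique cL Lo.
have dfx : differentiable fo x.
  apply/diff_locallyP; rewrite dE; split=> //.
split=> // v.
by rewrite deriveE // dE.
Unshelve. all: by end_near. Qed.

End Calculus.

(** * Composition of functions of class C^k *)

Section ChainRule.
Variable R : realType.

Lemma derive_along_line (V W : normedModType R) (f : V -> W) x v :
  'D_v f x = 'D_1 (fun h : R => f (h *: v + x)) 0.
Proof.
rewrite /derive; set g1 := fun h => h^-1 *: _; set g2 := fun h => h^-1 *: _.
suff -> : g1 = g2 by [].
by rewrite funeqE /g1 /g2 => h /=; rewrite addr0 scale0r add0r [_%:A]mulr1.
Qed.

Lemma is_derive_chain (V W W' : normedModType R) (f : V -> W) (h : W -> W') x v :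
  derivable f x v -> differentiable h (f x) ->
  is_derive x v (h \o f) ('d h (f x) ('D_v f x)).
Proof.
move=> df dh; pose c (t : R) := f (t *: v + x).
have c0 : c 0 = f x by rewrite /c scale0r add0r.
have dc : differentiable c 0 by apply: (derivable1_diffP _ _).1; exact: (derivable1P _ _ _).1.
have dh' : differentiable h (c 0) by rewrite c0.
have dhc : differentiable (h \o c) 0 by exact: differentiable_comp.
have dhf : derivable (h \o f) x v.
  by apply: (derivable1P _ _ _).2; apply: (derivable1_diffP _ _).2; exact: dhc.
apply: DeriveDef => //.
transitivity ('D_1 (h \o c) (0 : R)); first exact: derive_along_line.
rewrite (deriveE _ dhc) (diff_comp dc dh') [RHS](_ : _ = 'd h (c 0) ('d c 0 1)) //.
by rewrite -(deriveE _ dc) c0 -derive_along_line.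
Qed.

Lemma is_derive_chain1 (V : normedModType R) (f : V -> R) (h : R -> R) x v dh :
  derivable f x v -> is_derive (f x) 1 h dh ->
  is_derive x v (h \o f) (dh * 'D_v f x).
Proof.
move=> df [dh1 dhE]; have dh2 := (derivable1_diffP _ _).1 dh1.
have [dhf E] := is_derive_chain df dh2; apply: DeriveDef => //.
by rewrite E diff1E // derive1E dhE mulrC.
Qed.

Lemma cvg_rV n (T : topologicalType) (f : T -> 'rV[R]_n) x :
  (forall j, {for x, continuous (fun y => f y 0 j)}) -> {for x, continuous f}.
Proof.
move=> cf; rewrite /prop_for /continuous_at; apply/cvgrPdist_le => e e0.
have : nbhs x (fun y => forall j, `|f x 0 j - f y 0 j| <= e).
  apply: (@filter_forall T 'I_n (fun j y => `|f x 0 j - f y 0 j| <= e) (nbhs x) _) => j.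
  by have := cf j; rewrite /prop_for /continuous_at => /cvgrPdist_le /(_ _ e0).
apply: filterS => y H; apply: norm_le_coord => [|j]; first exact: ltW.
by have := H j; rewrite !mxE.
Qed.

(** Induction on [k]: a partial derivative of [h \o phi] is a sum of products of
    partial derivatives of [phi] and of [h], the latter composed with [phi]. *)
Lemma Ck_comp m n k (U : set 'rV[R]_m) (W : set 'rV[R]_n) (phi : 'rV[R]_m -> 'rV[R]_n) h :
  open U -> open W -> (forall j, Ck k U (fun x => phi x 0 j)) ->
  (forall x, U x -> W (phi x)) -> Ck k W h -> Ck k U (h \o phi).
Proof.
move=> oU oW; elim: k h => [|k IH] h Cphi UW Ch.
  split=> // x Ux; apply: continuous_comp; last exact: Ck_cont Ch _ (UW _ Ux).
  by apply: cvg_rV => j; exact: Ck_cont (Cphi j) _ Ux.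
have Cphi' j : Ck k U (fun x => phi x 0 j) by exact: Ck_pred.
have cphi x : U x -> {for x, continuous phi}.
  by move=> Ux; apply: cvg_rV => j; exact: Ck_cont (Cphi j) _ Ux.
split=> [x Ux|i].
  by apply: continuous_comp; [exact: cphi|exact: Ck_cont Ch _ (UW _ Ux)].
have dphi x : U x -> derivable phi x (delta_mx 0 i).
  move=> Ux; apply/derivable_mxP => i0 j; rewrite (ord1 i0).
  by have [_ /(_ i) [+ _]] := Cphi j; exact.
have C1 : Ck 1 W h by exact: Ck_le Ch.
have dh x : U x -> is_derive x (delta_mx 0 i) (h \o phi)
    (\sum_j partial i (fun x => phi x 0 j) x * partial j h (phi x)).
  move=> Ux; have [dh Dh] := differentiable_C1 oW C1 (UW _ Ux).
  have := is_derive_chain (dphi _ Ux) dh.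
  rewrite -deriveE // Dh (derive_mx (dphi _ Ux)).
  by under eq_bigr do rewrite mxE.
split=> [x Ux|]; first by have [] := dh _ Ux.
have := @Ck_sum _ _ _ (index_enum 'I_n) k U
  (fun j x => partial i (fun x => phi x 0 j) x * partial j h (phi x)) oU.
move=> H; apply: Ck_ext (H _) => // [x Ux|j].
  by rewrite /partial; have [_ ->] := dh _ Ux.
apply: CkM => //; first by have [_ /(_ i) []] := Cphi j.
apply: IH => //; by have [_ /(_ j) []] := Ch.
Qed.

Lemma CkV n k (U : set 'rV[R]_n) f : open U -> (forall x, U x -> f x != 0) ->
  Ck k U f -> Ck k U (fun x => (f x)^-1).
Proof.
move=> oU f0; elim: k => [|k IH] Cf.
  by split=> // x Ux; exact: continuousV (f0 _ Ux) (Ck_cont Cf Ux).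
have Cf' := Ck_pred Cf; split=> [x Ux|i].
  exact: continuousV (f0 _ Ux) (Ck_cont Cf Ux).
have [_ /(_ i) [df Cdf]] := Cf; split=> [x Ux|].
  by apply: derivableV; [apply: f0|exact: df].
have CV := IH Cf'.
apply: Ck_ext (CkZ (-1) oU (CkM oU (CkM oU CV CV) Cdf)) => // x Ux.
rewrite /partial (deriveV (f0 _ Ux) (df _ Ux)) -[RHS]/(- (f x) ^- 2 * _) mulN1r mulNr; congr (- (_ * _)).
by rewrite -exprVn expr2.
Qed.

End ChainRule.

(** * Bump functions on R^n *)

Section Bump.
Variable R : realType.

(** The functions x^(-N) exp(-1/x), extended by zero to the left of the origin.
    Keeping the exponent [N] as a parameter makes the family stable under
    differentiation, up to linear combinations. *)
Definition flat (N : nat) (x : R) : R := if 0 < x then x ^- N * expR (- x^-1) else 0.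

(** This quadratic bound gives the derivative at the origin; it comes from
    bounding exp(1/x) below by the term of degree [N.+2] of its series. *)
Lemma flat_bound N x : `|flat N x| <= (N.+2)`!%:R * x ^+ 2.
Proof.
rewrite /flat; case: ifP => [x0|_]; last by rewrite normr0 mulr_ge0 // sqr_ge0.
have y0 : 0 <= x^-1 by rewrite invr_ge0 ltW.
rewrite ger0_norm; last by rewrite mulr_ge0 ?expR_ge0 // invr_ge0 exprn_ge0 // ltW.
rewrite expRN.
have F0 : 0 < (N.+2)`!%:R :> R by rewrite ltr0n fact_gt0.
have E := expR_ge1Dxn N.+1 y0.
have E' : x^-1 ^+ N.+2 / (N.+2)`!%:R <= expR x^-1 by apply: le_trans E; rewrite lerDr.
have P : 0 < x^-1 ^+ N.+2 / (N.+2)`!%:R by rewrite divr_gt0 // exprn_gt0 // invr_gt0.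
have := E'; rewrite -lef_pV2 ?posrE ?expR_gt0 // => E2.
apply: (@le_trans _ _ (x ^- N * (x^-1 ^+ N.+2 / (N.+2)`!%:R)^-1)).
  by apply: ler_wpM2l E2; rewrite invr_ge0 exprn_ge0 // ltW.
rewrite invf_div exprVn invrK mulrCA; apply: ler_wpM2l; first exact: ltW.
by rewrite -addn2 exprD mulKf // expf_neq0 // gt_eqF.
Qed.

Lemma is_derive_flat N (x : R) : is_derive x 1 (flat N) (flat N.+2 x - N%:R * flat N.+1 x).
Proof.
have [x0|x0|->] := ltgtP x 0.
- have -> : flat N.+2 x - N%:R * flat N.+1 x = 0.
    by rewrite /flat ltNge (ltW x0) /= mulr0 subr0.
  have near0 : {near x, (fun=> 0) =1 flat N}.
    near=> y; rewrite /flat ltNge (_ : y <= 0) //=.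
    by apply: ltW; near: y; exact: lt_nbhsl.
  by apply: DeriveDef; [apply: near_eq_derivable near0 _; exact: derivable_cst
    |rewrite -(near_eq_derive _ near0) derive_cst].
- have nearx : {near x, (fun y : R => y^-1 ^+ N * expR (- y^-1)) =1 flat N}.
    near=> y; rewrite /flat (_ : 0 < y) ?exprVn //.
    by near: y; exact: lt_nbhsr.
  have xn0 : x != 0 by rewrite gt_eqF.
  have dV : is_derive x (1 : R) (fun y : R => y^-1) (- x ^- 2).
    apply: DeriveDef; first by apply: derivableV.
    by rewrite deriveV // derive_id -[LHS]/(- x ^- 2 * 1) mulr1.
  have dE : is_derive x (1 : R) (fun y : R => expR (- y^-1)) (expR (- x^-1) * x ^- 2).
    have dn : is_derive x (1 : R) (fun y : R => - y^-1) (x ^- 2).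
      have [d1 d2] := dV; apply: DeriveDef; first exact: derivableN.
      by rewrite (deriveN d1) d2 opprK.
    have [dn1 dn2] := dn.
    have := is_derive_chain1 dn1 (is_derive_expR (- x^-1)).
    by rewrite dn2.
  have dX := @is_deriveX _ _ _ N _ _ _ dV.
  have := is_deriveM dX dE.
  have E : flat N.+2 x - N%:R * flat N.+1 x =
     (x^-1 ^+ N) *: (expR (- x^-1) * x ^- 2) + expR (- x^-1) *: (N%:R * x^-1 ^+ N.-1 *: - x ^- 2).
    rewrite /flat x0 /GRing.scale /= -!exprVn; case: N {nearx dX} => [|N] /=.
      by rewrite !expr0 !expr2; ring.
    by rewrite !exprS !expr0; ring.
  have EF : (fun y : R => y^-1 ^+ N * expR (- y^-1)) =
     (fun y : R => y^-1) ^+ N * (fun y : R => expR (- y^-1)).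
    by apply/funext => y; rewrite !fctE.
  rewrite -EF => -[d1 d2].
  apply: DeriveDef; first exact: near_eq_derivable nearx d1.
  by rewrite -(near_eq_derive _ nearx) E d2 !fctE.
have -> : flat N.+2 0 - N%:R * flat N.+1 0 = 0 by rewrite /flat ltxx mulr0 subr0.
have f0 : flat N 0 = 0 by rewrite /flat ltxx.
have C : (fun h : R => h^-1 *: ((flat N \o shift 0) (h *: 1) - flat N 0)) @ 0^' --> (0 : R).
  apply/cvgrPdist_le => e e0; near=> h.
  rewrite sub0r normrN /= addr0 -[h *: 1]/(h * 1) mulr1 f0 subr0.
  rewrite -[_ *: _]/(_ * _) normrM normfV.
  have hn0 : h != 0 by near: h; exact: nbhs_dnbhs_neq.
  rewrite ler_pdivrMl ?normr_gt0 //.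
  apply: le_trans (flat_bound _ _) _.
  rewrite -real_normK ?num_real // expr2 mulrCA ler_wpM2l //.
  rewrite -ler_pdivlMl ?ltr0n ?fact_gt0 //.
  near: h; apply: dnbhs0_le; by rewrite mulr_gt0 // invr_gt0 ltr0n fact_gt0.
by apply: DeriveDef; [apply/cvg_ex; exists 0|exact/cvg_lim].
Unshelve. all: by end_near. Qed.

Lemma Ck_flat n k (U : set 'rV[R]_n) N q : open U -> Ck k U q -> Ck k U (flat N \o q).
Proof.
move=> oU; have cf M : continuous (flat M).
  by move=> x; apply/differentiable_continuous/derivable1_diffP; have [] := is_derive_flat M x.
elim: k N q => [|k IH] N q Cq.
  split=> // x Ux; apply: continuous_comp; [exact: Ck_cont Cq _ Ux|exact: cf].
split=> [x Ux|i]; first by apply: continuous_comp; [exact: Ck_cont Cq _ Ux|exact: cf].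
have [_ /(_ i) [dq Cdq]] := Cq; have Cq' := Ck_pred Cq.
have D x : U x -> is_derive x (delta_mx 0 i) (flat N \o q)
    ((flat N.+2 (q x) - N%:R * flat N.+1 (q x)) * partial i q x).
  by move=> Ux; apply: is_derive_chain1; [exact: dq|exact: is_derive_flat].
split=> [x Ux|]; first by have [] := D _ Ux.
have := CkM oU (CkB oU (IH N.+2 _ Cq') (CkZ N%:R oU (IH N.+1 _ Cq'))) Cdq.
by apply: Ck_ext => // x Ux; have [_ E] := D _ Ux; rewrite /partial E.
Qed.

(** With s the squared Euclidean distance to [x0], a quotient a / (a + b), where a
    is supported in s <= e^2 and b in s >= e^2 / 4: it is 1 where b vanishes, and
    the denominator never vanishes because one of the two conditions holds
    strictly at each point. *)
Lemma exists_bump n (x0 : 'rV[R]_n) e : 0 < e ->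
  exists chi : 'rV[R]_n -> R, [/\ forall k U, open U -> Ck k U chi,
    exists2 W, open W /\ W x0 & forall x, W x -> chi x = 1 &
    forall x, chi x != 0 -> `|x - x0| <= e].
Proof.
move=> e0; pose s (x : 'rV[R]_n) := \sum_i (x 0 i - x0 0 i) * (x 0 i - x0 0 i).
have Cs k U : open U -> Ck k U s.
  by move=> oU; apply: Ck_sum => // i; apply: CkM => //; apply: CkB => //;
    [exact: Ck_coord|exact: Ck_cst|exact: Ck_coord|exact: Ck_cst].
pose a (x : 'rV[R]_n) := flat 0 (e ^+ 2 - s x).
pose b (x : 'rV[R]_n) := flat 0 (s x - e ^+ 2 / 4).
have fge0 y : 0 <= flat 0 y by rewrite /flat; case: ifP => // y0; rewrite mulr_ge0 ?expR_ge0 // invr_ge0 exprn_ge0 // ltW.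
have fgt0 y : 0 < y -> 0 < flat 0 y by move=> y0; rewrite /flat y0 mulr_gt0 ?expR_gt0 // invr_gt0 exprn_gt0.
have e2 : 0 < e ^+ 2 by rewrite exprn_gt0.
have ab0 x : a x + b x != 0.
  rewrite gt_eqF //; have [h|h] := ltP (s x) (e ^+ 2).
    by rewrite ltr_wpDr ?fge0 // fgt0 // subr_gt0.
  by rewrite ltr_wpDl ?fge0 // fgt0 // subr_gt0; lra.
have Ca k U : open U -> Ck k U a.
  by move=> oU; apply: (Ck_flat _ oU); apply: CkB => //; [exact: Ck_cst|exact: Cs].
have Cb k U : open U -> Ck k U b.
  by move=> oU; apply: (Ck_flat _ oU); apply: CkB => //; [exact: Cs|exact: Ck_cst].
exists (fun x => a x * (a x + b x)^-1); split.
- move=> k U oU; apply: CkM => //; first exact: Ca.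
  by apply: CkV => //; apply: CkD => //; [exact: Ca|exact: Cb].
- exists (s @^-1` [set y | y < e ^+ 2 / 4]).
    split; last by rewrite /= /s big1 => [|i _]; [rewrite divr_gt0|rewrite subrr mul0r].
    apply: open_comp => [x _|]; last exact: open_lt.
    by apply: (@Ck_cont _ _ 0 setT) => //; apply: Cs; exact: openT.
  move=> x /= sx; have -> : b x = 0 by rewrite /b /flat subr_gt0 ltNge ltW.
  by rewrite addr0 divff //; have := ab0 x; rewrite /b /flat subr_gt0 ltNge (ltW sx) addr0.
- move=> x; apply: contraNle => xe.
  have -> : a x = 0; last by rewrite mul0r.
  rewrite /a /flat subr_gt0 ltNge (_ : e ^+ 2 <= s x) //.
  rewrite leNgt; apply/negP => sx; move: xe; rewrite ltNge => /negP; apply.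
  apply: norm_le_coord => [|i]; first exact: ltW.
  rewrite leNgt; apply/negP; rewrite !mxE => xi.
  have : (x 0 i - x0 0 i) * (x 0 i - x0 0 i) <= s x.
    rewrite /s (bigD1 i) //= lerDl; apply: sumr_ge0 => j _; exact: sqr_ge0.
  move=> /(le_lt_trans)/(_ sx); rewrite -expr2 -real_normK ?num_real //.
  by rewrite ltNge => /negP; apply; rewrite ler_pXn2r ?nnegrE // ltW.
Qed.

End Bump.

(** * Hadamard's lemma *)

Lemma continuous_at_dist (R : realType) (T : topologicalType) (f : T -> R) x :
  (forall eps, 0 < eps -> nbhs x (fun y => `|f x - f y| <= eps)) -> {for x, continuous f}.
Proof. by move=> H; apply/cvgrPdist_le. Qed.

Lemma continuous_bigsum (R : realType) (T : topologicalType) (I : Type) (s : seq I)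
    (F : I -> T -> R) x : (forall i, {for x, continuous (F i)}) ->
  {for x, continuous (fun y => \sum_(i <- s) F i y)}.
Proof.
move=> cF; elim: s => [|i s IH].
  rewrite (_ : (fun y => _) = (fun=> 0)); first exact: cst_continuous.
  by apply/funext => y; rewrite big_nil.
rewrite (_ : (fun y => _) = (fun y => F i y + \sum_(j <- s) F j y)).
  exact: cvgD (cF i) IH.
by apply/funext => y; rewrite big_cons.
Qed.

Section Hadamard.
Variables (R : realType) (n : nat) (x0 : 'rV[R]_n) (e : R).
Notation V := 'rV[R]_n.
Notation mu := (@lebesgue_measure R).
Let B : set V := [set x | `|x - x0| < e].

Lemma open_norm_ball : open B.
Proof.
rewrite (_ : B = ball x0 e); first exact: ball_open.
by rewrite mx_norm_ball; apply/seteqP; split=> x; rewrite /B /ball_ /= distrC.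
Qed.

Definition segment_point (t : R) (x : V) : V := x0 + t *: (x - x0).
Local Notation seg := segment_point.

Lemma seg_ball t x : t \in `[0, 1]%R -> B x -> B (seg t x).
Proof.
rewrite in_itv /= => /andP[t0 t1]; rewrite /B /= => Bx.
rewrite /seg addrC addKr normrZ ger0_norm //; apply: le_lt_trans Bx.
by rewrite ler_piMl.
Qed.

Lemma seg_continuous (z : R * V) : {for z, continuous (fun p : R * V => seg p.1 p.2)}.
Proof.
apply: cvgD; first exact: cvg_cst.
apply: cvgZ; first exact: cvg_fst.
by apply: cvgB; [exact: cvg_snd|exact: cvg_cst].
Qed.

Lemma seg_cont_t (g : V -> R) x : (forall y, B y -> {for y, continuous g}) -> B x ->
  forall t, t \in `[0, 1]%R -> {for t, continuous (fun t => g (seg t x))}.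
Proof.
move=> cg Bx t t01; apply: (@continuous_comp _ _ _ (fun t => seg t x) g); last exact/cg/seg_ball.
apply: cvgD; first exact: cvg_cst.
by apply: cvgZr_tmp; exact: cvg_id.
Qed.

(** Compactness of [[0, 1]] makes the continuity of g along the segments from
    [x0] uniform in the parameter; this gives both the continuity of the means
    below and the domination needed to differentiate under the integral. *)
Lemma seg_uniform (g : V -> R) x eps : (forall y, B y -> {for y, continuous g}) -> B x ->
  0 < eps -> \forall y \near x, forall t, t \in `[0, 1]%R -> `|g (seg t y) - g (seg t x)| <= eps.
Proof.
move=> cg Bx eps0.
have K := (compact_near_coveringP _).1 (@segment_compact R 0 1).
have := K _ (nbhs x) (fun y t => `|g (seg t y) - g (seg t x)| <= eps) _.
move=> /(_ _) H; apply: H => t t01.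
have eps2 : 0 < eps / 2 by rewrite divr_gt0.
have Bt : B (seg t x) by exact: seg_ball.
have c1 : {for (t, x), continuous (fun p : R * V => g (seg p.1 p.2))}.
  apply: (@continuous_comp _ _ _ (fun p : R * V => seg p.1 p.2) g); first exact: seg_continuous.
  exact: cg.
have c2 : {for (t, x), continuous (fun p : R * V => g (seg p.1 x))}.
  apply: (@continuous_comp _ _ _ fst (fun t => g (seg t x))); first exact: cvg_fst.
  exact: seg_cont_t.
move: c1 c2; rewrite /prop_for /continuous_at => /cvgrPdist_le /(_ _ eps2) h1 /cvgrPdist_le /(_ _ eps2) h2.
have h : nbhs (t, x) (fun p : R * V => `|g (seg p.1 p.2) - g (seg p.1 x)| <= eps).
  apply: filterS2 h1 h2 => p /= h1 h2.
  rewrite -(subrKA (g (seg t x))) [eps]splitr; apply: le_trans (ler_normD _ _) _.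
  by rewrite lerD // distrC.
by have [[U1 U2] /= [n1 n2] H'] := h; exists (U1, U2).
Qed.

Lemma within_seg k (g : V -> R) x : (forall y, B y -> {for y, continuous g}) -> B x ->
  {within `[0, 1], continuous (fun t : R => t ^+ k * g (seg t x))}.
Proof.
move=> cg Bx; apply: continuous_in_subspaceT => t /set_mem t01.
by apply: cvgM; [exact: exprn_continuous|exact: seg_cont_t].
Qed.

Lemma integrable_seg k (g : V -> R) x : (forall y, B y -> {for y, continuous g}) -> B x ->
  mu.-integrable `[0, 1] (EFin \o (fun t : R => t ^+ k * g (seg t x))).
Proof.
move=> cg Bx; apply: continuous_compact_integrable; first exact: segment_compact.
exact: within_seg.
Qed.

Lemma integrable_EFinB (f g : R -> R) : mu.-integrable `[0, 1] (EFin \o f) ->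
  mu.-integrable `[0, 1] (EFin \o g) -> mu.-integrable `[0, 1] (EFin \o (fun t => f t - g t)).
Proof.
move=> If Ig; have := integrableB _ If Ig; move=> /(_ (measurable_itv _)).
by congr (integrable _ _ _); apply/funext => t /=; rewrite EFinB.
Qed.

Lemma integrable_EFinD (f g : R -> R) : mu.-integrable `[0, 1] (EFin \o f) ->
  mu.-integrable `[0, 1] (EFin \o g) -> mu.-integrable `[0, 1] (EFin \o (fun t => f t + g t)).
Proof.
move=> If Ig; have := integrableD _ If Ig; move=> /(_ (measurable_itv _)).
by congr (integrable _ _ _); apply/funext => t /=; rewrite EFinD.
Qed.

Lemma integrable_01_cst (a : R) : mu.-integrable `[0, 1] (EFin \o (fun=> a)).
Proof.
apply: continuous_compact_integrable; first exact: segment_compact.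
by apply: continuous_subspaceT => z; exact: cst_continuous.
Qed.

(** The weight t^k keeps the family stable under differentiation: the partial
    derivatives of the mean of weight k of g are the means of weight k + 1 of the
    partial derivatives of g. *)
Definition segment_mean (k : nat) (g : V -> R) (x : V) : R :=
  \int[mu]_(t in `[0, 1]) (t ^+ k * g (seg t x)).

Lemma integral_01_cst (a : R) : \int[mu]_(t in `[0, 1]) a = a.
Proof.
rewrite Rintegral_cst //= lebesgue_measure_itv /= lte_fin ltr01 /=.
by rewrite oppr0 addr0 mulr1.
Qed.

Lemma segment_mean_continuous k g : (forall y, B y -> {for y, continuous g}) ->
  forall x, B x -> {for x, continuous (segment_mean k g)}.
Proof.
move=> cg x Bx; apply: continuous_at_dist => eps eps0.
have oB := open_norm_ball; have nB := open_nbhs_nbhs (conj oB Bx).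
have h := seg_uniform cg Bx eps0.
have nh : nbhs x (B `&` (fun y => forall t, t \in `[0, 1]%R -> `|g (seg t y) - g (seg t x)| <= eps)).
  exact: (@filterI _ (nbhs x) _ _ _ nB h).
suff sub y : (B `&` (fun y => forall t, t \in `[0, 1]%R -> `|g (seg t y) - g (seg t x)| <= eps)) y ->
    `|segment_mean k g x - segment_mean k g y| <= eps.
  exact: (@filterS _ (nbhs x) _ _ _ sub nh).
move=> [By hy].
have Ix := integrable_seg k cg Bx; have Iy := integrable_seg k cg By.
rewrite /segment_mean -RintegralB //.
apply: le_trans (le_normr_Rintegral _ _) _ => //.
  exact: integrable_EFinB.
rewrite -[leRHS]integral_01_cst; apply: le_Rintegral => //.
- by apply: integrable_norm => //; exact: integrable_EFinB.
- exact: integrable_01_cst.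
- move=> t t01; rewrite -mulrBr normrM.
  have t01' : t \in `[0, 1]%R by [].
  move: (t01'); rewrite in_itv /= => /andP[t0 t1].
  rewrite -[leRHS]mul1r; apply: ler_pM => //; last by rewrite distrC; exact: hy.
  by rewrite ger0_norm ?exprn_ge0 // exprn_ile1.
Qed.

Lemma is_derive_segment_mean k g i x : Ck 1 B g -> B x ->
  is_derive x (delta_mx 0 i) (segment_mean k g) (segment_mean k.+1 (partial i g) x).
Proof.
move=> Cg Bx; pose v : V := delta_mx 0 i.
have [cg dg] := Cg; have [_ [cpg _]] := dg i.
have oB := open_norm_ball; have nB := open_nbhs_nbhs (conj oB Bx).
have cx : {for (0 : R), continuous (fun s : R => s *: v + x)}.
  by apply: cvgD; [apply: cvgZr_tmp; exact: cvg_id|exact: cvg_cst].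
have x00 : (0 : R) *: v + x = x by rewrite scale0r add0r.
have nall : nbhs x (fun y => B y /\ forall t, t \in `[0, 1]%R -> `|partial i g (seg t y) - partial i g (seg t x)| <= 1).
  apply: (@filterI _ (nbhs x) _ _ _ nB); exact: seg_uniform.
have : nbhs (0 : R) (fun s => B (s *: v + x) /\
   forall t, t \in `[0, 1]%R -> `|partial i g (seg t (s *: v + x)) - partial i g (seg t x)| <= 1).
  by move: cx; rewrite /prop_for /continuous_at x00 => cx; exact: cx nall.
move=> /nbhs_ballP [d /= d0 Bd].
pose I : set R := `]- d, d[%classic; pose J : set R := `[0, 1]%classic.
pose f (s t : R) := t ^+ k * g (seg t (s *: v + x)).
have sI s : I s -> B (s *: v + x) /\
   forall t, t \in `[0, 1]%R -> `|partial i g (seg t (s *: v + x)) - partial i g (seg t x)| <= 1.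
  by move=> sd; apply: Bd; rewrite /ball /= sub0r normrN ltr_norml; move: sd; rewrite /I /= in_itv.
have df s t : I s -> J t ->
    is_derive s 1 (f ^~ t) (t ^+ k.+1 * partial i g (seg t (s *: v + x))).
  move=> /sI [Bs _] t01.
  have t01' : t \in `[0, 1]%R by [].
  have Bst := seg_ball t01' Bs.
  have E u : seg t (u *: v + x) = seg t x + u *: (t *: v).
    by rewrite /seg -[u *: v + x - x0]addrA scalerDr [_ *: (u *: v) + _]addrC addrA !scalerA [t * u]mulrC.
  have [dgs Dgs] := differentiable_C1 open_norm_ball Cg Bst.
  have dgs' : derivable g (seg t x + s *: (t *: v)) (t *: v) by rewrite -E; exact: diff_derivable.
  have := is_derive_line dgs'; rewrite -E Dgs.
  have -> : \sum_j (t *: v) 0 j * partial j g (seg t (s *: v + x)) = t * partial i g (seg t (s *: v + x)).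
    rewrite (bigD1 i) //= big1 ?addr0 => [|j ji]; first by rewrite !mxE !eqxx mulr1.
    by rewrite !mxE (negbTE ji) andbF mulr0 mul0r.
  move=> [d1 d2]; apply: DeriveDef.
    rewrite (_ : f^~ t = (t ^+ k) *: (fun s => g (seg t x + s *: (t *: v)))).
      exact: derivableZ.
    by apply/funext => u; rewrite /f E.
  rewrite (_ : f^~ t = (t ^+ k) *: (fun s => g (seg t x + s *: (t *: v)))).
    rewrite deriveZ //; rewrite d2 -[LHS]/(t ^+ k * _) mulrA -exprSr //.
  by apply/funext => u; rewrite /f E.
have I0 : I 0 by rewrite /I /= in_itv /= oppr_lt0 d0.
have intf s : I s -> mu.-integrable `[0, 1] (EFin \o f s).
  by move=> /sI [Bs _]; exact: integrable_seg.
pose G (t : R) := `|t ^+ 0 * partial i g (seg t x)| + 1.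
have G0 t : 0 <= G t by rewrite addr_ge0.
have intG : mu.-integrable `[0, 1] (EFin \o G).
  apply: integrable_EFinD; last exact: integrable_01_cst.
  by apply: integrable_norm => //; exact: integrable_seg.
have Gub s t : I s -> J t -> `|partial1of2 f s t| <= G t.
  move=> Is It; rewrite partial1of2E (@derive_val _ _ _ _ _ _ _ (df _ _ Is It)).
  have t01' : t \in `[0, 1]%R by [].
  have [_ /(_ _ t01') h] := sI _ Is.
  move: (t01'); rewrite in_itv /= => /andP[t0 t1].
  rewrite normrM /G expr0 mul1r.
  apply: (@le_trans _ _ `|partial i g (seg t (s *: v + x))|).
    by rewrite -[leRHS]mul1r ler_wpM2r // ger0_norm ?exprn_ge0 // exprn_ile1.
  rewrite -lerBlDl; apply: le_trans h; exact: lerB_dist.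
have m01 : measurable (`[0, 1]%classic : set (measurableTypeR R)) by exact: measurable_itv.
have df1 s t : I s -> J t -> derivable (f^~ t) s 1.
  by move=> Is It; have [] := df _ _ Is It.
have D := derivable_under_integral m01 I0 intf df1 G0 intG Gub.
have E := differentiation_under_integral m01 I0 intf df1 G0 intG Gub.
have FE : (fun s : R => segment_mean k g (s *: v + x)) = (fun s => \int[mu]_(t in `[0, 1]) f s t) by [].
apply: DeriveDef.
  by apply: (derivable1P _ _ _).2; rewrite FE.
rewrite derive_along_line FE -derive1E E /segment_mean; apply: eq_Rintegral => t /set_mem It.
by rewrite partial1of2E (@derive_val _ _ _ _ _ _ _ (df _ _ I0 It)) x00.
Qed.

Lemma Ck_segment_mean k l g : Ck l B g -> Ck l B (segment_mean k g).
Proof.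
elim: l k g => [|l IH] k g Cg.
  by split=> // x Bx; apply: segment_mean_continuous Bx; exact: Ck_cont Cg.
split=> [x Bx|i]; first by apply: segment_mean_continuous Bx; exact: Ck_cont Cg.
have C1 : Ck 1 B g by exact: Ck_le Cg.
split=> [x Bx|]; first by have [] := is_derive_segment_mean k i C1 Bx.
have [_ /(_ i) [_ Cpg]] := Cg.
apply: Ck_ext (IH k.+1 _ Cpg) => [|x Bx]; first exact: open_norm_ball.
by rewrite /partial (@derive_val _ _ _ _ _ _ _ (is_derive_segment_mean k i C1 Bx)).
Qed.

(** The fundamental theorem of calculus on the segment from [x0] to [x]. *)
Lemma hadamard g x : Ck 1 B g -> B x ->
  g x = g x0 + \sum_i (x 0 i - x0 0 i) * segment_mean 0 (partial i g) x.
Proof.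
move=> Cg Bx; have [cg dg] := Cg.
have cp i y : B y -> {for y, continuous (partial i g)} by have [_ [+ _]] := dg i; exact.
pose c (t : R) := \sum_i (x 0 i - x0 0 i) * partial i g (seg t x).
have D (t : R) : t \in `[0, 1]%R -> is_derive t 1 (fun t => g (seg t x)) (c t).
  move=> t01; have Bt := seg_ball t01 Bx.
  have [dgs Dgs] := differentiable_C1 open_norm_ball Cg Bt.
  have := is_derive_line (@diff_derivable _ _ _ g (seg t x) (x - x0) dgs).
  by rewrite Dgs /c; under eq_bigr do rewrite !mxE.
have ct (t : R) : t \in `[0, 1]%R -> {for t, continuous (fun t => g (seg t x))}.
  exact: seg_cont_t.
have cc : {within `[0, 1], continuous c}.
  apply: continuous_in_subspaceT => t /set_mem t01.
  apply: continuous_bigsum => i; apply: cvgM; first exact: cvg_cst.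
  exact: (seg_cont_t (cp i)).
have t0 : (0 : R) \in `[0, 1]%R by rewrite in_itv /= lexx ler01.
have t1 : (1 : R) \in `[0, 1]%R by rewrite in_itv /= lexx ler01.
have := @continuous_FTC2 R c (fun t => g (seg t x)) 0 1 ltr01 cc.
have seg0 : seg 0 x = x0 by rewrite /seg scale0r addr0.
have seg1 : seg 1 x = x by rewrite /seg scale1r addrC subrK.
rewrite seg0 seg1 => FTC.
have : (\int[mu]_(t in `[0%R, 1%R]) (c t)%:E = (g x)%:E - (g x0)%:E)%E.
  apply: FTC; first split.
  - move=> t tI; have t01 : t \in `[0, 1]%R by exact: subset_itv_oo_cc tI.
    by have [] := D t t01.
  - apply: cvg_at_right_filter; exact: ct.
  - apply: cvg_at_left_filter; exact: ct.
  - move=> t tI; have t01 : t \in `[0, 1]%R by exact: subset_itv_oo_cc tI.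
    by rewrite derive1E; have [_ ->] := D t t01.
move=> /(congr1 fine); rewrite -EFinB /= -/(Rintegral mu `[0, 1] c) => E.
apply/eqP; rewrite addrC -subr_eq -E; apply/eqP; rewrite /c.
have I i : mu.-integrable `[0, 1] (EFin \o (fun t : R => t ^+ 0 * partial i g (seg t x))).
  by apply: integrable_seg => //; exact: cp.
have I' i a : mu.-integrable `[0, 1] (EFin \o (fun t : R => a * partial i g (seg t x))).
  have := @integrableZl _ _ _ mu `[0, 1] _ a _ (I i).
  move=> /(_ (measurable_itv _)); congr (integrable _ _ _); apply/funext => t /=.
  by rewrite expr0 mul1r EFinM.
suff H (s : seq 'I_n) : mu.-integrable `[0, 1] (EFin \o (fun t => \sum_(i <- s) (x 0 i - x0 0 i) * partial i g (seg t x))) /\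
   \int[mu]_(t in `[0, 1]) (\sum_(i <- s) (x 0 i - x0 0 i) * partial i g (seg t x)) =
   \sum_(i <- s) (x 0 i - x0 0 i) * segment_mean 0 (partial i g) x by have [] := H (index_enum 'I_n).
elim: s => [|i s [IHi IHE]].
  rewrite big_nil (_ : (fun t => _) = (fun=> 0)); last first.
    by apply/funext => t; rewrite big_nil.
  by rewrite integral_01_cst; split=> //; exact: integrable_01_cst.
rewrite big_cons (_ : (fun t => _) = (fun t => (x 0 i - x0 0 i) * partial i g (seg t x) +
   \sum_(i <- s) (x 0 i - x0 0 i) * partial i g (seg t x))); last first.
  by apply/funext => t; rewrite big_cons.
split; first by apply: integrable_EFinD => //; exact: I'.
rewrite RintegralD; [|by []|exact: I'|exact: IHi].
rewrite IHE; congr (_ + _).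
rewrite /segment_mean -RintegralZl //.
by apply: eq_Rintegral => t _; rewrite expr0 mul1r.
Qed.

Lemma hadamard_factors g : (forall k, Ck k B g) ->
  exists G : 'I_n -> V -> R, [/\ forall i k, Ck k B (G i),
    forall i, G i x0 = partial i g x0 &
    forall x, B x -> g x = g x0 + \sum_i (x 0 i - x0 0 i) * G i x].
Proof.
move=> Cg; exists (fun i => segment_mean 0 (partial i g)); split=> [i k|i|x Bx].
- by apply: Ck_segment_mean; have [_ /(_ i) []] := Cg k.+1.
- rewrite /segment_mean -[RHS]integral_01_cst; apply: eq_Rintegral => t _.
  by rewrite expr0 mul1r /seg subrr scaler0 addr0.
- exact: hadamard (Cg 1) Bx.
Qed.

End Hadamard.

(** * Smooth functions and tangent vectors on a manifold *)

Lemma continuous_dist_to (R : realType) (T : topologicalType) (W : normedModType R)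
  (f : T -> W) (p : W) x : {for x, continuous f} -> {for x, continuous (fun y => `|f y - p|)}.
Proof. by move=> cf; apply: cvg_norm; apply: cvgB; [exact: cf|exact: cvg_cst]. Qed.

Section SmoothFunctions.
Variables (R : realType) (n : nat) (M : manifold R n).
Implicit Types (c : chart R M n) (W U : set M) (f g s : M -> R).

(** The auxiliary function [g] may differ from [f] outside the chart, which leaves
    room for extensions by zero. *)
Lemma smooth_in_local c W f :
  (forall x, cdom c x -> W x -> exists U g, [/\ open U, U x,
     forall y, cdom c y -> U y -> g y = f y & smooth_in c U g]) ->
  smooth_in c W f.
Proof.
move=> H k; apply: Ck_local => _ [x [cx Wx] <-].
have [U [g [oU Ux gf Sg]]] := H x cx Wx.
exists (chart_image c U), (g \o cinv c); first exact: chart_image_open.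
by split; [exists x|split; [move=> _ [y [cy Uy] <-] /=; rewrite cmapK // gf|exact: Sg]].
Qed.

Lemma smooth_in_sub c W U f : W `<=` U -> smooth_in c U f -> smooth_in c W f.
Proof.
by move=> WU Sf k; apply: Ck_sub (Sf k) => _ [x [cx /WU Ux] <-]; exists x.
Qed.

Lemma smooth_in_cst c W (a : R) : smooth_in c W (fun=> a).
Proof. by move=> k; exact: Ck_cst. Qed.

Lemma smooth_in_sum (I : Type) (s : seq I) c W (F : I -> M -> R) : open W ->
  (forall i, smooth_in c W (F i)) -> smooth_in c W (fun x => \sum_(i <- s) F i x).
Proof.
move=> oW SF; elim: s => [|i s IH].
  by apply: smooth_in_ext (smooth_in0 c W) => // x _ _; rewrite big_nil.
apply: smooth_in_ext (smooth_in_lin 1 oW (SF i) IH) => // x _ _.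
by rewrite big_cons mul1r.
Qed.

Lemma smooth_in_change c c' W s : atlas c -> atlas c' -> open W -> W `<=` cdom c ->
  smooth_in c W s -> smooth_in c' W s.
Proof.
move=> Ac Ac' oW Wc Ss k.
have Ci := chart_image_open (c:=c') oW; have Ci' := chart_image_open (c:=c) oW.
have H : Ck k (chart_image c' W) ((s \o cinv c) \o (cmap c \o cinv c')).
  apply: (Ck_comp Ci Ci' _ _ (Ss k)) => [j|_ [x [cx Wx] <-]].
    apply: Ck_sub (@atlas_compatible _ _ M c' c Ac' Ac j k) => _ [x [cx Wx] <-].
    by exists x => //; split=> //; exact: Wc.
  by rewrite /= cmapK //; exists x => //; split=> //; exact: Wc.
apply: Ck_ext H => // _ [x [cx Wx] <-] /=.
by rewrite !cmapK //; exact: Wc.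
Qed.

Lemma smooth_in_coord c i : smooth_in c setT (fun x => cmap c x 0 i).
Proof.
move=> k; apply: Ck_ext (Ck_coord k _ i); first by apply: chart_image_open; exact: openT.
by move=> _ [x [cx _] <-] /=; rewrite cmapK.
Qed.

Lemma open_chart_preimage c (O : set 'rV[R]_n) : open O -> open (cdom c `&` cmap c @^-1` O).
Proof.
move=> oO; have := @cmap_continuous _ _ _ c.
rewrite continuous_open_subspace; last exact: cdom_open.
move=> cc; rewrite openE => z [cz Oz].
have oc := cdom_open c; have ncz := open_nbhs_nbhs (conj oc cz).
apply: (@filterI _ (nbhs z) _ _ _ ncz).
by apply: (cc z); [exact/mem_set|apply: open_nbhs_nbhs].
Qed.

(** The closed support is recorded along with the function, so that a product of
    the bump with a function that is smooth on [U] only is smooth on [M]: outside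
    the support it vanishes on an open set. *)
Record bump_at (m : M) (U : set M) := BumpAt {
  bump_fun :> Cinf M;
  bump_nbhd : set M;
  bump_supp : set M;
  bump_open : open bump_nbhd;
  bump_mem : bump_nbhd m;
  bump_eq1 : forall x, bump_nbhd x -> bump_fun x = 1;
  bump_closed : closed bump_supp;
  bump_sub : bump_supp `<=` U;
  bump_eq0 : forall x, ~ bump_supp x -> bump_fun x = 0 }.

(** A bump function of R^n supported in a closed ball inside a chart. The preimage
    of the ball is compact, hence closed because the manifold is Hausdorff; this
    is what makes the extension by zero smooth. *)
Lemma exists_bump_at m U : open U -> U m -> inhabited (bump_at m U).
Proof.
move=> oU Um; have [c Ac cm] := atlas_cover m.
pose p := cmap c m.
have oO := chart_image_open (c:=c) oU.
have Op : chart_image c U p by exists m.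
have := open_nbhs_nbhs (conj oO Op) => /nbhs_ballP [e /= e0 Be].
pose e' := e / 2.
have e'0 : 0 < e' by rewrite divr_gt0.
pose D : set 'rV[R]_n := [set y | `|y - p| <= e'].
have DO : D `<=` chart_image c U.
  move=> y Dy; apply: Be; rewrite mx_norm_ball /ball_ /= distrC; apply: le_lt_trans Dy _.
  by rewrite /e' ltr_pdivrMr // ltr_pMr // ltr1n.
have cD : compact D.
  apply: bounded_closed_compact.
    exists (`|p| + e'); split; first exact: num_real.
    move=> x px y; rewrite /D /= => Dy; apply: le_trans (ltW px).
    by rewrite -(subrK p y) addrC; apply: le_trans (ler_normD _ _) _; rewrite lerD2l.
  rewrite (_ : D = (fun y => `|y - p|) @^-1` [set r | r <= e']) //.
  apply: closed_comp; last exact: closed_le.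
  by move=> y _; exact: (@continuous_dist_to _ _ _ id p y (fun A => id)).
pose K := cinv c @` D.
have cK : compact K.
  apply: continuous_compact cD.
  apply: continuous_subspaceW (@cinv_continuous _ _ _ c).
  by move=> y /DO [x [cx _] <-]; exists x.
have clK : closed K by apply: compact_closed cK; exact: mspace_hausdorff.
have KU : K `<=` cdom c `&` U by move=> _ [y /DO [x [cx Ux] <-] <-]; rewrite cmapK.
have [chi0 [Cchi [W1 [oW1 W1p] chi1] chi_supp]] := exists_bump p e'0.
pose chi (x : M) := if `[< cdom c x >] then chi0 (cmap c x) else 0.
have chi_in x : cdom c x -> chi x = chi0 (cmap c x) by move=> cx; rewrite /chi asboolT.
have chi_out x : ~ K x -> chi x = 0.
  move=> nK; rewrite /chi; case: asboolP => // cx; apply/eqP; apply: contrapT => /negP h.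
  by apply: nK; exists (cmap c x); [exact: chi_supp|exact: cmapK].
have S0 : smooth_in c (cdom c) chi.
  move=> k; apply: Ck_ext (Cchi k _ _); try by apply: chart_image_open; exact: cdom_open.
  by move=> _ [x [cx _] <-] /=; rewrite cmapK // chi_in.
have Schi : Cinf_space M chi.
  move=> c' Ac'; apply: smooth_in_local => x cx _.
  have [Kx|nKx] := EM (K x).
    exists (cdom c), chi; split=> //; [exact: cdom_open|by have [] := KU _ Kx|].
    by apply: smooth_in_change S0 => //; exact: cdom_open.
  exists (~` K), (fun=> 0); split=> //; first exact: closed_openC.
    by move=> y _ /chi_out.
  exact: smooth_in0.
constructor; exists (sub_mk Schi) (cdom c `&` cmap c @^-1` W1) K => //.
- exact: open_chart_preimage.
- by move=> x [cx /chi1]; rewrite /Cinf_fun /= chi_in.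
- by move=> x /KU [].
Qed.

Lemma bump_mul_smooth m U (b : bump_at m U) s : open U -> smooth_on U s ->
  Cinf_space M (fun x => b x * s x).
Proof.
move=> oU Ss c Ac; apply: smooth_in_local => x cx _.
have [Kx|nKx] := EM (bump_supp b x).
  exists U, (fun x => b x * s x); split=> //; first exact: bump_sub Kx.
  apply: smooth_in_mul => //; last exact: Ss.
  by apply: smooth_in_sub (Cinf_smooth b Ac).
exists (~` bump_supp b), (fun=> 0); split=> //; first exact/closed_openC/bump_closed.
  by move=> y _ nKy; rewrite bump_eq0 // mul0r.
exact: smooth_in0.
Qed.

Definition bump_mul m U (b : bump_at m U) (oU : open U) s (Ss : smooth_on U s) : Cinf M :=
  sub_mk (bump_mul_smooth b oU Ss).

Lemma bump_nbhd_sub m U (b : bump_at m U) : bump_nbhd b `<=` U.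
Proof.
move=> x Vx; apply: (@bump_sub _ _ b); apply: contrapT => /(@bump_eq0 _ _ b).
by rewrite bump_eq1 //; move/eqP; rewrite oner_eq0.
Qed.

Lemma bump_center m U (b : bump_at m U) : b m = 1.
Proof. by apply: bump_eq1; exact: bump_mem. Qed.

Lemma Cinf_glue f :
  (forall m, exists U (g : Cinf M), [/\ open U, U m & forall x, U x -> f x = g x]) ->
  Cinf_space M f.
Proof.
move=> H c Ac; apply: smooth_in_local => x cx _.
have [U [g [oU Ux fg]]] := H x.
exists U, g; split=> // [y _ Uy|]; first by rewrite fg.
by apply: smooth_in_sub (Cinf_smooth g Ac).
Qed.

Lemma Cinf_lin (a : R) (f g : Cinf M) m : Cinf_fun (a *: f + g) m = a * f m + g m.
Proof. by []. Qed.

Lemma Cinf_mulE (f g : Cinf M) m : Cinf_mul f g m = f m * g m.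
Proof. by []. Qed.

Lemma Cinf_cst_smooth (a : R) : Cinf_space M (fun=> a).
Proof. by move=> c _; exact: smooth_in_cst. Qed.
Definition Cinf_cst (a : R) : Cinf M := sub_mk (Cinf_cst_smooth a).

(** The i-th partial derivative in the chart. *)
Definition dcoord c i f (m : M) : R := partial i (f \o cinv c) (cmap c m).

Lemma dcoord_derivable c i f U m : open U -> smooth_in c U f -> cdom c m -> U m ->
  derivable (f \o cinv c) (cmap c m) (delta_mx 0 i).
Proof.
move=> oU Sf cm Um; have [_ /(_ i) [+ _]] := Sf 1.
by apply; exists m.
Qed.

Lemma dcoord_smooth c i f U : open U -> smooth_in c U f -> smooth_in c U (dcoord c i f).
Proof.
move=> oU Sf k; have [_ /(_ i) [_ H]] := Sf k.+1.
apply: Ck_ext H; first exact: chart_image_open.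
by move=> _ [x [cx Ux] <-] /=; rewrite /dcoord cmapK.
Qed.

Lemma dcoord_local c i f g U m : open U -> U m -> cdom c m ->
  (forall x, cdom c x -> U x -> f x = g x) -> dcoord c i f m = dcoord c i g m.
Proof.
move=> oU Um cm fg; apply: near_eq_derive.
apply: (open_near_eq (chart_image_open (c:=c) oU)); last by exists m.
by move=> _ [x [cx Ux] <-] /=; rewrite cmapK // fg.
Qed.

Lemma dcoord_mul c i f g U m : open U -> smooth_in c U f -> smooth_in c U g ->
  cdom c m -> U m ->
  dcoord c i (fun x => f x * g x) m = f m * dcoord c i g m + g m * dcoord c i f m.
Proof.
move=> oU Sf Sg cm Um.
have df := dcoord_derivable (i:=i) oU Sf cm Um; have dg := dcoord_derivable (i:=i) oU Sg cm Um.
have -> : dcoord c i (fun x => f x * g x) m = 'D_(delta_mx 0 i) ((f \o cinv c) * (g \o cinv c)) (cmap c m) by [].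
by rewrite (deriveM df dg) /= cmapK.
Qed.

Lemma dcoord_lin c i (a : R) f g U m : open U -> smooth_in c U f -> smooth_in c U g ->
  cdom c m -> U m ->
  dcoord c i (fun x => a * f x + g x) m = a * dcoord c i f m + dcoord c i g m.
Proof.
move=> oU Sf Sg cm Um.
have df := dcoord_derivable (i:=i) oU Sf cm Um; have dg := dcoord_derivable (i:=i) oU Sg cm Um.
have -> : dcoord c i (fun x => a * f x + g x) m = 'D_(delta_mx 0 i) (a *: (f \o cinv c) + (g \o cinv c)) (cmap c m) by [].
by rewrite deriveD ?deriveZ //; exact: derivableZ.
Qed.

Lemma dcoord_coord c i j m : cdom c m -> dcoord c i (fun x => cmap c x 0 j) m = (i == j)%:R.
Proof.
move=> cm; have oI : open (chart_image c setT) by apply: chart_image_open; exact: openT.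
transitivity (partial i (fun y : 'rV[R]_n => y 0 j) (cmap c m)).
  apply: near_eq_derive; apply: (open_near_eq oI); last by exists m.
  by move=> _ [x [cx _] <-] /=; rewrite cmapK.
by rewrite /partial (@derive_val _ _ _ _ _ _ _ (is_derive_coord _ _ _)) mxE eqxx /= eq_sym.
Qed.

Lemma dcoord_cst c i (a : R) m : dcoord c i (fun=> a) m = 0.
Proof. exact: derive_cst. Qed.

Lemma dcoord_ext c i f g m : (forall x, f x = g x) -> dcoord c i f m = dcoord c i g m.
Proof. by move=> fg; congr (dcoord c i _ m); apply/funext. Qed.

Lemma dcoord_affine c i (a0 : R) (a : 'I_n -> R) (x0 : 'rV[R]_n) m : cdom c m ->
  dcoord c i (fun y => a0 + \sum_l a l * (cmap c y 0 l - x0 0 l)) m = a i.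
Proof.
move=> cm; have SX l : smooth_in c setT (fun y => cmap c y 0 l - x0 0 l).
  have := smooth_in_lin 1 openT (smooth_in_coord c l) (smooth_in_cst c setT (- x0 0 l)).
  by apply: smooth_in_ext => [|y _ _]; [exact: openT|rewrite mul1r].
have SF l : smooth_in c setT (fun y => a l * (cmap c y 0 l - x0 0 l)).
  by apply: smooth_in_mul; [exact: openT|exact: smooth_in_cst|exact: SX].
have dX l : dcoord c i (fun y => cmap c y 0 l - x0 0 l) m = (i == l)%:R.
  have := dcoord_lin i 1 openT (smooth_in_coord c l) (smooth_in_cst c setT (- x0 0 l)) cm I.
  rewrite dcoord_coord // dcoord_cst addr0 mul1r => <-.
  by apply: dcoord_ext => y; rewrite mul1r.
have dF l : dcoord c i (fun y => a l * (cmap c y 0 l - x0 0 l)) m = a l * (i == l)%:R.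
  by rewrite (dcoord_mul i openT (smooth_in_cst c setT (a l)) (SX l) cm I) dcoord_cst mulr0 addr0 dX.
suff H (s : seq 'I_n) : dcoord c i (fun y => a0 + \sum_(l <- s) a l * (cmap c y 0 l - x0 0 l)) m =
   \sum_(l <- s) a l * (i == l)%:R.
  rewrite H (bigD1 i) //= eqxx mulr1 big1 ?addr0 // => l li.
  by rewrite eq_sym (negbTE li) mulr0.
elim: s => [|l s IH].
  transitivity (dcoord c i (fun=> a0) m); last by rewrite dcoord_cst big_nil.
  by apply: dcoord_ext => y; rewrite big_nil addr0.
rewrite big_cons -dF -IH.
have Ss : smooth_in c setT (fun y => a0 + \sum_(l <- s) a l * (cmap c y 0 l - x0 0 l)).
  have := smooth_in_lin 1 openT (smooth_in_cst c setT a0) (smooth_in_sum s openT SF).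
  by apply: smooth_in_ext => [|y _ _]; [exact: openT|rewrite mul1r].
have := dcoord_lin i 1 openT (SF l) Ss cm I; rewrite mul1r => <-.
by apply: dcoord_ext => y; rewrite big_cons mul1r addrCA.
Qed.

Lemma coord_tangent_subproof c i m (Ac : atlas c) (cm : cdom c m) :
  tangent_space m (fun f : Cinf M => dcoord c i f m : R^o).
Proof.
have S (f : Cinf M) := Cinf_smooth f Ac.
split=> [a f g|f g]; first exact: (dcoord_lin i a openT (S f) (S g) cm I).
exact: (dcoord_mul i openT (S f) (S g) cm I).
Qed.
Definition coord_tangent c i m Ac cm : tangent m := sub_mk (@coord_tangent_subproof c i m Ac cm).

(** By Hadamard's lemma, near m, f = f(m) + sum_i (x_i - x_i(m)) G_i with
    G_i(m) = d_i f(m). The square of a bump function turns this into an identity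
    between global functions, one factor for the coordinates and one for the G_i,
    to which the Leibniz rule applies. *)
Lemma tangent_coordinates c m : atlas c -> cdom c m ->
  exists x : 'I_n -> Cinf M, (forall i, x i m = 0) /\
    forall (v : tangent m) (f : Cinf M), v f = \sum_i v (x i) * dcoord c i f m.
Proof.
move=> Ac cm; pose p := cmap c m.
have oO : open (chart_image c setT) by apply: chart_image_open; exact: openT.
have Op : chart_image c setT p by exists m.
have := open_nbhs_nbhs (conj oO Op) => /nbhs_ballP [e /= e0 Be].
pose B : set 'rV[R]_n := [set y | `|y - p| < e].
have oB : open B by exact: open_norm_ball.
have BO : B `<=` chart_image c setT.
  by move=> y By; apply: Be; rewrite mx_norm_ball /ball_ /= distrC.
have Bp : B p by rewrite /B /= subrr normr0.
pose U := cdom c `&` cmap c @^-1` B.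
have oU : open U by exact: open_chart_preimage.
have Um : U m by [].
have [b] := exists_bump_at oU Um.
have Uc : U `<=` cdom c by move=> x [].
have Sx i : smooth_on U (fun x => cmap c x 0 i - p 0 i).
  move=> c' Ac'; apply: (smooth_in_change Ac) => //.
  have := smooth_in_lin 1 oU (smooth_in_sub (@subsetT _ U) (smooth_in_coord c i)) (smooth_in_cst c U (- p 0 i)).
  by apply: smooth_in_ext => // x _ _; rewrite mul1r.
pose x i := bump_mul b oU (Sx i).
exists x; split=> [i|v f]; first by rewrite /x /Cinf_fun /= subrr mulr0.
pose g := f \o cinv c.
have Cg k : Ck k B g by apply: Ck_sub (Cinf_smooth f Ac k).
have [G [CG G0 GE]] := hadamard_factors Cg.
have SG i : smooth_on U (fun x => G i (cmap c x)).
  move=> c' Ac'; apply: (smooth_in_change Ac) => // k.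
  have CI : open (chart_image c U) by exact: chart_image_open.
  have := Ck_sub _ (CG i k) => /(_ (chart_image c U)) H.
  apply: Ck_ext (H _) => //; first by move=> _ [y [cy _] <-] /=; rewrite cmapK.
  by move=> _ [y [cy []] _ By <-].
pose y i := bump_mul b oU (SG i).
have Gp i : G i p = dcoord c i f m by exact: G0.
have E : Cinf_mul (Cinf_mul b b) f = f m *: Cinf_mul b b + \sum_i Cinf_mul (x i) (y i).
  apply: Cinf_ext => z; rewrite Cinf_lin !Cinf_mulE.
  have -> : Cinf_fun (\sum_i Cinf_mul (x i) (y i)) z = \sum_i (b z * (cmap c z 0 i - p 0 i)) * (b z * G i (cmap c z)).
    by elim/big_rec2: _ => [//|i a1 a2 _ <-].
  have [Kz|nKz] := EM (bump_supp b z); last first.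
    by rewrite bump_eq0 // !mul0r mulr0 add0r big1 // => i _; rewrite !mul0r.
  have [cz Bz] := bump_sub Kz.
  have := GE _ Bz; rewrite /g /= !cmapK // => ->.
  rewrite mulrDr mulrC; congr (_ + _); rewrite mulr_sumr; apply: eq_bigr => i _.
  by ring.
have v0 : v 0 = 0 by have := tangent_lin v (-1) 0 0; rewrite scaleN1r addNr mulN1r addNr.
have := congr1 v E; rewrite tangent_lin !tangent_mul !Cinf_mulE !bump_center.
have -> : v (\sum_i Cinf_mul (x i) (y i)) = \sum_i v (x i) * dcoord c i f m.
  transitivity (\sum_i v (Cinf_mul (x i) (y i))).
    elim/big_rec2: _ => [//|i a1 a2 _ <-].
    by have := tangent_lin v 1 (Cinf_mul (x i) (y i)) a2; rewrite scale1r mul1r.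
  apply: eq_bigr => i _; rewrite tangent_mul.
  have -> : x i m = 0 by rewrite /x /Cinf_fun /= subrr mulr0.
  have -> : y i m = dcoord c i f m by rewrite /y /Cinf_fun /= bump_center mul1r -Gp.
  by rewrite mul0r add0r mulrC.
by rewrite !mul1r addrC => /addrI.
Qed.

End SmoothFunctions.

(** * Local frames of a vector bundle and of its jets *)

Arguments section_at : simpl never.
Arguments Cinf_fun : simpl never.
Arguments vector_field_at : simpl never.
Arguments tangent_fun : simpl never.
Arguments gauge_fun : simpl never.
Arguments jet_section_at : simpl never.

Section Bundles.
Variables (R : realType) (n : nat) (M : manifold R n) (r : nat) (A : vbundle M r).
Implicit Types (c : chart R M n) (t : trivialization r A) (U : set M) (u v : sections A)
  (f : Cinf M) (m : M).

Lemma sections_glue (s : dfun A) :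
  (forall m, exists U u, [/\ open U, U m & forall x, U x -> s x = u x]) ->
  section_space A s.
Proof.
move=> H t tt j c Ac; apply: smooth_in_local => x cx tx.
have [U [u [oU Ux su]]] := H x.
exists (tdom t `&` U), (tcoord t j (section_dfun u)); split=> //.
- by apply: openI => //; exact: tdom_open.
- by move=> y _ [_ Uy]; rewrite /tcoord su.
- by apply: smooth_in_sub (sub_valP u t tt j c Ac) => y [].
Qed.

Lemma jet_sections_glue (mu : dfun (jet A)) :
  (forall m, exists U (nu : jet_sections A), [/\ open U, U m & forall x, U x -> mu x = nu x]) ->
  jet_section_space A mu.
Proof.
move=> H c t Ac tt j; split=> [|i]; apply: smooth_in_local => x cx tx;
  have [U [nu [oU Ux munu]]] := H x; have [S1 S2] := sub_valP nu c t Ac tt j.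
- exists (tdom t `&` U), (fun m => tcoord t j (section_dfun (jet_rep (nu m))) m); split=> //.
  + by apply: openI => //; exact: tdom_open.
  + by move=> y _ [_ Uy]; rewrite munu.
  + by apply: smooth_in_sub S1 => y [].
- exists (tdom t `&` U), (fun m => tderiv c t j i (jet_rep (nu m)) m); split=> //.
  + by apply: openI => //; exact: tdom_open.
  + by move=> y _ [_ Uy]; rewrite munu.
  + by apply: smooth_in_sub (S2 i) => y [].
Qed.

Lemma tcoord_inj t m (x y : A m) : tdom t m ->
  (forall j, tmap t m x 0 j = tmap t m y 0 j) -> x = y.
Proof.
by move=> /tmap_bij/bij_inj inj xy; apply: inj; apply/rowP.
Qed.

Definition triv_inv t m (y : 'rV[R]_r) : A m := xget 0 [set x | tmap t m x = y].

Lemma triv_invK t m y : tdom t m -> tmap t m (triv_inv t m y) = y.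
Proof.
move=> /tmap_bij [g _ gK]; rewrite /triv_inv.
by case: xgetP => [x _ //|/(_ (g y)) h]; case: h; exact: gK.
Qed.

Lemma section_linE (a : R) u v m : (a *: u + v : sections A) m = a *: u m + v m.
Proof. by []. Qed.

Lemma sectionD u v m : (u + v : sections A) m = u m + v m. Proof. by []. Qed.
Lemma sectionB u v m : (u - v : sections A) m = u m - v m. Proof. by []. Qed.
Lemma sectionN u m : (- u : sections A) m = - u m. Proof. by []. Qed.
Lemma sectionZ (a : R) u m : (a *: u : sections A) m = a *: u m. Proof. by []. Qed.
Lemma section_sum (I : Type) (s : seq I) (P : pred I) (F : I -> sections A) m :
  (\sum_(i <- s | P i) F i : sections A) m = \sum_(i <- s | P i) F i m.
Proof. by elim/big_rec2: _ => [//|i a b _ <-]. Qed.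
Lemma fscaleE f u m : fscale f u m = f m *: u m. Proof. by []. Qed.

Lemma bump_scale_section m0 U (b : bump_at m0 U) t (s : dfun A) : open U -> trivs t ->
  U `<=` tdom t -> (forall j, smooth_on U (tcoord t j s)) ->
  section_space A (fun m => b m *: s m).
Proof.
move=> oU tt Ut Ss t' tt' j c Ac; apply: smooth_in_local => x cx tx.
have [Kx|nKx] := EM (bump_supp b x); last first.
  exists (~` bump_supp b), (fun=> 0); split=> //; first exact/closed_openC/bump_closed.
    by move=> y _ nKy; rewrite /tcoord bump_eq0 // scale0r linear0 mxE.
  exact: smooth_in0.
have [g [Sg gE]] := trivs_compatible tt tt'.
have Ux := @bump_sub _ _ _ _ _ b _ Kx.
have oI : open (U `&` tdom t') by apply: openI => //; exact: tdom_open.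
exists (U `&` tdom t'), (fun m => b m * \sum_i tcoord t i s m * g m i j); split=> //.
  move=> y _ [Uy t'y]; rewrite /tcoord linearZ (gE y) // ?mxE //; last exact: Ut.
apply: smooth_in_mul => //; first by apply: smooth_in_sub (Cinf_smooth b Ac).
apply: smooth_in_sum => // i; apply: smooth_in_mul => //.
  by apply: smooth_in_sub (Ss i c Ac) => y [].
by apply: smooth_in_sub (Sg i j c Ac) => y [Uy t'y]; split=> //; exact: Ut.
Qed.

(** The value at [m] of a derivation of the sections: this covers both the values
    of elements of [gauge] and those of a multiderivation in its last argument. *)
Definition point_derivation m (d : sections A -> A m) (v : tangent m) : Prop :=
  linear d /\ forall f u, d (fscale f u) = f m *: d u + v f *: u m.

Definition gauge_symbol (d : gauge A) (X : vector_field M) : Prop :=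
  forall f u m, d (fscale f u) m = f m *: d u m + X m f *: u m.

Lemma gauge_linear (d : gauge A) : linear d.
Proof. by have [] := sub_valP d. Qed.

Lemma gauge_has_symbol (d : gauge A) : exists X, gauge_symbol d X.
Proof. by have [] := sub_valP d. Qed.

Lemma gauge_point d m : exists w, @point_derivation m (fun u => gauge_fun d u m) w.
Proof.
have [X dX] := gauge_has_symbol d; exists (X m); split=> [a u w|f u]; last exact: dX.
by rewrite gauge_linear.
Qed.

Section Frame.
Variables (m0 : M) (c : chart R M n) (t : trivialization r A).
Hypotheses (Ac : atlas c) (tt : trivs t) (cm0 : cdom c m0) (tm0 : tdom t m0).
Let U := cdom c `&` tdom t.
Variable b : bump_at m0 U.

Let oU : open U. Proof. by apply: openI; [exact: cdom_open|exact: tdom_open]. Qed.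
Let Uc : U `<=` cdom c. Proof. by move=> ? []. Qed.
Let Ut : U `<=` tdom t. Proof. by move=> ? []. Qed.
Let VU : bump_nbhd b `<=` U. Proof. exact: bump_nbhd_sub. Qed.
Let oV : open (bump_nbhd b). Proof. exact: bump_open. Qed.

Fact frame_coord_smooth u j : smooth_on U (tcoord t j (section_dfun u)).
Proof. by move=> c' Ac'; apply: smooth_in_sub (sub_valP u t tt j c' Ac'). Qed.
Definition frame_coord j u : Cinf M := bump_mul b oU (frame_coord_smooth u j).

Lemma frame_coordE j u m : frame_coord j u m = b m * tcoord t j (section_dfun u) m.
Proof. by []. Qed.

Fact frame_smooth (j : 'I_r) :
  section_space A (fun m => b m *: triv_inv t m (delta_mx 0 j)).
Proof.
apply: (bump_scale_section b oU tt Ut) => i c' Ac'.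
apply: smooth_in_ext (smooth_in_cst c' U (delta_mx 0 j 0 i : R)) => // x _ /Ut tx.
by rewrite /tcoord triv_invK.
Qed.
Definition frame_section (j : 'I_r) : sections A := sub_mk (frame_smooth j).

Lemma frame_sectionE i j m : tdom t m ->
  tcoord t i (section_dfun (frame_section j)) m = b m * (i == j)%:R.
Proof. by move=> tm; rewrite /tcoord /= linearZ mxE triv_invK // mxE eqxx. Qed.

(** The factor b^2, with one b for the coordinates and one for the frame, makes
    this an identity between global sections. *)
Lemma frame_decomposition u :
  fscale (Cinf_mul b b) u = \sum_j fscale (frame_coord j u) (frame_section j).
Proof.
apply: sections_ext => m; rewrite section_sum fscaleE Cinf_mulE.
have [Km|nKm] := EM (bump_supp b m); last first.
  rewrite bump_eq0 // mulr0 scale0r big1 // => j _.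
  by rewrite fscaleE frame_coordE bump_eq0 // mul0r scale0r.
have tm := Ut (bump_sub Km).
apply: (tcoord_inj tm) => i; rewrite linearZ linear_sum mxE summxE (bigD1 i) //= big1 => [|j ji].
  rewrite fscaleE linearZ mxE addr0.
  have := frame_sectionE i i tm; rewrite /tcoord /section_at => ->.
  by rewrite eqxx mulr1 frame_coordE /tcoord; ring.
rewrite fscaleE linearZ mxE; have := frame_sectionE i j tm; rewrite /tcoord /section_at => ->.
by rewrite eq_sym (negbTE ji) !mulr0.
Qed.

Fact frame_x_smooth i : smooth_on U (fun m => cmap c m 0 i - cmap c m0 0 i).
Proof.
move=> c' Ac'; apply: (smooth_in_change Ac) => //.
have := smooth_in_lin 1 oU (smooth_in_sub (@subsetT _ U) (smooth_in_coord c i)) (smooth_in_cst c U (- cmap c m0 0 i)).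
by apply: smooth_in_ext => // x _ _; rewrite mul1r.
Qed.
Definition frame_x i : Cinf M := bump_mul b oU (frame_x_smooth i).

Lemma frame_xE i m : frame_x i m = b m * (cmap c m 0 i - cmap c m0 0 i).
Proof. by []. Qed.

(** The coordinate vector field multiplied by the bump, extended by zero. *)
Definition frame_vf_fun i : dfun (@tangent R n M) := fun m =>
  match pselect (cdom c m) with
  | left cm => b m *: coord_tangent i Ac cm
  | right _ => 0
  end.

Lemma frame_vf_funE i m f : bump_supp b m ->
  (frame_vf_fun i m : tangent m) f = b m * dcoord c i f m.
Proof.
move=> Km; rewrite /frame_vf_fun; case: pselect => // ncm.
by case: ncm; exact: Uc (bump_sub Km).
Qed.

Lemma frame_vf_fun0 i m f : ~ bump_supp b m -> (frame_vf_fun i m : tangent m) f = 0.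
Proof.
move=> nKm; rewrite /frame_vf_fun; case: pselect => // cm.
by rewrite bump_eq0 // scale0r.
Qed.

Fact frame_vf_smooth i : vector_field_space M (frame_vf_fun i).
Proof.
move=> f; have S : smooth_on U (dcoord c i f).
  move=> c' Ac'; apply: (smooth_in_change Ac) => //.
  by apply: dcoord_smooth => //; apply: smooth_in_sub (Cinf_smooth f Ac).
suff -> : (fun m => (frame_vf_fun i m : tangent m) f) = (fun m => b m * dcoord c i f m).
  exact: (bump_mul_smooth b oU S).
apply/funext => m; have [Km|nKm] := EM (bump_supp b m); first exact: frame_vf_funE.
by rewrite frame_vf_fun0 // bump_eq0 // mul0r.
Qed.
Definition frame_vf i : vector_field M := sub_mk (frame_vf_smooth i).

Lemma frame_vfE i f : frame_vf i m0 f = dcoord c i f m0.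
Proof.
have Km : bump_supp b m0.
  by apply: contrapT => /(@bump_eq0 _ _ _ _ _ b); rewrite bump_center => /eqP; rewrite oner_eq0.
by rewrite [LHS]frame_vf_funE // bump_center mul1r.
Qed.

Lemma tderiv_dcoord i j u m : tderiv c t j i u m = dcoord c i (tcoord t j (section_dfun u)) m.
Proof. by []. Qed.

Lemma dcoord_frame_coord i j u m : bump_nbhd b m ->
  dcoord c i (frame_coord j u) m = tderiv c t j i u m.
Proof.
move=> Vm; apply: (@dcoord_local R n M c i _ _ (bump_nbhd b) m) => //; first exact: Uc (VU Vm).
by move=> x _ Vx; rewrite frame_coordE bump_eq1 // mul1r.
Qed.

Lemma frame_section_center i j : tmap t m0 (frame_section j m0) 0 i = (i == j)%:R.
Proof. by have := frame_sectionE i j tm0; rewrite /tcoord bump_center mul1r. Qed.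

Lemma sum_frame_center (a : 'I_r -> R) :
  \sum_j a j *: frame_section j m0 = 0 -> forall j, a j = 0.
Proof.
move=> E j; have := congr1 (fun x => tmap t m0 x 0 j) E.
rewrite linear_sum summxE linear0 mxE (bigD1 j) //= big1 => [|k kj].
  by rewrite linearZ mxE frame_section_center eqxx mulr1 addr0.
by rewrite linearZ mxE frame_section_center eq_sym (negbTE kj) mulr0.
Qed.

(** Apply d to the decomposition of b^2 u in the frame: both terms of each Leibniz
    rule vanish, the first because u(m0) = 0, the second because a tangent vector
    is a combination of partial derivatives. *)
Lemma point_derivation_null d w u : @point_derivation m0 d w ->
  (forall j, tcoord t j (section_dfun u) m0 = 0 /\ forall i, tderiv c t j i u m0 = 0) ->
  d u = 0.
Proof.
move=> [dl dM] nu.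
have um0 : u m0 = 0.
  by apply: (tcoord_inj tm0) => j; rewrite linear0 mxE; have [] := nu j.
have := congr1 d (frame_decomposition u).
rewrite dM Cinf_mulE bump_center um0 mul1r scale1r scaler0 addr0 => ->.
have [x [_ vx]] := tangent_coordinates Ac cm0.
have d0 : d 0 = 0 by have := dl (-1) 0 0; rewrite scaleN1r addNr scaleN1r addNr.
transitivity (\sum_j d (fscale (frame_coord j u) (frame_section j))).
  by elim/big_rec2: _ => [//|j a1 a2 _ <-]; have := dl 1 (fscale (frame_coord j u) (frame_section j)) a2; rewrite !scale1r.
rewrite big1 // => j _; rewrite dM frame_coordE; have [-> dn] := nu j.
rewrite mulr0 scale0r add0r vx big1 ?scale0r // => i _.
by rewrite dcoord_frame_coord ?dn ?mulr0 //; exact: bump_mem.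
Qed.

Lemma frame_coord_lin j (a : R) u v : frame_coord j (a *: u + v) = a *: frame_coord j u + frame_coord j v.
Proof.
by apply: Cinf_ext => m; rewrite Cinf_lin !frame_coordE tcoord_lin; ring.
Qed.

Lemma frame_coord_fscale j f u : frame_coord j (fscale f u) = Cinf_mul f (frame_coord j u).
Proof.
by apply: Cinf_ext => m; rewrite Cinf_mulE !frame_coordE /tcoord /= linearZ mxE; ring.
Qed.

Fact frame_endo_subproof j : gauge_space A (fun u => fscale (frame_coord j u) (frame_section j)).
Proof.
split=> [a u v|].
  by apply: sections_ext => m; rewrite section_linE !fscaleE frame_coord_lin Cinf_lin scalerDl scalerA.
exists 0 => f u m; rewrite !fscaleE frame_coord_fscale Cinf_mulE scalerA.
by rewrite [(0 : vector_field M) m f](_ : _ = 0) // scale0r addr0.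
Qed.
Definition frame_endo j : gauge A := sub_mk (frame_endo_subproof j).

Lemma vf_app_lin X (a : R) f g : vf_app X (a *: f + g) = a *: vf_app X f + vf_app X g.
Proof. by apply: Cinf_ext => x; exact: tangent_lin. Qed.

Lemma vf_app_mul X f g m : vf_app X (Cinf_mul f g) m = f m * vf_app X g m + g m * vf_app X f m.
Proof. exact: tangent_mul. Qed.

Definition vf_scale_fun f (X : vector_field M) : dfun (@tangent R n M) := fun m => f m *: X m.
Fact vf_scale_subproof f X : vector_field_space M (vf_scale_fun f X).
Proof. by move=> g; exact: (Cinf_smooth (Cinf_mul f (vf_app X g))). Qed.
Definition vf_scale f X : vector_field M := sub_mk (vf_scale_subproof f X).
Lemma vf_scaleE f X m g : vf_scale f X m g = f m * X m g. Proof. by []. Qed.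

(** Differentiation of the coordinates along the i-th coordinate vector field.
    The symbol is b^2 times that field, one b coming from the coordinates of u
    and one from the frame. *)
Fact frame_connection_subproof i : gauge_space A
  (fun u => \sum_j fscale (vf_app (frame_vf i) (frame_coord j u)) (frame_section j)).
Proof.
split=> [a u v|].
  rewrite scaler_sumr -big_split; apply: eq_bigr => j _; apply: sections_ext => m.
  by rewrite section_linE !fscaleE frame_coord_lin vf_app_lin Cinf_lin scalerDl scalerA.
exists (vf_scale (Cinf_mul b b) (frame_vf i)) => f u m.
have := congr1 (fun w : sections A => w m) (frame_decomposition u).
rewrite section_sum fscaleE => E.
rewrite vf_scaleE mulrC -scalerA E !section_sum !scaler_sumr -big_split.
apply: eq_bigr => j _; rewrite !fscaleE frame_coord_fscale vf_app_mul scalerDl !scalerA.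
by rewrite /=; congr (_ + (_ * _) *: _); exact: mulrC.
Qed.
Definition frame_connection i : gauge A := sub_mk (frame_connection_subproof i).

(** The derivations obtained from the frame read off the coordinates of u at the
    point and their partial derivatives. *)
Lemma gauge_null u : (forall d : gauge A, d u m0 = 0) ->
  forall j, tcoord t j (section_dfun u) m0 = 0 /\ forall i, tderiv c t j i u m0 = 0.
Proof.
move=> du j; split=> [|i].
  have : frame_endo j u m0 = 0 by exact: du.
  rewrite [LHS](fscaleE _ _ _) frame_coordE bump_center mul1r => /(congr1 (fun x => tmap t m0 x 0 j)).
  by rewrite linearZ linear0 !mxE frame_section_center eqxx mulr1.
have : frame_connection i u m0 = 0 by exact: du.
rewrite [LHS]section_sum => /sum_frame_center /(_ j).
rewrite /vf_app {1}/Cinf_fun /= [LHS]frame_vfE dcoord_frame_coord //; exact: bump_mem.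
Qed.

End Frame.

Lemma exists_frame m0 : exists c t, [/\ atlas c, trivs t, cdom c m0, tdom t m0 &
  inhabited (bump_at m0 (cdom c `&` tdom t))].
Proof.
have [c Ac cm] := atlas_cover m0; have [t tt tm] := trivs_cover A m0.
exists c, t; split=> //; apply: exists_bump_at => //.
by apply: openI; [exact: cdom_open|exact: tdom_open].
Qed.

Lemma null_jet_derivation m d w u : @point_derivation m d w -> null_jet_space A m u -> d u = 0.
Proof.
move=> dd nu; have [c [t [Ac tt cm tm [b]]]] := exists_frame m.
by apply: (point_derivation_null Ac tt cm tm b dd) => j; exact: nu.
Qed.

(** Sections with vanishing 1-jet are recognised algebraically. This gives the
    independence of the chart and the trivialization, and the nondegeneracy of
    the pairing between jets and derivations. *)
Lemma null_jetP m u : null_jet_space A m u <-> forall d : gauge A, d u m = 0.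
Proof.
split=> [nu d|du c t Ac tt cm tm j].
  by have [v dv] := gauge_point d m; exact: null_jet_derivation dv nu.
have oU : open (cdom c `&` tdom t) by apply: openI; [exact: cdom_open|exact: tdom_open].
by have [b] := exists_bump_at oU (conj cm tm); exact: (gauge_null Ac tt tm b).
Qed.

(** Passing through derivations replaces a change of coordinates for first
    derivatives. *)
Lemma null_jet_local m c t u : atlas c -> trivs t -> cdom c m -> tdom t m ->
  (forall j, tcoord t j (section_dfun u) m = 0 /\ forall i, tderiv c t j i u m = 0) ->
  null_jet_space A m u.
Proof.
move=> Ac tt cm tm nu; apply/null_jetP => d; have [v dv] := gauge_point d m.
have oU : open (cdom c `&` tdom t) by apply: openI; [exact: cdom_open|exact: tdom_open].
by have [b] := exists_bump_at oU (conj cm tm); exact: (point_derivation_null Ac tt cm tm b dv).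
Qed.

Lemma jet_ofP m u v : jet_of m u = jet_of m v <-> forall d : gauge A, d u m = d v m.
Proof.
have B (d : gauge A) : d (u - v) m = d u m - d v m.
  have -> : u - v = (-1) *: v + u by rewrite scaleN1r addrC.
  by rewrite gauge_linear section_linE scaleN1r addrC.
split=> [/quot_piP/null_jetP uv d|uv].
  by apply/eqP; rewrite -subr_eq0 -B uv.
by apply/quot_piP/null_jetP => d; rewrite B uv subrr.
Qed.

Lemma section_through m (x : A m) : exists u : sections A, u m = x.
Proof.
have [c [t [Ac tt cm tm [b]]]] := exists_frame m.
exists (\sum_j tmap t m x 0 j *: frame_section tt b j).
apply: (tcoord_inj tm) => i; rewrite section_sum linear_sum summxE (bigD1 i) //= big1 => [|j ji].
  by rewrite sectionZ linearZ mxE frame_section_center // eqxx mulr1 addr0.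
by rewrite sectionZ linearZ mxE frame_section_center // eq_sym (negbTE ji) mulr0.
Qed.

Lemma jet_of_sum m (I : Type) (s : seq I) (P : pred I) (F : I -> sections A) :
  jet_of m (\sum_(i <- s | P i) F i) = \sum_(i <- s | P i) jet_of m (F i).
Proof. exact: linear_sum. Qed.

Lemma jet_ofZ m (a : R) u : jet_of m (a *: u) = a *: jet_of m u.
Proof. exact: linearZ. Qed.

Lemma jet_repK m (x : jet A m) : jet_of m (jet_rep x) = x.
Proof. exact: quot_piK. Qed.

(** The jets of the sections e_j and x_i e_j, for a local frame e and local
    coordinates x, span the jets near m0. The coefficients are the affine Taylor
    coefficients of the section, cut off by a bump function so as to be globally
    defined. *)
Lemma local_jet_frame m0 : exists (I : finType) (E : I -> sections A) (V : set M),
  [/\ open V, V m0 & forall mu : jet_sections A, exists a : I -> Cinf M,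
    forall m, V m -> mu m = \sum_b a b m *: jet_of m (E b)].
Proof.
have [c [t [Ac tt cm0 tm0 [b]]]] := exists_frame m0.
pose U := cdom c `&` tdom t.
have oU : open U by apply: openI; [exact: cdom_open|exact: tdom_open].
have Uc : U `<=` cdom c by move=> ? [].
have Ut : U `<=` tdom t by move=> ? [].
pose e j := frame_section tt b j; pose x i := frame_x Ac b i.
pose E (l : 'I_r + 'I_r * 'I_n) := match l with inl j => e j | inr (j, i) => fscale (x i) (e j) end.
exists ('I_r + 'I_r * 'I_n)%type, E, (bump_nbhd b); split; [exact: bump_open|exact: bump_mem|].
move=> mu.
have S1 j : smooth_on U (fun m => tcoord t j (section_dfun (jet_rep (mu m))) m).
  move=> c' Ac'; apply: (smooth_in_change Ac) => //.
  by have [S _] := sub_valP mu c t Ac tt j; apply: smooth_in_sub S.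
have S2 j i : smooth_on U (fun m => tderiv c t j i (jet_rep (mu m)) m).
  move=> c' Ac'; apply: (smooth_in_change Ac) => //.
  by have [_ S] := sub_valP mu c t Ac tt j; apply: smooth_in_sub (S i).
pose q j i : Cinf M := bump_mul b oU (S2 j i).
pose p j : Cinf M := (-1) *: (\sum_i Cinf_mul (q j i) (x i)) + bump_mul b oU (S1 j).
pose a (l : 'I_r + 'I_r * 'I_n) := match l with inl j => p j | inr (j, i) => q j i end.
exists a => m Vm.
have [cm tm] : U m by exact: bump_nbhd_sub Vm.
have oV : open (bump_nbhd b) by exact: bump_open.
have bm : b m = 1 by exact: bump_eq1.
rewrite -[mu m]jet_repK.
set w := jet_rep (mu m).
pose z : sections A := \sum_l a l m *: E l.
have -> : \sum_l a l m *: jet_of m (E l) = jet_of m z.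
  by rewrite jet_of_sum; apply: eq_bigr => l _; rewrite jet_ofZ.
apply/quot_piP; apply: (null_jet_local Ac tt cm tm) => j.
have qm i : q j i m = tderiv c t j i w m by rewrite {1}/Cinf_fun /= bm mul1r.
have pm : p j m = tcoord t j (section_dfun w) m - \sum_i q j i m * x i m.
  rewrite Cinf_lin mulN1r addrC; congr (_ - _); first by rewrite /Cinf_fun /= bm mul1r.
  by elim/big_rec2: _ => [//|i a1 a2 _ <-].
(* The coefficients are frozen at m, so that near m the coordinates of the
   section z are affine functions of the coordinates of the chart. *)
have zj y : cdom c y -> bump_nbhd b y -> tcoord t j (section_dfun z) y =
   p j m + \sum_i q j i m * (cmap c y 0 i - cmap c m0 0 i).
  move=> cy Vy; have [_ ty] : U y by exact: bump_nbhd_sub Vy.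
  have by1 : b y = 1 by exact: bump_eq1.
  have eE l : tmap t y (e l y) 0 j = (j == l)%:R.
    by have := frame_sectionE tt b j l ty; rewrite /tcoord by1 mul1r.
  rewrite /tcoord -[section_dfun z y]/(z y) section_sum linear_sum summxE big_sumType /=.
  congr (_ + _).
    rewrite (bigD1 j) //= sectionZ linearZ mxE eE eqxx mulr1 big1 ?addr0 // => l lj.
    by rewrite sectionZ linearZ mxE eE eq_sym (negbTE lj) mulr0.
  have T p' : tmap t y ((a (inr p') m *: E (inr p') : sections A) y) 0 j =
      q p'.1 p'.2 m * ((j == p'.1)%:R * x p'.2 y).
    case: p' => l i; transitivity (q l i m * tmap t y (x i y *: e l y) 0 j).
      by rewrite sectionZ linearZ mxE.
    by rewrite linearZ mxE eE [X in _ * X]mulrC.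
  rewrite (eq_bigr _ (fun p' _ => T p')).
  rewrite -(pair_bigA _ (fun l i => q l i m * ((j == l)%:R * x i y))) /=.
  rewrite (bigD1 j) //= [X in _ + X]big1 ?addr0 => [|l lj]; last first.
    by rewrite big1 // => i _; rewrite eq_sym (negbTE lj) mul0r mulr0.
  by apply: eq_bigr => i _; rewrite eqxx mul1r frame_xE by1 mul1r.
have -> : w - z = (-1) *: z + w by rewrite scaleN1r addrC.
split=> [|i].
  have S : \sum_i q j i m * (cmap c m 0 i - cmap c m0 0 i) = \sum_i q j i m * x i m.
    by apply: eq_bigr => i _; rewrite frame_xE bm mul1r.
  by rewrite tcoord_lin zj // S pm subrK mulN1r addNr.
rewrite tderiv_lin // mulN1r -qm tderiv_dcoord.
suff -> : dcoord c i (tcoord t j (section_dfun z)) m = q j i m by rewrite addNr.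
rewrite (@dcoord_local R n M c i _ (fun y => p j m + \sum_l q j l m * (cmap c y 0 l - cmap c m0 0 l)) (bump_nbhd b) m) //.
exact: dcoord_affine.
Qed.
End Bundles.

(** * Forms seen one argument at a time *)

Local Notation contract := Defs.contract.

Section Slots.
Variable T : Type.

Definition set_slot k (x : 'I_k -> T) (p : 'I_k) (y : T) : 'I_k -> T :=
  fun i => if i == p then y else x i.

Lemma set_slot_eta k (x : 'I_k -> T) p y : [eta x with p |-> y] = set_slot x p y :> ('I_k -> T).
Proof. by []. Qed.

Lemma set_slot_eq k (x : 'I_k -> T) p y : set_slot x p y p = y.
Proof. by rewrite /set_slot eqxx. Qed.

Lemma set_slot_neq k (x : 'I_k -> T) p y i : i != p -> set_slot x p y i = x i.
Proof. by rewrite /set_slot => /negbTE ->. Qed.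

Lemma set_slot_id k (x : 'I_k -> T) p : set_slot x p (x p) = x.
Proof. by apply/funext => i; rewrite /set_slot; case: eqP => [->|]. Qed.

Lemma set_slot_lift_same k (x : 'I_k.+1 -> T) p y : set_slot x p y \o lift p = x \o lift p.
Proof. by apply/funext => i /=; rewrite set_slot_neq // eq_sym neq_lift. Qed.

Lemma set_slot_lift k (x : 'I_k.+1 -> T) i q y :
  set_slot x (lift i q) y \o lift i = set_slot (x \o lift i) q y.
Proof. by apply/funext => l; rewrite /set_slot /= (inj_eq (@lift_inj _ i)). Qed.

Lemma contract_index k (i j : 'I_k.+1) (l : 'I_k) : (i < j)%N -> l != 0%N :> nat ->
  (bump j (bump i l.-1) < k.+1)%N.
Proof. by rewrite /bump; case: l i j => l lk [i ik] [j jk] /=; lia. Qed.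

Lemma contract_index_val k (i j : 'I_k.+1) (l : 'I_k) : (i < j)%N -> l != 0%N :> nat ->
  (inord (bump j (bump i l.-1)) : 'I_k.+1) = bump j (bump i l.-1) :> nat.
Proof. by move=> ij l0; rewrite inordK // contract_index. Qed.

Lemma contract_set_slot_removed k (x : 'I_k.+1 -> T) (i j p : 'I_k.+1) y b : (i < j)%N ->
  (p == i) || (p == j) -> contract i j b (set_slot x p y) = contract i j b x.
Proof.
move=> ij pij; apply/funext => l; rewrite /Defs.contract; case: ifPn => // l0.
rewrite set_slot_neq // -val_eqE /= contract_index_val //.
by move: pij; rewrite -!val_eqE /= /bump => /orP[] /eqP ->; lia.
Qed.

Lemma contract_set_slot_head k (x : 'I_k.+1 -> T) (i j : 'I_k.+1) : (i < j)%N ->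
  exists (x' : 'I_k -> T) (q : 'I_k), forall y, contract i j y x = set_slot x' q y.
Proof.
case: k x i j => [x i j|k x i j ij]; first by rewrite (ord1 i) (ord1 j).
exists (contract i j (x i) x), ord0 => y; apply/funext => l.
by rewrite /Defs.contract /set_slot -val_eqE /=; case: eqP.
Qed.

Lemma contract_set_slot_kept k (i j p : 'I_k.+1) : (i < j)%N -> p != i -> p != j ->
  exists q : 'I_k, forall (x : 'I_k.+1 -> T) b y,
    contract i j b (set_slot x p y) = set_slot (contract i j b x) q y.
Proof.
case: k i j p => [i j|k i j p ij pi pj]; first by rewrite (ord1 i) (ord1 j).
have qlt : ((unbump i (unbump j p)).+1 < k.+1)%N.
  by move: i j p ij pi pj => [i ik] [j jk] [p pk]; rewrite -!val_eqE /= /unbump; lia.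
exists (Ordinal qlt) => x b y; apply/funext => l; rewrite /Defs.contract /set_slot -!val_eqE /=.
case: eqP => [l0|/eqP l0]; first by case: eqP => //; lia.
rewrite contract_index_val // (_ : (bump j (bump i l.-1) == p) = (l == (unbump i (unbump j p)).+1 :> nat)) //.
move: i j p l ij pi pj l0 {qlt x b y} => [i ik] [j jk] [p pk] [l lk]; rewrite -!val_eqE /= /unbump /bump.
by lia.
Qed.

End Slots.

Lemma bump_swap i p t : (i < p)%N -> bump p (bump i t) = bump i (bump p.-1 t).
Proof. by rewrite /bump; lia. Qed.

Section Slotwise.
Variables (R : comPzRingType) (V W : lmodType R).

Lemma multilinear_slot k (c : ('I_k -> V) -> W) : multilinear c ->
  forall i x a y z, c (set_slot x i (a *: y + z)) = a *: c (set_slot x i y) + c (set_slot x i z).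
Proof. by move=> cl i x a y z; rewrite -!set_slot_eta cl. Qed.

(** The cyclic permutation that moves position [q] to the front has sign (-1)^q. *)
Lemma skew_front k (c : ('I_k.+1 -> V) -> W) (x : 'I_k.+1 -> V) (q : 'I_k.+1) : skew_symmetric c ->
  c (fun l => if unlift ord0 l is Some l' then x (lift q l') else x q) = (-1) ^+ q *: c x.
Proof.
move=> cs; pose s := lift_perm ord0 q (1%g : 'S_k).
have E : x \o s = (fun l => if unlift ord0 l is Some l' then x (lift q l') else x q).
  apply/funext => l /=; case: unliftP => [l' ->|->]; rewrite /s.
    by rewrite lift_perm_lift perm1.
  by rewrite lift_perm_id.
by rewrite -E cs /s odd_lift_perm odd_perm1 addbF /= signr_odd.
Qed.

(** The two ways in which an argument y can appear when the i-th one is consumed: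
    as a value of the bracket, placed in front, or in its own position. *)
Lemma contract_skew_lt k (c : ('I_k -> V) -> W) (x : 'I_k.+1 -> V) (i p : 'I_k.+1) q y :
  skew_symmetric c -> p = lift i q -> (i < p)%N ->
  (-1) ^+ (i + p) *: c (contract i p y x) = - (-1) ^+ i *: c (set_slot (x \o lift i) q y).
Proof.
case: k c x i p q => [c x i p []//|k c x i p q cs E ip].
have qp : q = p.-1 :> nat by have := congr1 val E; move: ip; rewrite /= /bump; lia.
have -> : contract i p y x = (fun l => if unlift ord0 l is Some l' then
    (set_slot (x \o lift i) q y) (lift q l') else set_slot (x \o lift i) q y q).
  apply/funext => l; rewrite /Defs.contract; case: unliftP => [l' ->|->] /=; last by rewrite set_slot_eq.
  rewrite set_slot_neq ?(eq_sym _ q) ?neq_lift //=; congr (x _); apply: val_inj => /=.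
  have lt1 : (bump p (bump i (0 + l')) < k.+2)%N.
    by have := ltn_ord l'; have := ltn_ord p; move: ip; rewrite /bump; lia.
  by rewrite (inordK lt1) !qp bump_swap.
rewrite skew_front // scalerA; congr (_ *: _).
have -> : (i + p = (i + q).+1)%N by rewrite qp; move: ip; lia.
by rewrite exprS exprD mulN1r mulNr -mulrA -expr2 sqrr_sign mulr1.
Qed.

Lemma contract_skew_gt k (c : ('I_k -> V) -> W) (x : 'I_k.+1 -> V) (i p : 'I_k.+1) q y :
  skew_symmetric c -> p = lift i q -> (p < i)%N ->
  (-1) ^+ (p + i) *: c (contract p i y x) = (-1) ^+ i *: c (set_slot (x \o lift i) q y).
Proof.
case: k c x i p q => [c x i p []//|k c x i p q cs E ip].
have qp : q = p :> nat by have := congr1 val E; move: ip; rewrite /= /bump; lia.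
have -> : contract p i y x = (fun l => if unlift ord0 l is Some l' then
    (set_slot (x \o lift i) q y) (lift q l') else set_slot (x \o lift i) q y q).
  apply/funext => l; rewrite /Defs.contract; case: unliftP => [l' ->|->] /=; last by rewrite set_slot_eq.
  rewrite set_slot_neq ?(eq_sym _ q) ?neq_lift //=; congr (x _); apply: val_inj => /=.
  have lt1 : (bump i (bump p (0 + l')) < k.+2)%N.
    by have := ltn_ord l'; have := ltn_ord i; move: ip; rewrite /bump; lia.
  by rewrite (inordK lt1) qp.
rewrite skew_front // scalerA; congr (_ *: _).
by rewrite qp exprD mulrAC -expr2 sqrr_sign mul1r.
Qed.

End Slotwise.

(** * Tensoriality of the Chevalley-Eilenberg differential *)

Section CEtensorial.
Variables (R : comPzRingType) (V W : lmodType R).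
Variables (br : V -> V -> V) (act : V -> W -> W).
Variables (Fv : V -> V) (Fw : W -> W) (rv : V -> V -> V) (rw : V -> W -> W).
(* [Fv] and [Fw] stand for the multiplication by a function f, and [rv x], [rw x]
   for the multiplication by the derivative of f along the anchor of x. *)
Hypotheses
  (brR : forall x y z, br x (Fv y + z) = Fv (br x y) + rv x y + br x z)
  (brL : forall x y z, br (Fv y + z) x = Fv (br y x) - rv x y + br z x)
  (actL : forall y z w, act (Fv y + z) w = Fw (act y w) + act z w)
  (actR : forall x w w', act x (Fw w + w') = Fw (act x w) + rw x w + act x w')
  (Fw_lin : linear Fw) (rw_lin : forall x, linear (rw x)).
Variables (k : nat) (c : ('I_k -> V) -> W).
Hypotheses (c_lin : multilinear c) (c_skew : skew_symmetric c)
  (cF : forall i x y z, c (set_slot x i (Fv y + z)) = Fw (c (set_slot x i y)) + c (set_slot x i z))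
  (cr : forall i x v y z, c (set_slot x i (rv v y + z)) = rw v (c (set_slot x i y)) + c (set_slot x i z)).

Let Fw0 : Fw 0 = 0. Proof. by have := Fw_lin (-1) 0 0; rewrite scaleN1r addNr scaleN1r addNr. Qed.
Let FwD w w' : Fw (w + w') = Fw w + Fw w'.
Proof. by have := Fw_lin 1 w w'; rewrite !scale1r. Qed.
Let FwZ a w : Fw (a *: w) = a *: Fw w.
Proof. by have := Fw_lin a w 0; rewrite !addr0 Fw0 addr0. Qed.
Let Fw_sum (I : finType) (P : pred I) (G : I -> W) : Fw (\sum_(i | P i) G i) = \sum_(i | P i) Fw (G i).
Proof. by elim/big_rec2: _ => [//|i a b _ <-]; rewrite FwD. Qed.

Variables (x : 'I_k.+1 -> V) (p : 'I_k.+1) (y z : V).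

(* The term in which x_i differentiates the function multiplying the p-th
   argument. *)
Let symbol_term (i : 'I_k.+1) : W := if unlift i p is Some q then
  (-1) ^+ i *: rw (x i) (c (set_slot (x \o lift i) q y)) else 0.

Let act_term (t : V) (i : 'I_k.+1) : W :=
  (-1) ^+ i *: act (set_slot x p t i) (c (fun l => set_slot x p t (lift i l))).

Let br_term (t : V) (i j : 'I_k.+1) : W :=
  (-1) ^+ (i + j) *: c (contract i j (br (set_slot x p t i) (set_slot x p t j)) (set_slot x p t)).

Lemma act_term_slot i : act_term (Fv y + z) i = Fw (act_term y i) + act_term z i + symbol_term i.
Proof.
rewrite /act_term /symbol_term -!/(set_slot x p _ \o lift i) FwZ -scalerDr.
case: unliftP => [q E|->].
  have ip : i != p by rewrite E neq_lift.
  have H t : set_slot x p t \o lift i = set_slot (x \o lift i) q t by rewrite E set_slot_lift.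
  by rewrite !H !(set_slot_neq _ _ ip) cF actR -scalerDr addrAC.
by rewrite !set_slot_lift_same !set_slot_eq actL addr0.
Qed.

Let rwZ v a w : rw v (a *: w) = a *: rw v w.
Proof.
have r0 : rw v 0 = 0 by have := rw_lin v (-1) 0 0; rewrite scaleN1r addNr scaleN1r addNr.
by have := rw_lin v a w 0; rewrite !addr0 r0 addr0.
Qed.

(** The derivative of f produced by the bracket of x_i with f y cancels the one
    produced by the action of x_i. *)
Lemma symbol_term_lt (i : 'I_k.+1) : (i < p)%N ->
  (-1) ^+ (i + p) *: rw (x i) (c (contract i p y x)) = - symbol_term i.
Proof.
move=> ip; rewrite /symbol_term; case: unliftP => [q E|E]; last by rewrite E ltnn in ip.
by rewrite -rwZ (contract_skew_lt x y c_skew E ip) !rwZ scaleNr.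
Qed.

Lemma symbol_term_gt (j : 'I_k.+1) : (p < j)%N ->
  (-1) ^+ (p + j) *: rw (x j) (c (contract p j y x)) = symbol_term j.
Proof.
move=> pj; rewrite /symbol_term; case: unliftP => [q E|E]; last by rewrite E ltnn in pj.
by rewrite -!rwZ (contract_skew_gt x y c_skew E pj).
Qed.

Lemma br_term_slot (i j : 'I_k.+1) : (i < j)%N -> br_term (Fv y + z) i j =
  Fw (br_term y i j) + br_term z i j - (if j == p then symbol_term i else if i == p then symbol_term j else 0).
Proof.
move=> ij; rewrite /br_term FwZ -scalerDr.
have ij' : i != j by rewrite neq_ltn ij.
have ji' : j != i by rewrite eq_sym.
case: eqP => [jp|/eqP jp].
  have ip : i != p by rewrite -jp.
  have ipn : (i < p)%N by rewrite -jp.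
  rewrite {}jp !set_slot_eq !(set_slot_neq _ _ ip).
  have cc b t : contract i p b (set_slot x p t) = contract i p b x.
    by apply: contract_set_slot_removed; rewrite ?eqxx ?orbT.
  rewrite !cc -(symbol_term_lt ipn) brR.
  have [x' [q H]] := contract_set_slot_head x ipn.
  by rewrite !H -addrA cF cr -scalerDr [rw _ _ + _]addrC addrA.
case: eqP => [ip|/eqP ip].
  have jpn : (p < j)%N by rewrite -ip.
  rewrite {}ip !set_slot_eq !(set_slot_neq _ _ jp).
  have cc b t : contract p j b (set_slot x p t) = contract p j b x.
    by apply: contract_set_slot_removed; rewrite ?eqxx.
  rewrite !cc -(symbol_term_gt jpn) brL.
  have [x' [q H]] := contract_set_slot_head x jpn.
  have -> : Fv (br y (x j)) - rv (x j) y + br z (x j) =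
    Fv (br y (x j)) + ((-1) *: (rv (x j) y + 0) + br z (x j)) by rewrite scaleN1r addr0 addrA.
  rewrite !H cF multilinear_slot // cr.
  have c0 : c (set_slot x' q 0) = 0.
    by have := multilinear_slot c_lin q x' (-1) 0 0; rewrite scaleN1r addNr scaleN1r addNr.
  by rewrite c0 addr0 scaleN1r -scalerBr [- _ + _]addrC addrA.
have pi : p != i by rewrite eq_sym.
have pj : p != j by rewrite eq_sym.
have [q H] := contract_set_slot_kept V ij pi pj.
have ei t : set_slot x p t i = x i by rewrite set_slot_neq.
have ej t : set_slot x p t j = x j by rewrite set_slot_neq.
by rewrite !ei !ej !H cF subr0.
Qed.

Lemma sum_pairs_through :
  \sum_(i < k.+1) \sum_(j < k.+1 | (i < j)%N) (if j == p then symbol_term i else if i == p then symbol_term j else 0) =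
  \sum_i symbol_term i.
Proof.
have gp : symbol_term p = 0 by rewrite /symbol_term unlift_none.
transitivity (\sum_(i < k.+1 | (i < p)%N) symbol_term i + \sum_(j < k.+1 | (p < j)%N) symbol_term j).
  rewrite (bigD1 p) //= addrC; congr (_ + _); last first.
    by apply: eq_bigr => j pj; rewrite eqxx; case: eqP => [->|].
  rewrite [RHS]big_mkcond [RHS](bigD1 p) //= ltnn add0r; apply: eq_bigr => i ip.
  rewrite big_mkcond (bigD1 p) //= eqxx big1 ?addr0 // => j jp.
  by rewrite (negbTE jp) (negbTE ip); case: ifP.
rewrite [RHS](bigID (fun i : 'I_k.+1 => (i < p)%N)) /=; congr (_ + _).
rewrite [RHS]big_mkcond [LHS]big_mkcond; apply: eq_bigr => j _.
by case: ltngtP => // E; have -> : j = p by apply: val_inj; rewrite /= E.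
Qed.

(** Each pair formed by [p] and another index i contributes the derivative of f
    along x_i twice, once through the action of x_i and once through a bracket,
    with opposite signs. *)
Lemma chevalley_eilenberg_slot :
  chevalley_eilenberg br act c (set_slot x p (Fv y + z)) =
  Fw (chevalley_eilenberg br act c (set_slot x p y)) + chevalley_eilenberg br act c (set_slot x p z).
Proof.
have E t : chevalley_eilenberg br act c (set_slot x p t) =
  \sum_(i < k.+1) act_term t i + \sum_(i < k.+1) \sum_(j < k.+1 | (i < j)%N) br_term t i j by [].
rewrite !E FwD !Fw_sum (eq_bigr _ (fun i _ => act_term_slot i)) !big_split /=.
have -> : \sum_(i < k.+1) \sum_(j < k.+1 | (i < j)%N) br_term (Fv y + z) i j =
  \sum_(i < k.+1) Fw (\sum_(j < k.+1 | (i < j)%N) br_term y i j) +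
  \sum_(i < k.+1) \sum_(j < k.+1 | (i < j)%N) br_term z i j - \sum_i symbol_term i.
  rewrite -sum_pairs_through -big_split -sumrB; apply: eq_bigr => i _ /=.
  rewrite Fw_sum -big_split -sumrB; apply: eq_bigr => j ij /=; exact: br_term_slot.
set a1 := \sum_i Fw _; set a2 := \sum_i act_term _ _; set a3 := \sum_i symbol_term i.
set b1 := \sum_i Fw _; set b2 := \sum_i \sum_(_ | _) _.
by rewrite [b1 + b2 - a3]addrC addrA addrK addrACA.
Qed.

End CEtensorial.

(** * Derivations of the sections and their pairing with jets *)

Section GaugeAlgebra.
Variables (R : realType) (n : nat) (M : manifold R n) (r : nat) (A : vbundle M r).
Implicit Types (U : set M) (u v : sections A) (f g : Cinf M) (m : M) (d e : gauge A)
  (mu nu : jet_sections A).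

Lemma gaugeD d u v : d (u + v) = d u + d v.
Proof. by have := gauge_linear d 1 u v; rewrite !scale1r. Qed.
Lemma gauge0 d : d 0 = 0.
Proof. by have := gauge_linear d (-1) 0 0; rewrite scaleN1r addNr scaleN1r addNr. Qed.
Lemma gaugeZ d (a : R) u : d (a *: u) = a *: d u.
Proof. by have := gauge_linear d a u 0; rewrite !addr0 gauge0 addr0. Qed.
Lemma gauge_sum d (I : Type) (s : seq I) (P : pred I) (F : I -> sections A) :
  d (\sum_(i <- s | P i) F i) = \sum_(i <- s | P i) d (F i).
Proof. exact: (big_morph (gauge_fun d) (gaugeD d) (gauge0 d)). Qed.

Lemma gauge_ext d e : (forall u m, d u m = e u m) -> d = e.
Proof. by move=> de; apply: val_inj; apply/funext => u; apply: sections_ext => m; exact: de. Qed.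

Lemma gaugeDE d e u : (d + e : gauge A) u = d u + e u. Proof. by []. Qed.
Lemma gaugeNE d u : (- d : gauge A) u = - d u. Proof. by []. Qed.

Definition symbol_of d : vector_field M := xget 0 [set X | gauge_symbol d X].

Lemma symbol_ofP d : gauge_symbol d (symbol_of d).
Proof.
have [X dX] := gauge_has_symbol d; rewrite /symbol_of.
by case: xgetP => [Y //|/(_ X)].
Qed.

Lemma gauge_fscale d f u m : d (fscale f u) m = f m *: d u m + symbol_of d m f *: u m.
Proof. exact: symbol_ofP. Qed.

Lemma gauge_fscaleE d f u : d (fscale f u) = fscale f (d u) + fscale (vf_app (symbol_of d) f) u.
Proof. by apply: sections_ext => m; rewrite gauge_fscale. Qed.

(** Derivations are local operators: multiply u - v by a bump function. *)
Lemma gauge_local d U u v m : open U -> U m -> (forall x, U x -> u x = v x) -> d u m = d v m.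
Proof.
move=> oU Um uv; have [b] := exists_bump_at oU Um.
have E : fscale b u = fscale b v.
  apply: sections_ext => x; rewrite !fscaleE.
  have [Kx|nKx] := EM (bump_supp b x); first by rewrite uv //; exact: bump_sub Kx.
  by rewrite bump_eq0 // !scale0r.
have := congr1 (fun w => d w m) E; rewrite !gauge_fscale bump_center !scale1r uv //.
exact: addIr.
Qed.

Lemma gauge_jet d m u : d (jet_rep (jet_of m u)) m = d u m.
Proof. by apply: (jet_ofP m _ _).1; rewrite jet_repK. Qed.

Lemma jet_nondegenerate m (x y : jet A m) :
  (forall d, d (jet_rep x) m = d (jet_rep y) m) -> x = y.
Proof. by move=> H; rewrite -[x]jet_repK -[y]jet_repK; apply/jet_ofP. Qed.

Lemma jet_as_section m (a : R) (x y : jet A m) :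
  a *: x + y = jet_of m (a *: jet_rep x + jet_rep y).
Proof. by rewrite jet_of_lin !jet_repK. Qed.

Lemma gauge_jet_lin d m (a : R) (x y : jet A m) :
  d (jet_rep (a *: x + y)) m = a *: d (jet_rep x) m + d (jet_rep y) m.
Proof. by rewrite jet_as_section gauge_jet gaugeD gaugeZ. Qed.

Lemma gauge_jet_sum d m (I : finType) (a : I -> R) (E : I -> sections A) :
  d (jet_rep (\sum_b a b *: jet_of m (E b))) m = \sum_b a b *: d (E b) m.
Proof.
rewrite (_ : \sum_b a b *: jet_of m (E b) = jet_of m (\sum_b a b *: E b)); last first.
  by rewrite jet_of_sum; apply: eq_bigr => b _; rewrite jet_ofZ.
by rewrite gauge_jet gauge_sum section_sum; apply: eq_bigr => b _; rewrite gaugeZ.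
Qed.

Lemma jet_sections_ext mu nu : (forall m, mu m = nu m) -> mu = nu.
Proof. by move=> H; apply: val_inj; apply: functional_extensionality_dep => m; exact: H. Qed.

Lemma jet_sectionD mu nu m : (mu + nu : jet_sections A) m = mu m + nu m. Proof. by []. Qed.
Lemma jet_sectionN mu m : (- mu : jet_sections A) m = - mu m. Proof. by []. Qed.
Lemma prolongE u m : prolong u m = jet_of m u. Proof. by []. Qed.

Lemma jet_section_sum (I : Type) (s : seq I) (P : pred I) (F : I -> jet_sections A) m :
  (\sum_(i <- s | P i) F i : jet_sections A) m = \sum_(i <- s | P i) F i m.
Proof. by elim/big_rec2: _ => [//|i a b _ <-]. Qed.

(** A representative of f(m) mu(m) is f(m) times a representative of mu(m), for
    the constant f(m). *)
Fact jscale_smooth f mu : jet_section_space A (fun m => f m *: mu m).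
Proof.
move=> c t Ac tt j; have oW := tdom_open t.
have N m : null_jet_space A m (jet_rep (f m *: mu m) - f m *: jet_rep (mu m)).
  by apply/quot_piP; rewrite -[LHS]/(jet_of m _) jet_repK -[RHS]/(jet_of m _) jet_ofZ jet_repK.
have Sf : smooth_in c (tdom t) f by apply: smooth_in_sub (Cinf_smooth f Ac).
have [S1 S2] := sub_valP mu c t Ac tt j.
split=> [|i].
  apply: (smooth_in_ext oW _ (smooth_in_mul oW Sf S1)) => m cm tm.
  have [-> _] := null_jet_eq j (N m) Ac tt cm tm.
  by rewrite /tcoord /= linearZ mxE.
apply: (smooth_in_ext oW _ (smooth_in_mul oW Sf (S2 i))) => m cm tm.
have [_ ->] := null_jet_eq j (N m) Ac tt cm tm.
have := tderiv_lin j i (f m) (jet_rep (mu m)) 0 Ac tt cm tm.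
have -> : tderiv c t j i (0 : sections A) m = 0.
  by have := tderiv_lin j i (- 1) 0 0 Ac tt cm tm; rewrite mulN1r addNr scaler0 addr0.
by rewrite !addr0 => ->.
Qed.
Definition jscale f mu : jet_sections A := sub_mk (jscale_smooth f mu).
Lemma jscaleE f mu m : jscale f mu m = f m *: mu m. Proof. by []. Qed.

(** Near each point, expand mu in prolongations of sections: the pairing becomes
    a combination of sections. *)
Lemma pairing_smooth d mu : section_space A (fun m => d (jet_rep (mu m)) m).
Proof.
apply: sections_glue => m0; have [I [E [V [oV Vm0 H]]]] := local_jet_frame A m0.
have [a aE] := H mu; exists V, (\sum_b fscale (a b) (d (E b))); split=> // m Vm.
by rewrite aE // gauge_jet_sum section_sum.
Qed.

Lemma section_ofE (s : forall m, A m) m : section_space A s -> section_of s m = s m.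
Proof.
move=> Ss; rewrite /section_of; case: xgetP => [u _ ->//|/(_ (sub_mk Ss)) []//].
Qed.

Lemma pairingE d mu m : pairing d mu m = d (jet_rep (mu m)) m.
Proof. exact: section_ofE (pairing_smooth d mu). Qed.

Lemma pairing_prolong d u : pairing d (prolong u) = d u.
Proof. by apply: sections_ext => m; rewrite pairingE prolongE gauge_jet. Qed.

Lemma pairing_jscale d f mu nu :
  pairing d (jscale f mu + nu) = fscale f (pairing d mu) + pairing d nu.
Proof.
apply: sections_ext => m; rewrite sectionD fscaleE !pairingE jet_sectionD jscaleE.
exact: gauge_jet_lin.
Qed.

Lemma pairing_nondegenerate mu nu : (forall d, pairing d mu = pairing d nu) -> mu = nu.
Proof.
move=> H; apply: jet_sections_ext => m; apply: jet_nondegenerate => d.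
by rewrite -!pairingE H.
Qed.

Lemma pairingD d mu nu : pairing d (mu + nu) = pairing d mu + pairing d nu.
Proof.
apply: sections_ext => m; rewrite sectionD !pairingE jet_sectionD.
by have := gauge_jet_lin d 1 (mu m) (nu m); rewrite !scale1r.
Qed.

Lemma pairingN d mu : pairing d (- mu) = - pairing d mu.
Proof.
apply/eqP; rewrite -subr_eq0 opprK -pairingD addNr; apply/eqP; apply: sections_ext => m.
rewrite pairingE; have := gauge_jet_lin d (-1) (0 : jet A m) 0.
by rewrite scaleN1r addNr scaleN1r addNr.
Qed.

Lemma pairingB d mu nu : pairing d (mu - nu) = pairing d mu - pairing d nu.
Proof. by rewrite pairingD pairingN. Qed.

Lemma pairing_gaugeD d e mu : pairing (d + e) mu = pairing d mu + pairing e mu.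
Proof. by apply: sections_ext => m; rewrite sectionD !pairingE gaugeDE sectionD. Qed.

Lemma pairing_gaugeN d mu : pairing (- d) mu = - pairing d mu.
Proof. by apply: sections_ext => m; rewrite sectionN !pairingE gaugeNE sectionN. Qed.

Fact gscale_subproof f d : gauge_space A (fun u => fscale f (d u)).
Proof.
split=> [a u v|].
  apply: sections_ext => m; rewrite section_linE !fscaleE gauge_linear section_linE.
  by rewrite scalerDr !scalerA mulrC.
exists (vf_scale f (symbol_of d)) => g u m.
by rewrite !fscaleE gauge_fscale vf_scaleE scalerDr !scalerA [f m * g m]mulrC.
Qed.
Definition gscale f d : gauge A := sub_mk (gscale_subproof f d).
Lemma gscaleE f d u : gscale f d u = fscale f (d u). Proof. by []. Qed.

Lemma pairing_gscale f d mu : pairing (gscale f d) mu = fscale f (pairing d mu).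
Proof. by apply: sections_ext => m; rewrite fscaleE !pairingE. Qed.

Lemma gauge_bracketE d e u : gauge_bracket d e u = d (e u) - e (d u). Proof. by []. Qed.

Lemma gauge_bracket_gscale d f e e' :
  gauge_bracket d (gscale f e + e') =
  gscale f (gauge_bracket d e) + gscale (vf_app (symbol_of d) f) e + gauge_bracket d e'.
Proof.
apply: gauge_ext => u m; rewrite !(gaugeDE, gscaleE, gauge_bracketE) gaugeD gauge_fscaleE.
rewrite !(sectionB, sectionD, fscaleE) scalerBr opprD addrACA; congr (_ + _).
by rewrite addrAC.
Qed.

Lemma gauge_bracket_skew d e : gauge_bracket d e = - gauge_bracket e d.
Proof. by apply: gauge_ext => u m; rewrite gaugeNE !gauge_bracketE opprB. Qed.

Definition is_lie_derivative_at d mu m (x : jet A m) : Prop :=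
  forall e, e (jet_rep x) m = section_at (d (pairing e mu) - pairing (gauge_bracket d e) mu) m.

(** On a combination of prolongations the Leibniz rule dictates the formula
    L_d (a du) = a d(d u) + X(a) du, where X is the symbol of d. *)
Lemma lie_derivative_local d mu m0 : exists U nu,
  [/\ open U, U m0 & forall m, U m -> is_lie_derivative_at d mu (nu m)].
Proof.
have [I [E [V [oV Vm0 H]]]] := local_jet_frame A m0; have [a aE] := H mu.
pose nu : jet_sections A := \sum_b (jscale (a b) (prolong (d (E b))) +
   jscale (vf_app (symbol_of d) (a b)) (prolong (E b))).
exists V, nu; split=> // m Vm e.
have -> : nu m = jet_of m (\sum_b (a b m *: d (E b) + symbol_of d m (a b) *: E b)).
  rewrite jet_section_sum jet_of_sum; apply: eq_bigr => b _.
  by rewrite jet_of_lin jet_ofZ.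
rewrite gauge_jet gauge_sum section_sum sectionB pairingE aE // gauge_jet_sum.
have -> : d (pairing e mu) m = d (\sum_b fscale (a b) (e (E b))) m.
  apply: (gauge_local _ oV Vm) => x Vx.
  by rewrite pairingE aE // gauge_jet_sum section_sum.
rewrite gauge_sum section_sum -sumrB; apply: eq_bigr => b _.
rewrite gaugeD !gaugeZ sectionD !sectionZ gauge_fscale gauge_bracketE sectionB scalerBr.
by rewrite opprB [X in _ = _ + X]addrC addrACA subrr add0r addrC.
Qed.

(** Nondegeneracy makes the value at each point unique, so that the local solutions
    agree on overlaps and glue. *)
Lemma lie_derivative_exists d mu : exists nu, forall e,
  pairing e nu = d (pairing e mu) - pairing (gauge_bracket d e) mu.
Proof.
pose x m : jet A m := xget 0 [set x | is_lie_derivative_at d mu x].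
have xP m : is_lie_derivative_at d mu (x m).
  have [U [nu [oU Um H]]] := lie_derivative_local d mu m.
  by rewrite /x; case: xgetP => [y _ //|/(_ (nu m))[]]; exact: H.
have Sx : jet_section_space A x.
  apply: jet_sections_glue => m; have [U [nu [oU Um H]]] := lie_derivative_local d mu m.
  exists U, nu; split=> // y Uy; apply: jet_nondegenerate => e.
  by rewrite xP H.
by exists (sub_mk Sx) => e; apply: sections_ext => m; rewrite pairingE [LHS]xP.
Qed.

Lemma lie_derivativeE d mu e :
  pairing e (lie_derivative d mu) = d (pairing e mu) - pairing (gauge_bracket d e) mu.
Proof.
have [nu H] := lie_derivative_exists d mu; rewrite /lie_derivative.
by case: xgetP => [y _ ->//|/(_ nu)[]].
Qed.

Lemma lie_derivative_prolong d u : lie_derivative d (prolong u) = prolong (d u).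
Proof.
apply: pairing_nondegenerate => e.
by rewrite lie_derivativeE !pairing_prolong gauge_bracketE opprB addrCA subrr addr0.
Qed.

Lemma null_jet_value m u : null_jet_space A m u -> u m = 0.
Proof.
move=> nu; have [c [t [Ac tt cm tm _]]] := exists_frame A m.
by apply: (tcoord_inj tm) => j; rewrite linear0 mxE; have [] := nu c t Ac tt cm tm j.
Qed.

Lemma jet_value_of m u : jet_value (jet_of m u) = u m.
Proof.
by apply/eqP; rewrite -subr_eq0; apply/eqP; exact: (null_jet_value (@jet_rep_of _ _ _ _ A m u)).
Qed.

Lemma jet_value_lin m (a : R) (x y : jet A m) :
  jet_value (a *: x + y) = a *: jet_value x + jet_value y.
Proof. by rewrite jet_as_section jet_value_of. Qed.

Lemma jet_value_smooth mu : section_space A (fun m => jet_value (mu m)).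
Proof.
apply: sections_glue => m0; have [I [E [V [oV Vm0 H]]]] := local_jet_frame A m0.
have [a aE] := H mu; exists V, (\sum_b fscale (a b) (E b)); split=> // m Vm.
rewrite aE // section_sum (_ : \sum_b a b m *: jet_of m (E b) = jet_of m (\sum_b a b m *: E b)).
  by rewrite jet_value_of section_sum.
by rewrite jet_of_sum; apply: eq_bigr => b _; rewrite jet_ofZ.
Qed.
Definition value_section mu : sections A := sub_mk (jet_value_smooth mu).

End GaugeAlgebra.

(** * The map pi and the bracket of jet sections *)

(** The identity to which the Leibniz rule of the bracket of jet sections reduces
    after pairing with a derivation and evaluating at a point; the two terms
    containing x cancel. *)
Lemma jscale_bracket_identity (R : comPzRingType) (V : lmodType R) (f j x : R)
    (a b c p q s t h e w z o : V) :
  f *: a + j *: b + c - (f *: p + q) - (f *: o + s - (f *: t - x *: - w + h))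
    - (f *: e + x *: w + z) =
  f *: (a - p - (o - t) - e) + (j *: b + (c - q - (s - h) - z)).
Proof.
rewrite !scalerBr scalerN !opprK !opprD !opprK !addrA.
by rewrite [LHS](ACl (1*4*6*8*11*2*3*5*7*10*13*(9*12))) /= subrr addr0.
Qed.

Section JetAlgebroid.
Variables (R : realType) (n : nat) (M : manifold R n) (r : nat) (A : vbundle M r)
  (L : lie_algebroid A).
Implicit Types (u v : sections A) (f g : Cinf M) (m : M) (d e : gauge A)
  (mu nu : jet_sections A).
Notation "[ u , v ]" := (bracket L u v).
Notation pi := (jet_to_gauge L).

Definition anchor_field u : vector_field M := sub_mk (anchor_smooth L u).

Lemma bracket_fscale u f v m : [u, fscale f v] m = f m *: [u, v] m + anchor_field u m f *: v m.
Proof. exact: bracket_leibniz. Qed.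

Fact adjoint_subproof u : gauge_space A (bracket L u).
Proof.
split; first exact: bracket_linear.
by exists (anchor_field u) => f v m; exact: bracket_fscale.
Qed.
Definition adjoint u : gauge A := sub_mk (adjoint_subproof u).
Lemma adjointE u v : adjoint u v = [u, v]. Proof. by []. Qed.

Lemma bracket_jet m u v : bracket L (jet_rep (jet_of m u)) v m = [u, v] m.
Proof. by rewrite ![bracket L _ v]bracket_skew !sectionN -!adjointE gauge_jet. Qed.

(** For each v, the map u |-> [u, v] is minus a derivation; hence it factors through
    jets and its value on mu is smooth. *)
Fact jet_to_gauge_subproof mu : gauge_space A (fun v => - pairing (adjoint v) mu).
Proof.
have E v m : (- pairing (adjoint v) mu : sections A) m = [jet_rep (mu m), v] m.
  by rewrite sectionN pairingE adjointE [in RHS]bracket_skew sectionN.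
split=> [a u v|].
  by apply: sections_ext => m; rewrite E section_linE !E bracket_linear.
exists (anchor_field (value_section mu)) => f u m.
by rewrite E bracket_fscale E.
Qed.

Lemma jet_to_gaugeE mu v m : pi mu v m = [jet_rep (mu m), v] m.
Proof.
rewrite /jet_to_gauge; case: xgetP => [d _ H|/(_ (sub_mk (jet_to_gauge_subproof mu)))[]].
  by apply: H; rewrite jet_repK.
move=> m' u E v'; rewrite [LHS]sectionN pairingE E gauge_jet.
by rewrite adjointE [in RHS]bracket_skew.
Qed.

Lemma jet_to_gauge_of mu m u : mu m = jet_of m u -> forall v, pi mu v m = [u, v] m.
Proof. by move=> E v; rewrite jet_to_gaugeE E bracket_jet. Qed.

Lemma jet_to_gauge_prolong u : pi (prolong u) = adjoint u.
Proof. by apply: gauge_ext => v m; rewrite (@jet_to_gauge_of _ m u). Qed.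

Lemma jet_to_gauge_jscale f mu nu : pi (jscale f mu + nu) = gscale f (pi mu) + pi nu.
Proof.
apply: gauge_ext => v m.
rewrite (@jet_to_gauge_of _ m (f m *: jet_rep (mu m) + jet_rep (nu m))); last first.
  by rewrite jet_sectionD jscaleE jet_as_section.
rewrite gaugeDE gscaleE sectionD fscaleE !jet_to_gaugeE.
by rewrite ![bracket L _ v]bracket_skew bracket_linear opprD -scalerN.
Qed.

Lemma pairing_skew mu nu : pairing (pi mu) nu = - pairing (pi nu) mu.
Proof.
apply: sections_ext => m; rewrite sectionN !pairingE !jet_to_gaugeE.
by rewrite [in LHS]bracket_skew.
Qed.

Definition jet_anchor mu f : Cinf M := vf_app (anchor_field (value_section mu)) f.

Lemma jet_to_gauge_symbol mu : gauge_symbol (pi mu) (anchor_field (value_section mu)).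
Proof. by move=> f u m; rewrite !jet_to_gaugeE bracket_fscale. Qed.

Lemma jet_to_gauge_fscale mu f u :
  pi mu (fscale f u) = fscale f (pi mu u) + fscale (jet_anchor mu f) u.
Proof. by apply: sections_ext => m; rewrite jet_to_gauge_symbol. Qed.

Lemma prolongN u : prolong (- u) = - prolong u.
Proof.
apply: jet_sections_ext => m; rewrite jet_sectionN !prolongE.
by rewrite -[in LHS]scaleN1r jet_ofZ scaleN1r.
Qed.

Lemma jet_bracket_skew mu nu : jet_bracket L mu nu = - jet_bracket L nu mu.
Proof.
rewrite /jet_bracket pairing_skew prolongN opprK !opprB addrC.
by rewrite addrA addrAC.
Qed.

Lemma pairing_jet_bracket e mu nu : pairing e (jet_bracket L mu nu) =
  (pi mu (pairing e nu) - pairing (gauge_bracket (pi mu) e) nu)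
  - (pi nu (pairing e mu) - pairing (gauge_bracket (pi nu) e) mu)
  - e (pairing (pi mu) nu).
Proof. by rewrite /jet_bracket !pairingB !lie_derivativeE pairing_prolong. Qed.

Lemma jet_bracket_prolong u v : jet_bracket L (prolong u) (prolong v) = prolong [u, v].
Proof.
rewrite /jet_bracket !jet_to_gauge_prolong !lie_derivative_prolong pairing_prolong !adjointE.
by rewrite [bracket L v u]bracket_skew prolongN opprK addrK.
Qed.

Lemma fscale_lin f (a : R) u v : fscale f (a *: u + v) = a *: fscale f u + fscale f v.
Proof.
by apply: sections_ext => m; rewrite section_linE !fscaleE section_linE scalerDr !scalerA mulrC.
Qed.
Lemma fscaleD f u v : fscale f (u + v) = fscale f u + fscale f v.
Proof. by have := fscale_lin f 1 u v; rewrite !scale1r. Qed.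
Lemma fscaleN f u : fscale f (- u) = - fscale f u.
Proof. by apply: sections_ext => m; rewrite sectionN !fscaleE sectionN scalerN. Qed.

Lemma gauge_bracket_jscale f nu nu' e :
  gauge_bracket (pi (jscale f nu + nu')) e =
  gscale f (gauge_bracket (pi nu) e) - gscale (vf_app (symbol_of e) f) (pi nu)
   + gauge_bracket (pi nu') e.
Proof.
rewrite jet_to_gauge_jscale gauge_bracket_skew gauge_bracket_gscale.
rewrite [gauge_bracket e (pi nu)]gauge_bracket_skew [gauge_bracket e (pi nu')]gauge_bracket_skew.
apply: gauge_ext => u m; rewrite !(gaugeDE, gaugeNE, gscaleE, sectionD, sectionN, fscaleE).
by rewrite scalerN !opprD !opprK.
Qed.

(** Both sides are compared through their pairings with derivations, where the
    definition of the bracket becomes explicit; the symbols of the test derivation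
    cancel by [pairing_skew]. *)
Lemma jet_bracket_jscaler f mu nu nu' : jet_bracket L mu (jscale f nu + nu') =
  jscale f (jet_bracket L mu nu) + jscale (jet_anchor mu f) nu + jet_bracket L mu nu'.
Proof.
apply: pairing_nondegenerate => e; rewrite -addrA !pairing_jscale !pairing_jet_bracket.
rewrite gauge_bracket_jscale !pairing_jscale jet_to_gauge_jscale.
rewrite !(pairing_gaugeD, pairing_gaugeN, pairing_gscale, gaugeDE, gscaleE).
rewrite !gaugeD jet_to_gauge_fscale gauge_fscaleE.
rewrite (pairing_skew nu mu).
apply: sections_ext => m.
rewrite !(sectionD, sectionN, fscaleE).
exact: jscale_bracket_identity.
Qed.

Lemma jet_bracket_jscalel f mu mu' nu : jet_bracket L (jscale f mu + mu') nu =
  jscale f (jet_bracket L mu nu) - jscale (jet_anchor nu f) mu + jet_bracket L mu' nu.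
Proof.
rewrite jet_bracket_skew jet_bracket_jscaler (jet_bracket_skew mu nu) (jet_bracket_skew mu' nu).
move: (jet_bracket L nu mu) (jet_bracket L nu mu') => X Y; apply: jet_sections_ext => m; rewrite !(jet_sectionD, jet_sectionN, jscaleE) !opprD.
by rewrite scalerN.
Qed.

End JetAlgebroid.

(** * Multilinear and skew-symmetric maps *)

Section MoreSlots.
Variable T : Type.

(** Reduction of a property of families to families with all entries in [Q]; used
    with [Q] the prolongations of sections, to which each entry is reduced by
    expanding it in a local frame. *)
Lemma slot_ind k (P : ('I_k -> T) -> Prop) (Q : T -> Prop) :
  (forall x i, (forall y, Q y -> P (set_slot x i y)) -> P x) ->
  (forall x, (forall i, Q (x i)) -> P x) -> forall x, P x.
Proof.
move=> step base x.
suff H l : forall x, (forall i : 'I_k, (l <= i)%N -> Q (x i)) -> P x.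
  by apply: (H k) => i; rewrite leqNgt ltn_ord.
elim: l => [|l IH] {}x Qx; first by apply: base => i; exact: Qx.
have [lk|kl] := ltnP l k; last first.
  by apply: IH => i li; case: (leqP k i) => [|/(leq_trans _) h]; [rewrite leqNgt ltn_ord|exfalso; have := ltn_ord i; rewrite ltnNge (leq_trans kl li)].
apply: (step x (Ordinal lk)) => y Qy; apply: IH => i li; rewrite /set_slot.
case: eqP => [//|/eqP il]; apply: Qx; rewrite ltn_neqAle li andbT.
by apply: contra_neq il => li'; apply: val_inj.
Qed.

Lemma slotwise_eq k (X : Type) (F : ('I_k -> T) -> X) (e : T -> T -> Prop) :
  (forall x i y y', e y y' -> F (set_slot x i y) = F (set_slot x i y')) ->
  forall x x', (forall i, e (x i) (x' i)) -> F x = F x'.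
Proof.
move=> H x x' xx'.
suff K l : (l <= k)%N -> F (fun i : 'I_k => if (i < l)%N then x' i else x i) = F x.
  rewrite -(K k (leqnn k)); congr F; apply/funext => i.
  by rewrite ltn_ord.
elim: l => [|l IH] lk; first by congr F; apply/funext.
rewrite -IH ?(ltnW lk) //; pose p := Ordinal lk.
have -> : (fun i : 'I_k => if (i < l.+1)%N then x' i else x i) =
    set_slot (fun i : 'I_k => if (i < l)%N then x' i else x i) p (x' p).
  apply/funext => i; rewrite /set_slot ltnS leq_eqVlt -val_eqE /=.
  by case: eqP => //= E; congr x'; apply: val_inj.
rewrite -(H _ p _ _ (xx' p)); congr F; apply/funext => i; rewrite /set_slot.
by case: eqP => // ->; rewrite ltnn.
Qed.

Lemma snoc_last k (x : 'I_k -> T) y : snoc x y ord_max = y.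
Proof. by rewrite /snoc unlift_none. Qed.

Lemma snoc_lift k (x : 'I_k -> T) y i : snoc x y (lift ord_max i) = x i.
Proof. by rewrite /snoc liftK. Qed.

Lemma set_slot_last k (x : 'I_k.+1 -> T) y : set_slot x ord_max y = snoc (x \o lift ord_max) y.
Proof.
apply/funext => i; rewrite /set_slot /snoc.
by case: unliftP => [j ->|->]; rewrite ?eqxx // eq_sym (negbTE (neq_lift _ _)).
Qed.

Lemma snoc_set_slot k (x : 'I_k -> T) i y z :
  snoc (set_slot x i z) y = set_slot (snoc x y) (lift ord_max i) z.
Proof.
apply/funext => j; rewrite /set_slot /snoc.
by case: unliftP => [l ->|->]; rewrite ?(inj_eq (@lift_inj _ _)) ?(negbTE (neq_lift _ _)).
Qed.

Lemma set_slot_swap k (x : 'I_k.+1 -> T) i y :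
  set_slot x i y = set_slot (x \o tperm i ord_max) ord_max y \o tperm i ord_max.
Proof.
apply/funext => j; rewrite /set_slot /=; case: tpermP => [->|->|/eqP ji /eqP jm].
- by rewrite !eqxx.
- by rewrite eq_sym tpermL.
- by rewrite (negbTE ji) (negbTE jm) tpermD // eq_sym.
Qed.

Lemma snoc_perm k (x : 'I_k -> T) y (s : 'S_k) :
  snoc (x \o s) y = snoc x y \o lift_perm ord_max ord_max s.
Proof.
apply/funext => j /=; rewrite [LHS]/snoc.
by case: unliftP => [l ->|->]; rewrite ?lift_perm_lift ?lift_perm_id ?snoc_lift ?snoc_last.
Qed.

Lemma snoc_exchange k (x : 'I_k -> T) i y z :
  snoc (set_slot x i y) z = snoc (set_slot x i z) y \o tperm (lift ord_max i) ord_max.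
Proof.
apply/funext => j /=; case: tpermP => [->|->|/eqP ji /eqP jm].
- by rewrite snoc_last snoc_lift set_slot_eq.
- by rewrite snoc_last snoc_lift set_slot_eq.
- rewrite !snoc_set_slot !set_slot_neq //; move: jm; rewrite /snoc.
  by case: unliftP => [//|->]; rewrite eqxx.
Qed.

End MoreSlots.

Lemma comp_set_slot (T T' : Type) (h : T -> T') k (x : 'I_k -> T) i y :
  h \o set_slot x i y = set_slot (h \o x) i (h y).
Proof. by apply/funext => j; rewrite /set_slot /=; case: eqP. Qed.

Lemma comp_snoc (T T' : Type) (h : T -> T') k (x : 'I_k -> T) y :
  h \o snoc x y = snoc (h \o x) (h y).
Proof. by apply/funext => j; rewrite /snoc /=; case: unlift. Qed.

Section MultilinearSlots.
Variables (R : comPzRingType) (V W : lmodType R).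

Lemma slot_multilinear k (c : ('I_k -> V) -> W) :
  (forall i x a y z, c (set_slot x i (a *: y + z)) = a *: c (set_slot x i y) + c (set_slot x i z)) ->
  multilinear c.
Proof. by move=> H i x a y z; rewrite !set_slot_eta H. Qed.

Lemma multilinear0 k (c : ('I_k -> V) -> W) i x : multilinear c -> c (set_slot x i 0) = 0.
Proof.
move=> cl; have := multilinear_slot cl i x (-1) 0 0.
by rewrite scaleN1r addNr scaleN1r addNr.
Qed.

Lemma multilinear_sum k (c : ('I_k -> V) -> W) i x (I : finType) (a : I -> R) (y : I -> V) :
  multilinear c ->
  c (set_slot x i (\sum_b a b *: y b)) = \sum_b a b *: c (set_slot x i (y b)).
Proof.
move=> cl; elim: (index_enum I) => [|b s IH]; first by rewrite !big_nil multilinear0.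
by rewrite !big_cons multilinear_slot // IH.
Qed.

Lemma skew_slot_last k (c : ('I_k.+1 -> V) -> W) i x : skew_symmetric c ->
  exists (b : bool) x', forall y, c (set_slot x i y) = (-1) ^+ b *: c (snoc x' y).
Proof.
move=> cs; exists (tperm i ord_max : 'S_k.+1), ((x \o tperm i ord_max) \o lift ord_max) => y.
by rewrite set_slot_swap cs set_slot_last.
Qed.

Lemma multilinear_snoc k (c : ('I_k.+1 -> V) -> W) x a y z : multilinear c ->
  c (snoc x (a *: y + z)) = a *: c (snoc x y) + c (snoc x z).
Proof.
move=> cl; have [x' E] : exists x', forall t, snoc x t = set_slot x' ord_max t.
  exists (snoc x 0) => t; rewrite set_slot_last; congr (snoc _ _).
  by apply/funext => i; rewrite /= snoc_lift.
by rewrite !E multilinear_slot.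
Qed.

Lemma skew_exchange k (c : ('I_k.+1 -> V) -> W) x i y z : skew_symmetric c ->
  c (snoc (set_slot x i y) z) = - c (snoc (set_slot x i z) y).
Proof.
move=> cs; rewrite snoc_exchange cs odd_tperm eq_sym neq_lift.
by rewrite expr1 scaleN1r.
Qed.

Lemma skew_snoc k (c : ('I_k.+1 -> V) -> W) x (s : 'S_k) y : skew_symmetric c ->
  c (snoc (x \o s) y) = (-1) ^+ s *: c (snoc x y).
Proof. by move=> cs; rewrite snoc_perm cs odd_lift_perm addbb. Qed.

End MultilinearSlots.

(** * The kernel of the projection from jets to values *)

Section Kernel.
Variables (R : realType) (n : nat) (M : manifold R n) (r : nat) (A : vbundle M r).
Implicit Types (u : sections A) (f g : Cinf M) (d e : gauge A).

Lemma tangent_ext (m : M) (v w : tangent m) : (forall f, v f = w f) -> v = w.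
Proof. by move=> vw; apply: val_inj; apply/funext => f; exact: vw. Qed.

Lemma tangent_linE (m : M) (a : R) (v w : tangent m) f : (a *: v + w : tangent m) f = a * v f + w f.
Proof. by []. Qed.

Lemma tangent_sumE (m : M) (I : finType) (a : I -> R) (v : I -> tangent m) f :
  (\sum_b a b *: v b : tangent m) f = \sum_b a b * v b f.
Proof. by elim/big_rec2: _ => [//|b y z _ <-]. Qed.

Lemma hom_TA_lin (m : M) (h : hom_TA A m) a (v w : tangent m) : h (a *: v + w) = a *: h v + h w.
Proof. exact: (sub_valP h). Qed.

Lemma hom_TA0 (m : M) (h : hom_TA A m) : h 0 = 0.
Proof. by have := hom_TA_lin h (-1) 0 0; rewrite scaleN1r addNr scaleN1r addNr. Qed.

Lemma hom_TA_sum (m : M) (h : hom_TA A m) (I : finType) (a : I -> R) (v : I -> tangent m) :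
  h (\sum_b a b *: v b) = \sum_b a b *: h (v b).
Proof.
by elim: (index_enum I) => [|b s IH]; rewrite ?big_nil ?hom_TA0 // !big_cons hom_TA_lin IH.
Qed.

Lemma hom_TA_ext (m : M) (h h' : hom_TA A m) : (forall v, h v = h' v) -> h = h'.
Proof. by move=> hh; apply: val_inj; apply/funext => v; exact: hh. Qed.

Lemma tangent_frame (m : M) : exists (x : 'I_n -> Cinf M) (D : 'I_n -> tangent m),
  (forall i, x i m = 0) /\ forall v : tangent m, v = \sum_i v (x i) *: D i.
Proof.
have [c Ac cm] := atlas_cover m; have [x [x0 xE]] := tangent_coordinates Ac cm.
exists x, (fun i => coord_tangent i Ac cm); split=> // v.
by apply: tangent_ext => f; rewrite tangent_sumE xE.
Qed.

(** In terms of a basis D_i of the tangent space with dual functions x_i, the map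
    sends eta to the jet of the sum of the x_i u_i, where u_i(m) = eta(D_i). Its
    pairing with a derivation e is eta applied to the symbol of e, which shows
    that the choices do not matter and that the map has the required properties. *)
Lemma hom_to_jetP (m : M) : linear (@hom_to_jet _ _ _ _ A m) /\
  forall f u, hom_to_jet (df_tensor m f u) = jet_of m (fscale f u) - f m *: jet_of m u.
Proof.
have [x [D [x0 xD]]] := tangent_frame m.
have [U UE] := choice (@section_through _ _ _ _ A m).
pose h (eta : hom_TA A m) : jet A m := jet_of m (\sum_i fscale (x i) (U (eta (D i)))).
have hE e eta : e (jet_rep (h eta)) m = eta (symbol_of e m).
  rewrite gauge_jet gauge_sum section_sum [in RHS](xD (symbol_of e m)) hom_TA_sum.
  by apply: eq_bigr => i _; rewrite gauge_fscale x0 scale0r add0r UE.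
rewrite /hom_to_jet; case: xgetP => [h' _ //|/(_ h)[]]; split=> [a eta eta'|f u].
  by apply: jet_nondegenerate => e; rewrite gauge_jet_lin !hE.
have -> : jet_of m (fscale f u) - f m *: jet_of m u = jet_of m (- f m *: u + fscale f u).
  by rewrite jet_of_lin scaleNr addrC.
apply: jet_nondegenerate => e; rewrite hE gauge_jet gaugeD gaugeZ sectionD sectionZ gauge_fscale.
by rewrite scaleNr addKr.
Qed.

(** An explicit representative, obtained from linearity and from the decomposition
    eta = sum_i dx_i (x) eta(D_i). *)
Lemma hom_to_jet_span (m : M) : exists (x : 'I_n -> Cinf M) (D : 'I_n -> tangent m),
  [/\ forall i, x i m = 0, forall v : tangent m, v = \sum_i v (x i) *: D i &
  forall (eta : hom_TA A m) (u : 'I_n -> sections A), (forall i, u i m = eta (D i)) ->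
    hom_to_jet eta = jet_of m (\sum_i fscale (x i) (u i))].
Proof.
have [x [D [x0 xD]]] := tangent_frame m; exists x, D; split=> // eta u uE.
have [hl hE] := hom_to_jetP m.
have h0 : hom_to_jet (0 : hom_TA A m) = 0.
  by have := hl (-1) 0 0; rewrite scaleN1r addNr scaleN1r addNr.
have hsum (s : seq 'I_n) : hom_to_jet (\sum_(i <- s) df_tensor m (x i) (u i)) =
    \sum_(i <- s) jet_of m (fscale (x i) (u i)).
  elim: s => [|i s IH]; first by rewrite !big_nil.
  rewrite !big_cons; have := hl 1 (df_tensor m (x i) (u i)) (\sum_(j <- s) df_tensor m (x j) (u j)).
  by rewrite !scale1r IH hE x0 scale0r subr0.
rewrite jet_of_sum -hsum; congr hom_to_jet; apply: hom_TA_ext => v.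
have -> : (\sum_i df_tensor m (x i) (u i) : hom_TA A m) v = \sum_i v (x i) *: u i m.
  by elim/big_rec2: _ => [//|i a b _ <-].
by rewrite [in LHS](xD v) hom_TA_sum; apply: eq_bigr => i _; rewrite uE.
Qed.

End Kernel.

(** * From multiderivations to cochains on jets *)

Section MultiderivationsToJets.
Variables (R : realType) (n : nat) (M : manifold R n) (r : nat) (A : vbundle M r).
Implicit Types (f g : Cinf M) (d e : gauge A).

Definition jet_extension k (D : ('I_k -> sections A) -> sections A) : fibre_cochain A k :=
  fun m mu => D (fun i => jet_rep (mu i)) m.

Arguments jet_extension {k} D _ _.

Lemma multiderivation_form k (D : ('I_k.+1 -> sections A) -> sections A) :
  is_multiderivation D -> is_form D.
Proof. by case. Qed.

Lemma multiderivation_point k (D : ('I_k.+1 -> sections A) -> sections A) u (m : M) :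
  is_multiderivation D -> exists w, @point_derivation _ _ _ _ A m (fun v => D (snoc u v) m) w.
Proof.
move=> [[Dl _] [s _ sD]]; exists (s m (fun i => u i m)); split=> [a v w|f v]; last exact: sD.
by rewrite multilinear_snoc.
Qed.

Lemma multiderivation_null k (D : ('I_k -> sections A) -> sections A) u i v (m : M) :
  is_multiderivation D -> null_jet_space A m v -> D (set_slot u i v) m = 0.
Proof.
case: k D u i => [D u []//|k D u i DD nv].
have [_ Ds] := multiderivation_form DD.
have [b [u' ->]] := skew_slot_last i u Ds; rewrite sectionZ.
have [w dw] := multiderivation_point u' m DD.
by have /= -> := null_jet_derivation dw nv; rewrite scaler0.
Qed.

Lemma multiderivation_slot k (D : ('I_k -> sections A) -> sections A) u i a v w :
  is_multiderivation D ->
  D (set_slot u i (a *: v + w)) = a *: D (set_slot u i v) + D (set_slot u i w).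
Proof.
by case: k D u i => [D u []//|k D u i /multiderivation_form [Dl _]]; rewrite multilinear_slot.
Qed.

Lemma multiderivation_jet_slot k (D : ('I_k -> sections A) -> sections A) u i v v' (m : M) :
  is_multiderivation D -> jet_of m v = jet_of m v' ->
  D (set_slot u i v) m = D (set_slot u i v') m.
Proof.
move=> DD /quot_piP nv.
have -> : v = 1 *: (v - v') + v' by rewrite scale1r subrK.
by rewrite multiderivation_slot // section_linE multiderivation_null // scaler0 add0r.
Qed.

(** Replace the arguments one by one: in each of them D is, up to sign, a derivation
    at m, and these kill sections with vanishing jet. *)
Lemma multiderivation_jet k (D : ('I_k -> sections A) -> sections A) u u' (m : M) :
  is_multiderivation D -> (forall i, jet_of m (u i) = jet_of m (u' i)) ->
  D u m = D u' m.
Proof.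
move=> DD; apply: (slotwise_eq (F := fun u => D u m) (e := fun v v' => jet_of m v = jet_of m v')).
by move=> x i y y'; exact: multiderivation_jet_slot.
Qed.

Lemma jet_extension_of k (D : ('I_k -> sections A) -> sections A) u (m : M) :
  is_multiderivation D -> jet_extension D m (fun i => jet_of m (u i)) = D u m.
Proof. by move=> DD; apply: multiderivation_jet => // i; rewrite jet_repK. Qed.

Lemma jet_extension_form k (D : ('I_k -> sections A) -> sections A) (m : M) :
  is_multiderivation D -> is_form (jet_extension D m).
Proof.
move=> DD; split.
  apply: slot_multilinear => i x a y z; rewrite /jet_extension.
  have E t : (fun l => jet_rep (set_slot x i t l)) = set_slot (fun l => jet_rep (x l)) i (jet_rep t).
    exact: (comp_set_slot (@jet_rep _ _ _ _ A m) x i t).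
  rewrite !E -section_linE -multiderivation_slot //; apply: multiderivation_jet_slot => //.
  by rewrite jet_repK -jet_as_section.
case: k D DD => [|k] D DD s x; last first.
  have [_ Ds] := multiderivation_form DD.
  by rewrite /jet_extension -sectionZ -Ds.
have -> : s = 1%g by apply/permP => -[].
have -> : x \o (1%g : 'S_0) = x by apply/funext => -[].
by rewrite odd_perm1 expr0 scale1r.
Qed.

(** On prolongations this is D itself; each argument is reduced to prolongations by
    a local frame of jets. *)
Lemma jet_extension_smooth k (D : ('I_k -> sections A) -> sections A) :
  is_multiderivation D -> forall mu : 'I_k -> jet_sections A,
  section_space A (fun m => jet_extension D m (fun i => mu i m)).
Proof.
move=> DD; apply: (slot_ind (Q := fun nu => exists u, nu = prolong u)) => [mu i H|mu H].
  apply: sections_glue => m0; have [I [E [V [oV Vm0 LF]]]] := local_jet_frame A m0.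
  have [a aE] := LF (mu i).
  have S b : section_space A (fun m => jet_extension D m (fun l => set_slot mu i (prolong (E b)) l m)).
    by apply: H; exists (E b).
  exists V, (\sum_b fscale (a b) (sub_mk (S b))); split=> // m Vm.
  have [Fl _] := jet_extension_form m DD.
  have E' (nu : jet_sections A) : (fun l => set_slot mu i nu l m) = set_slot (fun l => mu l m) i (nu m).
    exact: (comp_set_slot (fun nu : jet_sections A => nu m) mu i nu).
  rewrite section_sum; transitivity (\sum_b a b m *: jet_extension D m (set_slot (fun l => mu l m) i (jet_of m (E b)))).
    by rewrite -multilinear_sum // -aE // set_slot_id.
  apply: eq_bigr => b _; rewrite fscaleE; congr (_ *: _).
  by rewrite -(prolongE (E b) m) -E'.
have [u uE] := choice H.
suff -> : (fun m => jet_extension D m (fun i => mu i m)) = (fun m => D u m) by exact: (sub_valP (D u)).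
apply: functional_extensionality_dep => m; rewrite -jet_extension_of //.
by congr (jet_extension D m _); apply/funext => i; rewrite uE.
Qed.

Lemma jet_extension_snoc k (D : ('I_k.+1 -> sections A) -> sections A) (m : M)
    (mu : 'I_k -> jet A m) (x : jet A m) :
  jet_extension D m (snoc mu x) = D (snoc (fun i => jet_rep (mu i)) (jet_rep x)) m.
Proof.
have E : (fun i => jet_rep (snoc mu x i)) = snoc (fun i => jet_rep (mu i)) (jet_rep x).
  exact: (comp_snoc (@jet_rep _ _ _ _ A m) mu x).
by rewrite /jet_extension E.
Qed.

Lemma jet_extension_gauge k (D : ('I_k.+1 -> sections A) -> sections A) :
  is_multiderivation D -> in_gauge (jet_extension D).
Proof.
move=> DD m mu; pose u i := jet_rep (mu i).
have [[Dl Ds] [s [sf ss] sD]] := DD.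
have G : gauge_space A (fun v => D (snoc u v)).
  split=> [a v w|]; first by rewrite multilinear_snoc.
  by exists (sub_mk (ss u)) => f v x; exact: sD.
exists (sub_mk G) => v; rewrite jet_extension_snoc; apply: multiderivation_jet => // i.
by rewrite /snoc; case: unlift => // ; rewrite jet_repK.
Qed.

Lemma jet_extension_symbol k (D : ('I_k.+1 -> sections A) -> sections A) :
  is_multiderivation D -> has_symbol (jet_extension D).
Proof.
move=> DD m; have [[Dl Ds] [s [sf ss] sD]] := DD.
exists (s m) => // mu eta.
have [x [T [x0 xT spanE]]] := hom_to_jet_span A m.
have [U UE] := choice (@section_through _ _ _ _ A m).
pose u i := jet_rep (mu i).
rewrite (spanE eta (fun i => U (eta (T i)))) ?jet_extension_snoc //.
set z := \sum_i _.
transitivity (D (snoc u z) m).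
  by apply: multiderivation_jet => // i; rewrite /snoc; case: unlift => //; rewrite jet_repK.
have [w [dl dM]] := multiderivation_point u m DD.
have D0 : D (snoc u 0) m = 0 by have := dl (-1) 0 0; rewrite scaleN1r addNr scaleN1r addNr.
have -> : D (snoc u z) m = \sum_i D (snoc u (fscale (x i) (U (eta (T i))))) m.
  rewrite /z; elim: (index_enum 'I_n) => [|i l IH]; first by rewrite !big_nil.
  have := dl 1 (fscale (x i) (U (eta (T i)))) (\sum_(j <- l) fscale (x j) (U (eta (T j)))).
  by rewrite !big_cons !scale1r IH.
rewrite [in RHS](xT (s m (fun i => jet_value (mu i)))) hom_TA_sum.
by apply: eq_bigr => i _; rewrite sD x0 scale0r add0r UE.
Qed.

Lemma jet_extension_cochain k (D : def_cochains A k) :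
  jet_cochain_space A k (jet_extension (def_eval D)).
Proof.
have DD : is_multiderivation (def_eval D) by exact: sub_valP.
split; first split=> [m|mu]; [exact: jet_extension_form|exact: jet_extension_smooth|].
case: k D DD => [//|k] D DD /=; case: ifP => _; first exact: jet_extension_symbol.
exact: jet_extension_gauge.
Qed.

Definition to_jet_cochain k (D : def_cochains A k) : jet_cochains A k := sub_mk (jet_extension_cochain D).

Lemma to_jet_cochainE k (D : def_cochains A k) u :
  jet_eval (to_jet_cochain D) (fun i => prolong (u i)) = def_eval D u.
Proof.
apply: sections_ext => m; exact: (jet_extension_of u m (sub_valP D)).
Qed.

End MultiderivationsToJets.

(** * From cochains on jets to multiderivations *)

Section JetsToMultiderivations.
Variables (R : realType) (n : nat) (M : manifold R n) (r : nat) (A : vbundle M r).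
Implicit Types (f g : Cinf M) (d e : gauge A).

Lemma rank0_section (m : M) (x : A m) : r = 0%N -> x = 0.
Proof.
move=> r0; have [t _ tm] := trivs_cover A m; apply: (tcoord_inj tm) => j.
by have := ltn_ord j; rewrite [X in (_ < X)%N -> _]r0.
Qed.

Lemma rank_gt0_nonzero (m : M) : (0 < r)%N -> exists v : sections A,
  forall a : R, a *: v m = 0 -> a = 0.
Proof.
move=> r0; have [c [t [Ac tt cm tm [b]]]] := exists_frame A m.
pose j := Ordinal r0; exists (frame_section tt b j) => a.
move=> /(congr1 (fun x => tmap t m x 0 j)).
by rewrite linearZ linear0 !mxE frame_section_center // eqxx mulr1.
Qed.

(** Any v whose value is a basis vector of a frame different from one that occurs
    in x; when x = 0, any nonvanishing v. *)
Lemma rank_ge2_independent (m : M) (x : A m) : (1 < r)%N -> exists v : sections A,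
  forall a b : R, a *: v m = b *: x -> a = 0.
Proof.
move=> r2; have [c [t [Ac tt cm tm [b]]]] := exists_frame A m.
have E l a y : a *: frame_section tt b l m = y -> forall j, a * (j == l)%:R = tmap t m y 0 j.
  by move=> <- j; rewrite linearZ mxE frame_section_center.
have [[j xj]|x0] := pselect (exists j, tmap t m x 0 j != 0).
  have [l lj] : exists l : 'I_r, l != j.
    case: (eqVneq j (Ordinal (ltnW r2))) => [->|j0].
      by exists (Ordinal r2); rewrite -val_eqE.
    by exists (Ordinal (ltnW r2)); rewrite eq_sym.
  exists (frame_section tt b l) => a a' /E H.
  have := H j; rewrite linearZ mxE eq_sym (negbTE lj) mulr0 => /esym/eqP.
  rewrite mulf_eq0 (negbTE xj) orbF => /eqP a'0.
  by have := H l; rewrite linearZ mxE eqxx mulr1 a'0 mul0r.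
exists (frame_section tt b (Ordinal r2)) => a a' /E /(_ (Ordinal r2)).
rewrite eqxx mulr1 linearZ mxE => ->; apply/eqP; rewrite mulf_eq0.
by apply/orP; right; apply: contrapT => /negP h; apply: x0; exists (Ordinal r2).
Qed.

(** The decomposition of u in a frame: the square of the bump function has value 1
    at m and u(m) = 0, so that multiplying by it leaves the jet of u unchanged. *)
Lemma vanishing_jet (m : M) (u : sections A) : u m = 0 ->
  exists (g : 'I_r -> Cinf M) (v : 'I_r -> sections A),
    (forall l, g l m = 0) /\ jet_of m u = \sum_l jet_of m (fscale (g l) (v l)).
Proof.
move=> um; have [c [t [Ac tt cm tm [b]]]] := exists_frame A m.
exists (fun l => frame_coord tt b l u), (frame_section tt b); split=> [l|].
  by rewrite frame_coordE /tcoord -[section_dfun u m]/(u m) um linear0 mxE mulr0.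
rewrite -jet_of_sum -frame_decomposition; apply/jet_ofP => d.
by rewrite gauge_fscale um scaler0 addr0 Cinf_mulE bump_center mul1r scale1r.
Qed.

(** Near each point h is the coordinate of h e, where e belongs to a local frame. *)
Lemma Cinf_of_scaled (h : M -> R) : (0 < r)%N ->
  (forall v : sections A, section_space A (fun m => h m *: v m)) -> Cinf_space M h.
Proof.
move=> r0 H; apply: Cinf_glue => m.
have [c [t [Ac tt cm tm [b]]]] := exists_frame A m.
pose j := Ordinal r0; pose v : sections A := sub_mk (H (frame_section tt b j)).
exists (bump_nbhd b), (frame_coord tt b j v); split; [exact: bump_open|exact: bump_mem|].
move=> x Vx; have [_ tx] := bump_nbhd_sub Vx.
rewrite frame_coordE bump_eq1 // mul1r /tcoord -[section_dfun v x]/(h x *: frame_section tt b j x).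
rewrite linearZ mxE; have := frame_sectionE tt b j j tx.
by rewrite /tcoord /section_at => ->; rewrite bump_eq1 // eqxx !mulr1.
Qed.

(** The Leibniz rule of w at m in its last argument, on jets of sections. *)
Definition symbol_at k (m : M) (w : ('I_k.+1 -> jet A m) -> A m)
    (mu : 'I_k -> jet A m) (X : tangent m) : Prop :=
  forall f v, w (snoc mu (jet_of m (fscale f v))) =
    f m *: w (snoc mu (jet_of m v)) + X f *: v m.

Lemma symbol_at_unique k (m : M) (w : ('I_k.+1 -> jet A m) -> A m) mu X Y : (0 < r)%N ->
  symbol_at w mu X -> symbol_at w mu Y -> X = Y.
Proof.
move=> r0 HX HY; apply: tangent_ext => f; have [v vP] := rank_gt0_nonzero m r0.
have := HX f v; rewrite HY => /addrI/eqP; rewrite -subr_eq0 -scalerBl => /eqP/vP/eqP.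
by rewrite subr_eq0 eq_sym => /eqP.
Qed.

Lemma symbol_at_lin k (m : M) (w : ('I_k.+1 -> jet A m) -> A m) mu i a y z X Y :
  is_form w -> symbol_at w (set_slot mu i y) X -> symbol_at w (set_slot mu i z) Y ->
  symbol_at w (set_slot mu i (a *: y + z)) (a *: X + Y).
Proof.
move=> [wl _] HX HY f v; rewrite !snoc_set_slot !multilinear_slot //.
rewrite -!snoc_set_slot HX HY tangent_linE !scalerDr scalerDl !scalerA [f m * a]mulrC.
by rewrite addrACA.
Qed.

Lemma symbol_at_skew k (m : M) (w : ('I_k.+1 -> jet A m) -> A m) mu (s : 'S_k) X :
  is_form w -> symbol_at w mu X -> symbol_at w (mu \o s) ((-1) ^+ s *: X).
Proof.
move=> [_ ws] HX f v; rewrite !skew_snoc // HX scalerDr !scalerA [f m * _]mulrC.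
by congr (_ + _).
Qed.

Lemma in_gauge_symbol k (w : fibre_cochain A k.+1) (m : M) mu : in_gauge w ->
  exists X, symbol_at (w m) mu X.
Proof.
move=> wg; have [d dE] := wg m mu; exists (symbol_of d m) => f v.
by rewrite !dE gauge_fscale.
Qed.

(** By multilinearity it is enough to change the i-th argument by a jet of a section
    vanishing at m, that is, by a combination of the jets of g v with g(m) = 0.
    Exchange this argument with the last one, taken of the form f y2 - f(m) y2:
    the symbol along one of them multiplies y2, along the other one it multiplies
    v, and y2 can be chosen independent of v(m). *)
Lemma symbol_at_value k (w : fibre_cochain A k.+1) (m : M) (sg : ('I_k -> jet A m) -> tangent m) :
  is_form (w m) -> (k = 0)%N \/ (1 < r)%N -> (forall mu, symbol_at (w m) mu (sg mu)) ->
  forall mu mu' : 'I_k -> jet A m, (forall i, jet_value (mu i) = jet_value (mu' i)) -> sg mu = sg mu'.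
Proof.
move=> wf [k0|r2] sgP.
  by move=> mu mu' _; congr sg; apply/funext => i; have := ltn_ord i; rewrite [X in (_ < X)%N -> _]k0.
have r0 : (0 < r)%N by exact: ltnW.
have sl : multilinear sg.
  apply: slot_multilinear => i x a y z; apply: symbol_at_unique (sgP _) _ => //.
  exact: symbol_at_lin.
apply: (slotwise_eq (F := sg) (e := fun y y' => jet_value y = jet_value y')) => mu i y y' yy'.
suff H (u : sections A) : u m = 0 -> sg (set_slot mu i (jet_of m u)) = 0.
  have -> : y = 1 *: jet_of m (jet_rep y - jet_rep y') + y'.
    have := jet_of_lin m (-1) (jet_rep y') (jet_rep y).
    by rewrite !scaleN1r !jet_repK [- _ + _]addrC => ->; rewrite scale1r [- _ + _]addrC subrK.
  rewrite multilinear_slot // H ?scaler0 ?add0r // sectionB.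
  by apply/eqP; rewrite subr_eq0; apply/eqP.
move=> /vanishing_jet [g [v [g0 ->]]].
have -> : \sum_l jet_of m (fscale (g l) (v l)) = \sum_l 1 *: jet_of m (fscale (g l) (v l)).
  by apply: eq_bigr => l _; rewrite scale1r.
rewrite multilinear_sum // big1 // => l _; rewrite scale1r.
apply: tangent_ext => f; have [y2 y2P] := rank_ge2_independent (v l m) r2.
have ws := (wf.2).
pose z := jet_of m (fscale f y2 - f m *: y2).
have := sgP (set_slot mu i (jet_of m (fscale (g l) (v l)))) f y2.
have zE x : w m (snoc x z) = w m (snoc x (jet_of m (fscale f y2))) - f m *: w m (snoc x (jet_of m y2)).
  rewrite /z; have -> : fscale f y2 - f m *: y2 = (- f m) *: y2 + fscale f y2 by rewrite scaleNr addrC.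
  by rewrite jet_of_lin multilinear_snoc ?scaleNr 1?addrC //; exact: (wf.1).
move=> E; have : w m (snoc (set_slot mu i (jet_of m (fscale (g l) (v l)))) z) =
   sg (set_slot mu i (jet_of m (fscale (g l) (v l)))) f *: y2 m.
  by rewrite zE E addrC addrA addNr add0r.
rewrite skew_exchange // (sgP _ (g l) (v l)) g0 scale0r add0r -scaleNr => /esym/y2P.
by [].
Qed.

(** The map on A is obtained from the symbol on jets by choosing a jet above each
    vector. The choice is not linear, but [symbol_at_value] shows that the result
    depends on the values only. *)
Lemma cochain_symbol k (w : jet_cochains A k.+1) (m : M) : (0 < r)%N ->
  exists2 lam : ('I_k -> A m) -> tangent m, is_form lam &
  forall mu, symbol_at (sub_val w m) mu (lam (fun i => jet_value (mu i))).
Proof.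
move=> r0; have [[wf _] wc] := sub_valP w; have wfm := wf m.
move: wc; rewrite /=; case: ifP => [_|kr] wc.
  have [lam lamf lamE] := wc m; exists lam => // mu f v.
  have [_ hE] := hom_to_jetP A m.
  have := lamE mu (df_tensor m f v); rewrite hE.
  have -> : jet_of m (fscale f v) - f m *: jet_of m v = (- f m) *: jet_of m v + jet_of m (fscale f v).
    by rewrite scaleNr addrC.
  rewrite (multilinear_snoc _ _ _ _ wfm.1) scaleNr => E.
  by rewrite -[X in _ = _ + X]E addrA subrr add0r.
have [sg sgP] := choice (fun mu => @in_gauge_symbol k (sub_val w) m mu wc).
have k2 : (k = 0)%N \/ (1 < r)%N.
  case: (posnP k) => [k0|kp]; [by left|right].
  by move: kr; rewrite kp /= => /negbT r1; rewrite ltn_neqAle eq_sym r1.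
have sgV := symbol_at_value wfm k2 sgP.
have [U UE] := choice (@section_through _ _ _ _ A m).
pose jU (x : A m) := jet_of m (U x).
have jUv x : jet_value (jU x) = x by rewrite jet_value_of UE.
exists (fun x => sg (fun i => jU (x i))).
  split=> [|s x].
    apply: slot_multilinear => i x a y z.
    have E t : (fun l => jU (set_slot x i t l)) = set_slot (fun l => jU (x l)) i (jU t).
      exact: (comp_set_slot jU x i t).
    rewrite !E (sgV _ (set_slot (fun l => jU (x l)) i (a *: jU y + jU z))).
      apply: (symbol_at_unique r0 (sgP _)).
      by apply: symbol_at_lin; [exact: wfm|exact: sgP|exact: sgP].
    by move=> l; rewrite /set_slot; case: eqP => // _; rewrite jet_value_lin !jUv.
  exact: (symbol_at_unique r0 (sgP _) (symbol_at_skew s wfm (sgP (fun i => jU (x i))))).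
move=> mu; rewrite (sgV _ mu) // => i; exact: jUv.
Qed.

Definition prolong_cochain k (w : jet_cochains A k) (u : 'I_k -> sections A) : sections A :=
  jet_eval w (fun i => prolong (u i)).

Lemma prolong_cochainE k (w : jet_cochains A k) u (m : M) :
  prolong_cochain w u m = sub_val w m (fun i => jet_of m (u i)).
Proof. by []. Qed.

Lemma prolong_cochain_snoc k (w : jet_cochains A k.+1) u v (m : M) :
  prolong_cochain w (snoc u v) m = sub_val w m (snoc (fun i => jet_of m (u i)) (jet_of m v)).
Proof.
rewrite prolong_cochainE; have E : (fun i => jet_of m (snoc u v i)) = snoc (fun i => jet_of m (u i)) (jet_of m v).
  exact: (comp_snoc (jet_of m) u v).
by rewrite E.
Qed.

Lemma prolong_cochain_form k (w : jet_cochains A k) : is_form (prolong_cochain w).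
Proof.
have [[wf _] _] := sub_valP w; split.
  apply: slot_multilinear => i x a y z; apply: sections_ext => m.
  have E t : (fun l => jet_of m (set_slot x i t l)) = set_slot (fun l => jet_of m (x l)) i (jet_of m t).
    exact: (comp_set_slot (jet_of m) x i t).
  by rewrite section_linE !prolong_cochainE !E jet_of_lin multilinear_slot //; have [] := wf m.
move=> s x; apply: sections_ext => m; rewrite sectionZ !prolong_cochainE.
by have [_ ws] := wf m; rewrite -ws.
Qed.

(** In rank 0 every section vanishes and the symbol is taken to be zero; in positive
    rank the smoothness of the symbol is read off from that of its products with
    sections. *)
Lemma prolong_cochain_multiderivation k (w : jet_cochains A k) :
  is_multiderivation (prolong_cochain w).
Proof.
have wf := prolong_cochain_form w; case: k w wf => [//|k] w wf; split=> //.
have [r0|r0] := posnP r.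
  exists (fun m => 0) => [|u f v m]; last by rewrite [LHS]rank0_section // [RHS]rank0_section.
  by split=> [m|u]; [exact: is_form0|exact: subspace0].
have H m : exists lam : ('I_k -> A m) -> tangent m, is_form lam /\
  forall mu, symbol_at (sub_val w m) mu (lam (fun i => jet_value (mu i))).
  by have [lam lf lE] := cochain_symbol w m r0; exists lam.
pose s m := sval (cid (H m)); have sP m := svalP (cid (H m)).
have sE u f v m : prolong_cochain w (snoc u (fscale f v)) m =
    f m *: prolong_cochain w (snoc u v) m + s m (fun i => u i m) f *: v m.
  rewrite !prolong_cochain_snoc; have [_ sE] := sP m; rewrite sE.
  by congr (_ + _ *: _); congr (tangent_fun (s m _) f); apply/funext => i; rewrite jet_value_of.
exists s => //; split=> [m|u f]; first by have [] := sP m.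
apply: (Cinf_of_scaled r0) => v.
pose X : sections A := prolong_cochain w (snoc u (fscale f v)) - fscale f (prolong_cochain w (snoc u v)).
suff -> : (fun m => s m (fun i => u i m) f *: v m) = (fun m => X m) by exact: (sub_valP X).
apply: functional_extensionality_dep => m.
by rewrite sectionB fscaleE sE addrC addrA addNr add0r.
Qed.

Definition to_multiderivation k (w : jet_cochains A k) : def_cochains A k :=
  @sub_mk _ _ (def_cochain_space A k) _ (prolong_cochain_multiderivation w).

Lemma to_multiderivation_linear k : linear (@to_multiderivation k).
Proof. by move=> a w w'; apply: val_inj; apply/funext => u; apply: sections_ext. Qed.

Lemma to_multiderivationK k : cancel (@to_multiderivation k) (@to_jet_cochain _ _ _ _ A k).
Proof.
move=> w; apply: val_inj; apply: functional_extensionality_dep => m; apply/funext => mu.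
rewrite -[LHS]/(prolong_cochain w (fun i => jet_rep (mu i)) m) prolong_cochainE.
by congr (sub_val w m _); apply/funext => i; rewrite jet_repK.
Qed.

Lemma to_jet_cochainK k : cancel (@to_jet_cochain _ _ _ _ A k) (@to_multiderivation k).
Proof. by move=> D; apply: val_inj; apply/funext => u; exact: to_jet_cochainE. Qed.

End JetsToMultiderivations.

(** * Cohomology of isomorphic complexes *)

Section CohomologyIso.
Variables (R : pzRingType) (C E C' E' : nat -> lmodType R).
Variables (iota : forall k, {linear C k -> E k}) (d : forall k, {linear C k -> E k.+1}).
Variables (iota' : forall k, {linear C' k -> E' k}) (d' : forall k, {linear C' k -> E' k.+1}).
(* The differentials of the two complexes take values in larger spaces E and E',
   between which there is no map: the compatibility of Phi with them is expressed
   by the last two hypotheses. *)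
Variables (Phi : forall k, C k -> C' k) (Psi : forall k, C' k -> C k).
Hypotheses (Phi_lin : forall k, linear (@Phi k))
  (PhiK : forall k, cancel (@Phi k) (@Psi k)) (PsiK : forall k, cancel (@Psi k) (@Phi k))
  (Phi_cocycle : forall k z, d k z = 0 <-> d' k (Phi z) = 0)
  (Phi_coboundary : forall k (z : C k.+1) w,
     iota k.+1 z = d k w <-> iota' k.+1 (Phi z) = d' k (Phi w)).

Lemma Phi0 k : Phi (0 : C k) = 0.
Proof. by have := Phi_lin (-1) (0 : C k) 0; rewrite scaleN1r addNr scaleN1r addNr. Qed.

Lemma is_coboundary_Phi k (z : C k) : is_coboundary iota d z <-> is_coboundary iota' d' (Phi z).
Proof.
case: k z => [|k] z /=.
  split=> [->|z0]; first exact: Phi0.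
  by rewrite -(PhiK z) z0 -Phi0 PhiK.
split=> [[w zw]|[w zw]]; first by exists (Phi w); apply/Phi_coboundary.
by exists (Psi w); apply/Phi_coboundary; rewrite PsiK.
Qed.

Lemma cohomology_iso k : exists f : {linear cohomology iota d k -> cohomology iota' d' k}, bijective f.
Proof.
pose phi (z : sub_lmod (cocycles d k)) : sub_lmod (cocycles d' k) :=
  @sub_mk _ _ (cocycles d' k) (Phi (sub_val z)) ((Phi_cocycle _).1 (sub_valP z)).
have psi_cocycle (z : sub_lmod (cocycles d' k)) : d k (Psi (sub_val z)) = 0.
  by apply: (Phi_cocycle _).2; rewrite PsiK; exact: (sub_valP z).
pose psi (z : sub_lmod (cocycles d' k)) : sub_lmod (cocycles d k) :=
  @sub_mk _ _ (cocycles d k) (Psi (sub_val z)) (psi_cocycle z).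
have phi_lin : linear phi by move=> a y z; apply: val_inj; exact: Phi_lin.
have phiP y z : coboundaries iota d k (y - z) <-> coboundaries iota' d' k (phi y - phi z).
  have E0 : y - z = (-1) *: z + y by rewrite scaleN1r addrC.
  have -> : phi y - phi z = phi (y - z) by rewrite E0 phi_lin scaleN1r addrC.
  exact: is_coboundary_Phi.
pose f (x : cohomology iota d k) : cohomology iota' d' k := quot_pi _ (phi (quot_repr x)).
have fE z : f (quot_pi _ z) = quot_pi _ (phi z).
  by apply/quot_piP/phiP/quot_piP; exact: quot_piK.
have f_lin : linear f.
  move=> a x y; rewrite -[x]quot_piK -[y]quot_piK -quot_pi_linear !fE.
  by rewrite phi_lin quot_pi_linear.
have f_bij : bijective f.
  exists (fun y => quot_pi _ (psi (quot_repr y))) => x.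
    rewrite -[RHS]quot_piK; apply/quot_piP/phiP/quot_piP.
    have -> : phi (psi (quot_repr (f x))) = quot_repr (f x).
      by apply: val_inj; exact: PsiK.
    exact: quot_piK.
  rewrite fE -[RHS]quot_piK; congr quot_pi; apply: val_inj; exact: PsiK.
pose F : {linear cohomology iota d k -> cohomology iota' d' k} :=
  HB.pack f (GRing.isLinear.Build _ _ _ _ f f_lin).
by exists F.
Qed.

End CohomologyIso.

(** * Comparison of the two differentials *)

Section Comparison.
Variables (R : realType) (n : nat) (M : manifold R n) (r : nat) (A : vbundle M r)
  (L : lie_algebroid A).
Implicit Types (f g : Cinf M).

(** C^oo(M)-linearity in each argument. *)
Definition tensorial k (T : ('I_k -> jet_sections A) -> sections A) : Prop :=
  forall p mu f y z,
    T (set_slot mu p (jscale f y + z)) = fscale f (T (set_slot mu p y)) + T (set_slot mu p z).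

Lemma prolong0 : prolong (0 : sections A) = 0.
Proof.
by apply: jet_sections_ext => x; rewrite prolongE; have := jet_ofZ x 0 (0 : sections A); rewrite !scale0r.
Qed.

(** Near m, an argument is a combination of prolongations; multiplying by a bump
    function b supported there makes this an identity of global sections, and
    b(m) = 1 recovers the value of T at m. *)
Lemma tensorial_vanish k (T : ('I_k -> jet_sections A) -> sections A) : tensorial T ->
  (forall u, T (fun i => prolong (u i)) = 0) -> forall mu, T mu = 0.
Proof.
move=> TT T0; apply: (slot_ind (Q := fun nu => exists u, nu = prolong u)) => [mu p H|mu H].
  apply: sections_ext => m.
  have [I [E [V [oV Vm LF]]]] := local_jet_frame A m.
  have [a aE] := LF (mu p); have [b] := exists_bump_at oV Vm.
  have T00 : T (set_slot mu p 0) = 0.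
    by rewrite -prolong0; apply: H; exists 0.
  have TS (s : seq I) (c : I -> Cinf M) :
      T (set_slot mu p (\sum_(l <- s) jscale (c l) (prolong (E l)))) = 0.
    elim: s => [|l s IH]; first by rewrite big_nil.
    rewrite big_cons TT IH addr0 H; last by exists (E l).
    by apply: sections_ext => x; rewrite fscaleE scaler0.
  have := TT p mu b (mu p) 0; rewrite T00 addr0 set_slot_id addr0.
  have -> : jscale b (mu p) = \sum_l jscale (Cinf_mul b (a l)) (prolong (E l)).
    apply: jet_sections_ext => x; rewrite jet_section_sum jscaleE.
    have [Kx|nKx] := EM (bump_supp b x).
      rewrite aE; last exact: bump_sub Kx.
      rewrite scaler_sumr; apply: eq_bigr => l _.
      by rewrite jscaleE prolongE Cinf_mulE scalerA.
    rewrite bump_eq0 // scale0r big1 // => l _.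
    by rewrite jscaleE Cinf_mulE bump_eq0 // mul0r scale0r.
  rewrite TS => /(congr1 (fun w : sections A => w m)).
  by rewrite fscaleE bump_center scale1r => <-.
have [u uE] := choice H; have -> : mu = (fun i => prolong (u i)) by apply/funext => i; exact: uE.
exact: T0.
Qed.

Lemma jet_eval_slot k (w : jet_cochains A k) : tensorial (jet_eval w).
Proof.
move=> p mu f y z; apply: sections_ext => m; rewrite sectionD fscaleE.
have E (nu : jet_sections A) : (fun l => jet_section_at (set_slot mu p nu l) m) =
    set_slot (fun l => jet_section_at (mu l) m) p (nu m).
  exact: (comp_set_slot (fun nu : jet_sections A => nu m) mu p nu).
rewrite -![section_at (jet_eval w _) m]/(sub_val w m (fun l => jet_section_at (set_slot mu p _ l) m)) !E jet_sectionD jscaleE.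
have [[wf _] _] := sub_valP w; have [wl _] := wf m.
exact: multilinear_slot.
Qed.

Lemma jet_eval_form k (w : jet_cochains A k) : is_form (jet_eval w).
Proof.
have [[wf _] _] := sub_valP w; split.
  apply: slot_multilinear => i x a y z.
  have J t : jscale (Cinf_cst M a) t = a *: t by apply: jet_sections_ext.
  have F t : fscale (Cinf_cst M a) t = a *: t :> sections A by apply: sections_ext.
  by rewrite -J jet_eval_slot F.
move=> s x; apply: sections_ext => m; rewrite sectionZ.
by have [_ ws] := wf m; exact: ws.
Qed.

Lemma jet_d_tensorial k (w : jet_cochains A k) : tensorial (jet_d L w).
Proof.
have [wl ws] := jet_eval_form w.
move=> p mu f y z.
apply: (@chevalley_eilenberg_slot R (jet_sections A) (sections A) (jet_bracket L) (jet_to_gauge L)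
  (jscale f) (fscale f) (fun x => jscale (jet_anchor L x f)) (fun x => fscale (jet_anchor L x f))) => //.
- by move=> *; exact: jet_bracket_jscaler.
- by move=> *; exact: jet_bracket_jscalel.
- by move=> y' z' v; rewrite jet_to_gauge_jscale.
- by move=> x v v'; rewrite gaugeD jet_to_gauge_fscale.
- by move=> a u v; exact: fscale_lin.
- by move=> x a u v; exact: fscale_lin.
- by move=> *; exact: jet_eval_slot.
- by move=> *; exact: jet_eval_slot.
Qed.

(** Restriction to prolongations is a map of complexes, since pi(du) = [u, .] and
    [du, dv] = d[u, v]. *)
Lemma jet_d_prolong k (w : jet_cochains A k) u :
  jet_d L w (fun i => prolong (u i)) = def_d L (to_multiderivation w) u.
Proof.
rewrite /jet_d /def_d /chevalley_eilenberg; congr (_ + _); apply: eq_bigr => i _.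
  by rewrite jet_to_gauge_prolong.
apply: eq_bigr => j _; rewrite jet_bracket_prolong; congr (_ *: jet_eval w _).
by apply/funext => l; rewrite /Defs.contract; case: ifP.
Qed.

Lemma def_d_to_multiderivation k (w : jet_cochains A k) (z : jet_cochains A k.+1) :
  jet_eval z = jet_d L w <-> def_eval (to_multiderivation z) = def_d L (to_multiderivation w).
Proof.
split=> [E|E]; first by apply/funext => u; rewrite -jet_d_prolong -E.
have T : tensorial (fun mu => jet_eval z mu - jet_d L w mu).
  move=> p mu f x y /=; rewrite jet_eval_slot jet_d_tensorial.
  by rewrite fscaleD fscaleN opprD addrACA.
apply/funext => mu; apply/eqP; rewrite -subr_eq0; apply/eqP.
apply: (tensorial_vanish T) => u; rewrite jet_d_prolong -E.
by apply/eqP; rewrite subr_eq0.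
Qed.

Lemma cocycle_to_multiderivation k (w : jet_cochains A k) :
  jet_d L w = 0 <-> def_d L (to_multiderivation w) = 0.
Proof.
split=> [E|E]; first by apply/funext => u; rewrite -jet_d_prolong E.
by apply/funext => mu; apply: (tensorial_vanish (jet_d_tensorial w)) => u; rewrite jet_d_prolong E.
Qed.

End Comparison.

Theorem theorem4p1 (R : realType) (n r : nat) (M : manifold R n)
    (A : vbundle M r) (L : lie_algebroid A) (k : nat) :
  exists f : {linear jet_cohomology L k -> def_cohomology L k}, bijective f.
Proof.
apply: (@cohomology_iso _ _ _ _ _ _ _ _ _ (@to_multiderivation _ _ _ _ A) (@to_jet_cochain _ _ _ _ A)).
- exact: to_multiderivation_linear.
- exact: to_multiderivationK.
- exact: to_jet_cochainK.
- by move=> l z; exact: cocycle_to_multiderivation.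
- by move=> l z w; exact: def_d_to_multiderivation.
Qed.
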